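(* A Borel probability measure $\nu$ on $\mathbb{P}^n=\mathbb{P}^n(\mathbb{C})$ is stable (respectively semi-stable) with respect to the $\mathrm{SL}(n+1,\mathbb{C})$-action if and only if for any proper linear subspace $L\subset\mathbb{P}^n$ $$\nu(L)<\frac{\dim L+1}{n+1}\qquad\Big(\text{respectively }\ \nu(L)\le\frac{\dim L+1}{n+1}\Big).$$
   Context: $\mathbb{P}^n$ carries the Fubini-Study metric and the standard action of $K=\mathrm{SU}(n+1)$, with complexification $G=\mathrm{SL}(n+1,\mathbb{C})$. Identifying $\mathfrak{su}(n+1)^*$ with $\mathfrak{su}(n+1)$ by the invariant scalar product $\langle A,B\rangle=-\operatorname{tr}(AB)$, the momentum mapping is $\mu:\mathbb{P}^n\to\mathfrak{su}(n+1)$, $\mu([z])=-i\big(P_z-\frac{\mathrm{id}}{n+1}\big)$, where $P_z$ is the orthogonal projection of $\mathbb{C}^{n+1}$ onto $\mathbb{C}z$; equivalently $\langle\mu([z]),v\rangle=\frac{i\langle v(z),z\rangle}{|z|^2}$ for $v \in \mathfrak{su}(n+1)$. The set $\mathscr{P}(\mathbb{P}^n)$ of Borel probability measures carries the weak topology (weak-$*$ topology as a subset of the dual of $C(\mathbb{P}^n)$), and $G$ acts on it by push-forward $g\cdot\nu=g_*\nu$. Let $\mathfrak{F}(\nu)=\int_{\mathbb{P}^n}\mu\,d\nu$, let $G_\nu$ be the stabilizer of $\nu$ and $\mathfrak{g}_\nu$ its Lie algebra. $\nu$ is stable if there is $g\in G$ with $\mathfrak{F}(g\cdot\nu)=0$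 and $\mathfrak{g}_\nu$ is conjugate (under $\operatorname{Ad}(G)$) to a subalgebra of $\mathfrak{su}(n+1)$; $\nu$ is semi-stable if $\overline{G\cdot\nu}\cap\mathfrak{F}^{-1}(0)\ne\emptyset$. A proper linear subspace of $\mathbb{P}^n$ is $L=\mathbb{P}(E)$ with $0\neq E\subsetneq\mathbb{C}^{n+1}$ a complex linear subspace; $\dim L=\dim_{\mathbb{C}}E-1$. *)

(* Defs.v *)
From HB Require Import structures.
From mathcomp Require Import all_boot all_order all_algebra.
From mathcomp Require Import all_classical all_reals all_analysis.
From mathcomp Require Import complex.

Set Implicit Arguments.
Unset Strict Implicit.
Unset Printing Implicit Defensive.

Import Order.TTheory GRing.Theory Num.Theory.
Import numFieldNormedType.Exports.
Local Open Scope classical_set_scope.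
Local Open Scope complex_scope.
Local Open Scope sesquilinear_scope.
Local Open Scope ring_scope.

Section LineProjection.
Variables (C : numClosedFieldType) (m : nat).

(* orthogonal projection of C^m onto the line C z, for z != 0 *)
Definition line_proj (z : 'cV[C]_m) : 'M[C]_m :=
  ((z^t* *m z) 0 0)^-1 *: (z *m z^t* ).

Lemma line_projZ (c : C) (z : 'cV[C]_m) :
  c != 0 -> line_proj (c *: z) = line_proj z.
Proof.
move=> c0; have cc0 : c^* * c != 0 by rewrite mulf_neq0// conjC_eq0.
have E : (c *: z)^t* = c^* *: z^t*.
  by apply/matrixP => i j; rewrite !mxE rmorphM.
rewrite /line_proj E -!scalemxAl -!scalemxAr !scalerA.
rewrite [in LHS]mxE; congr (_ *: _).
by rewrite invfM -mulrA [c * _]mulrC mulrAC mulVf// mul1r.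
Qed.

End LineProjection.

(* The analysis library puts the norm topology only on abstract number fields. *)
HB.instance Definition _ (R : rcfType) := NormedModule.copy R[i] R[i]^o.

Section ProjectiveSpace.
Local Open Scope quotient_scope.
Variables (R : realType) (n : nat).

Definition nzvec : set 'cV[R[i]]_n.+1 := [set z | z != 0].

Definition same_line (z w : nzvec) : bool :=
  `[< exists2 c : R[i], c != 0 & \val w = c *: \val z >].

Lemma same_line_refl : reflexive same_line.
Proof. by move=> z; apply/asboolP; exists 1; rewrite ?oner_neq0 ?scale1r. Qed.

Lemma same_line_sym : symmetric same_line.
Proof.
suff H z w : same_line z w -> same_line w z by move=> z w; apply/idP/idP => /H.
move=> /asboolP[c c0 zw]; apply/asboolP; exists c^-1; first by rewrite invr_eq0.
by rewrite zw scalerA mulVf// scale1r.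
Qed.

Lemma same_line_trans : transitive same_line.
Proof.
move=> w z x /asboolP[c c0 zw] /asboolP[d d0 wx]; apply/asboolP.
by exists (d * c); rewrite ?mulf_neq0// wx zw scalerA.
Qed.

Canonical same_line_equiv :=
  EquivRel same_line same_line_refl same_line_sym same_line_trans.

(* P^n(C) with the quotient topology of C^{n+1} \ {0} and its Borel sets *)
Definition projspace : Type := quotient_topology {eq_quot same_line_equiv}.

HB.instance Definition _ :=
  Topological.copy projspace (quotient_topology {eq_quot same_line_equiv}).
HB.instance Definition _ :=
  Quotient.copy projspace (quotient_topology {eq_quot same_line_equiv}).

Lemma const1_nz : const_mx 1 \in nzvec.
Proof.
by rewrite inE; apply/eqP => /colP/(_ 0)/eqP; rewrite !mxE oner_eq0.
Qed.

HB.instance Definition _ := isPointed.Build projspace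
  (\pi_projspace (exist (fun z => z \in nzvec) _ const1_nz)).

HB.instance Definition _ :=
  Measurable.copy projspace (g_sigma_algebraType (@open projspace)).

(* a chosen vector spanning the line p; only used in scale-invariant formulas *)
Definition rep (p : projspace) : 'cV[R[i]]_n.+1 := \val (repr p : nzvec).

Lemma rep_pi (z : nzvec) :
  exists2 c : R[i], c != 0 & rep (\pi_projspace z) = c *: \val z.
Proof.
have : \pi_({eq_quot same_line_equiv}) z =
       \pi_({eq_quot same_line_equiv}) (repr (\pi_projspace z)).
  by rewrite [RHS]reprK.
by move/eqP; rewrite eqmodE => /asboolP[c c0 e]; exists c.
Qed.

(* [linsub E] is P(E), for a complex linear subspace E of C^{n+1}. *)
Definition linsub (E : {vspace 'cV[R[i]]_n.+1}) : set projspace :=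
  [set p | rep p \in E].

Lemma linsub_pi (E : {vspace 'cV[R[i]]_n.+1}) (z : nzvec) :
  linsub E (\pi_projspace z) <-> \val z \in E.
Proof.
have [c c0 e] := rep_pi z; rewrite /linsub/= e.
by split=> [|/(memvZ c)//] /(memvZ c^-1); rewrite scalerA mulVf// scale1r.
Qed.

Definition linsub_dim (E : {vspace 'cV[R[i]]_n.+1}) : nat := (\dim E).-1.

Definition momentum (p : projspace) : 'M[R[i]]_n.+1 :=
  - 'i *: (line_proj (rep p) - (n.+1%:R^-1)%:M).

Lemma momentum_pi (z : nzvec) :
  momentum (\pi_projspace z) = - 'i *: (line_proj (\val z) - (n.+1%:R^-1)%:M).
Proof. by rewrite /momentum; have [c c0 ->] := rep_pi z; rewrite line_projZ. Qed.

End ProjectiveSpace.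

Arguments nzvec : clear implicits.
Arguments projspace : clear implicits.

Section Action.
Local Open Scope quotient_scope.
Variables (R : realType) (n : nat).

Definition SL : Type := {g : 'M[R[i]]_n.+1 | \det g == 1}.

Lemma SL_nz (g : SL) (z : nzvec R n) : val g *m \val z \in nzvec R n.
Proof.
rewrite inE; apply/negP => /eqP gz.
have ug : val g \in unitmx by rewrite unitmxE (eqP (valP g)) unitr1.
have /set_mem/negP := valP z; apply.
by rewrite -[\val z]mul1mx -(mulVmx ug) -mulmxA gz mulmx0.
Qed.

Definition SL_vec (g : SL) (z : nzvec R n) : nzvec R n :=
  exist (fun w => w \in nzvec R n) _ (SL_nz g z).

Definition SL_act (g : SL) (p : projspace R n) : projspace R n :=
  \pi_(projspace R n) (SL_vec g (repr p)).

Lemma SL_act_pi (g : SL) (z : nzvec R n) :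
  SL_act g (\pi_(projspace R n) z) = \pi_(projspace R n) (SL_vec g z).
Proof.
have [c c0 e] := rep_pi z.
apply/(@eqmodP _ (@same_line_equiv R n))/asboolP; exists c^-1.
  by rewrite invr_eq0.
by rewrite /= -[\val (repr _)]/(rep _) e -scalemxAr scalerA mulVf// scale1r.
Qed.

Lemma mulmx_continuous (A : 'M[R[i]]_n.+1) :
  continuous (fun z : 'cV[R[i]]_n.+1 => A *m z).
Proof.
move=> z P /nbhs_ballP[e /= e0 eP].
pose M : R[i] := (\sum_i \sum_j `|A i j|) + 1.
have M0 : 0 < M.
  by rewrite ltr_wpDl// sumr_ge0// => i _; rewrite sumr_ge0.
apply/nbhs_ballP; exists (e / M) => /= [|w zw]; first by rewrite divr_gt0.
apply: eP; split => // i j; rewrite -ball_normE /ball_/=.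
rewrite !mxE -sumrB (le_lt_trans (ler_norm_sum _ _ _))//.
apply: (@le_lt_trans _ _ (\sum_k `|A i k| * (e / M))).
  apply: ler_sum => k _; rewrite -mulrBr normrM ler_wpM2l//.
  by have := zw.2 k j; rewrite -ball_normE => /ltW.
rewrite -mulr_suml mulrC -mulrA gtr_pMr// mulrC ltr_pdivrMr// mul1r.
rewrite /M [X in _ < X + _](bigD1 i)//= -addrA ltrDl ltr_wpDl//.
by rewrite sumr_ge0// => l _; rewrite sumr_ge0.
Qed.

Lemma SL_vec_continuous (g : SL) : continuous (SL_vec g).
Proof.
apply/continuousP => _ [B oB <-]; exists ((fun z => val g *m z) @^-1` B) => //.
by move/continuousP : (@mulmx_continuous (val g)); apply.
Qed.

Lemma SL_act_continuous (g : SL) : continuous (SL_act g).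
Proof.
apply/quotient_continuous.
rewrite (_ : _ \o _ = \pi_(projspace R n) \o SL_vec g); last first.
  by apply/funext => z; exact: SL_act_pi.
by move=> z; apply: continuous_comp; [exact: SL_vec_continuous|exact: pi_continuous].
Qed.

Lemma SL_act_measurable (g : SL) : measurable_fun setT (SL_act g).
Proof.
apply: (@measurability _ _ _ _ setT (SL_act g) (@open (projspace R n))) => //.
move=> _ [B oB <-]; rewrite setTI; apply: sub_sigma_algebra.
by move/continuousP : (@SL_act_continuous g); apply.
Qed.

HB.instance Definition _ (g : SL) :=
  isMeasurableFun.Build _ _ _ _ (SL_act g) (SL_act_measurable g).

End Action.

Arguments SL : clear implicits.

Section Measures.
Variables (R : realType) (n : nat).
Local Notation prob := (probability (projspace R n) R).

Definition integral_ev (nu : prob) :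
    {ptws continuousType (projspace R n) R -> R} :=
  fun f => \int[nu]_p f p.

(* Probability measures with the coarsest topology making all the maps
   nu |-> \int f dnu, for f continuous, continuous. *)
Definition weak_prob : Type := initial_topology integral_ev.

HB.instance Definition _ :=
  Topological.copy weak_prob (initial_topology integral_ev).

Definition push (g : SL R n) (nu : prob) : prob := distribution nu (SL_act g).

(* the su(n+1)-valued integral of the momentum mapping, entry by entry *)
Definition momentum_avg (nu : prob) : 'M[R[i]]_n.+1 :=
  \matrix_(i, j) ((\int[nu]_p complex.Re (momentum p i j))
               +i* (\int[nu]_p complex.Im (momentum p i j))).

(* Measures are compared on Borel sets only: a library measure is a function on
   all subsets, with unconstrained values outside the sigma-algebra. *)
Definition stabilizer (nu : prob) : set (SL R n) :=
  [set g | forall A, measurable A -> push g nu A = nu A].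

Definition expm (X : 'M[R[i]]_n.+1) : 'M[R[i]]_n.+1 :=
  limn (series (fun k => (k`!%:R)^-1 *: X ^+ k)).

(* Lie algebra of a closed subgroup H of SL(n+1,C), inside the matrices *)
Definition lie_algebra (H : set (SL R n)) : set 'M[R[i]]_n.+1 :=
  [set X | forall t : R, exists2 g, H g & val g = expm (t%:C *: X)].

Definition su : set 'M[R[i]]_n.+1 := [set X | X^t* = - X /\ \tr X = 0].

Definition Ad (g : SL R n) (X : 'M[R[i]]_n.+1) : 'M[R[i]]_n.+1 :=
  val g *m X *m invmx (val g).

Definition stable (nu : prob) : Prop :=
  (exists g : SL R n, momentum_avg (push g nu) = 0) /\
  (exists h : SL R n, Ad h @` lie_algebra (stabilizer nu) `<=` su).

Definition semistable (nu : prob) : Prop :=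
  closure (range (fun g : SL R n => push g nu : weak_prob)) `&`
    [set nu' : weak_prob | momentum_avg nu' = 0] !=set0.

End Measures.

(* Main.v *)
Require Import Defs.
From HB Require Import structures.
From mathcomp Require Import all_fingroup all_boot all_order all_algebra.
From mathcomp Require Import all_classical all_reals all_analysis.
From mathcomp Require Import complex measurable_realfun ring lra.
Import Order.TTheory GRing.Theory Num.Theory.
Import numFieldNormedType.Exports.
Local Open Scope classical_set_scope.
Local Open Scope complex_scope.
Local Open Scope sesquilinear_scope.
Local Open Scope ring_scope.

(** The average of the momentum over nu vanishes when the average of the
    orthogonal projectors onto the lines of P^n is the scalar matrix 1/(n+1);
    call nu balanced in that case. Everything rests on the Kempf-Ness functional
    Psi(g), the integral of ln (|g z|^2 / |z|^2) over nu, whose critical points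
    on the special linear group are the g that move nu to a balanced measure.

    Strict inequalities imply stability. If every proper subspace carries less
    than its share of the mass, then compactness of the unitary group makes the
    margin uniform over all flags ([uniform_gap]). Writing g, up to a unitary
    factor on the left, as a decreasing diagonal matrix e^(b/2) times a unitary
    one, ln (|g z|^2 / |z|^2) is bounded below by a step function adapted to the
    flag, and Abel summation turns the margin into a bound of Psi from below by
    a multiple of b_0 - b_n ([Psi_expdiag]). So Psi has a minimum ([Psi_min]),
    and its first variation along transvections says that the averaged
    projector is scalar there ([strictly_spread_balanced]). In a balanced
    position Jensen's inequality gives 0 <= Psi, with equality only at unitary
    matrices ([Psi_eq0_unitary]). For k in the stabilizer, Psi takes opposite
    values at k and at its inverse, hence vanishes: the stabilizer is conjugate
    into the unitary group, and first-order expansion of the exponential moves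
    this to Lie algebras ([unitary_expm_su]).

    The inequalities are necessary. Pairing the averaged projector with the
    projector onto g E gives the mass of E plus a nonnegative contribution of
    the other lines ([mass_frame]). For a balanced measure the total is
    dim E / (n+1), and the bound passes to limits along the orbit because
    projectors are bounded ([semistable_mass]). In case of equality almost every
    line lies in E or in a fixed complement, so a real diagonalisable one-
    parameter group fixes nu; its generator has nonzero real eigenvalues, hence
    is not conjugate to a skew-Hermitian matrix ([stable_mass]).

    Weak inequalities imply semi-stability. When some subspace carries exactly
    its share, the lines inside it and the images of the others modulo it
    satisfy the weak inequalities again, and one can degenerate nu to a measure
    on the union of that subspace and a complement. By induction on the
    dimension a single g and integer weights make the initial form of g z
    balanced ([spread_degenerates]). The one-parameter subgroup with these
    weights moves every line to its initial form, so by dominated convergence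
    the translates of nu tend weakly to a balanced measure ([push_limit]). *)

Set Implicit Arguments.
Unset Strict Implicit.
Unset Printing Implicit Defensive.
Local Notation rRe := complex.Re.
Local Notation rIm := complex.Im.

(** * Hermitian forms on lines *)

Section Algebra.
Variable R : realType.
Local Notation C := R[i].

Definition sqn (c : C) : R := rRe c ^+ 2 + rIm c ^+ 2.

Lemma mul_conj_sqn (c : C) : c^*%R * c = (sqn c)%:C.
Proof. by rewrite /sqn; case: c => a b /=; simpc; congr (_ +i* _); ring. Qed.

Lemma sqn_ge0 c : 0 <= sqn c.
Proof. by rewrite addr_ge0 ?sqr_ge0. Qed.

Lemma sqn_eq0 c : (sqn c == 0) = (c == 0).
Proof.
rewrite paddr_eq0 ?sqr_ge0// !sqrf_eq0.
by case: c => a b; rewrite /= eq_complex.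
Qed.

Lemma sqnM c d : sqn (c * d) = sqn c * sqn d.
Proof. by rewrite /sqn; case: c => a b; case: d => a' b' /=; ring. Qed.

Lemma sqnJ c : sqn c^*%R = sqn c.
Proof. by rewrite /sqn; case: c => a b /=; rewrite sqrrN. Qed.

Lemma Re_sqr_sqn c : rRe c ^+ 2 <= sqn c.
Proof. by rewrite lerDl sqr_ge0. Qed.

Lemma Im_sqr_sqn c : rIm c ^+ 2 <= sqn c.
Proof. by rewrite lerDr sqr_ge0. Qed.

Lemma ReD (c d : C) : rRe (c + d) = rRe c + rRe d.
Proof. by case: c d => ? ? []. Qed.

Lemma ImD (c d : C) : rIm (c + d) = rIm c + rIm d.
Proof. by case: c d => ? ? []. Qed.

Lemma ReB (c d : C) : rRe (c - d) = rRe c - rRe d.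
Proof. by case: c d => ? ? []. Qed.

Lemma ImB (c d : C) : rIm (c - d) = rIm c - rIm d.
Proof. by case: c d => ? ? []. Qed.

Lemma ReM (c d : C) : rRe (c * d) = rRe c * rRe d - rIm c * rIm d.
Proof. by case: c d => ? ? []. Qed.

Lemma ImM (c d : C) : rIm (c * d) = rRe c * rIm d + rIm c * rRe d.
Proof. by case: c d => ? ? [] ? ? /=. Qed.

Lemma ReZl (a : R) (c : C) : rRe (a%:C * c) = a * rRe c.
Proof. by rewrite ReM mul0r subr0. Qed.

Lemma ImZl (a : R) (c : C) : rIm (a%:C * c) = a * rIm c.
Proof. by rewrite ImM mul0r addr0. Qed.

Lemma Re_sum I (r : seq I) (P : pred I) (F : I -> C) :
  rRe (\sum_(i <- r | P i) F i) = \sum_(i <- r | P i) rRe (F i).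
Proof. by elim/big_rec2: _ => // i x y _ <-; rewrite ReD. Qed.

Lemma Im_sum I (r : seq I) (P : pred I) (F : I -> C) :
  rIm (\sum_(i <- r | P i) F i) = \sum_(i <- r | P i) rIm (F i).
Proof. by elim/big_rec2: _ => // i x y _ <-; rewrite ImD. Qed.

Lemma complex_ext (c d : C) : rRe c = rRe d -> rIm c = rIm d -> c = d.
Proof. by case: c d => ? ? [] ? ? /= -> ->. Qed.

Definition nsq k (z : 'cV[C]_k) : R := \sum_i sqn (z i 0).

Lemma dot_nsq k (z : 'cV[C]_k) : (z^t* *m z) 0 0 = (nsq z)%:C.
Proof.
rewrite mxE /nsq (rmorph_sum (real_complex R)); apply: eq_bigr => i _.
by rewrite !mxE mul_conj_sqn.
Qed.

Lemma normc_le_ReIm (w : C) : `|w| <= (`|rRe w| + `|rIm w|)%:C.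
Proof.
have nC (r : R) : `|r%:C| = `|r|%:C by rewrite normc_def/= expr0n/= addr0 sqrtr_sqr.
rewrite [w in leLHS]complexE (le_trans (ler_normD _ _))// normrM !nC.
have -> : `|'i%C : C| = 1 by rewrite normc_def/= expr0n/= add0r expr1n sqrtr1.
by rewrite mul1r rmorphD.
Qed.

Lemma nsq_ge0 k (z : 'cV[C]_k) : 0 <= nsq z.
Proof. by apply: sumr_ge0 => i _; exact: sqn_ge0. Qed.

Lemma nsq_eq0 k (z : 'cV[C]_k) : (nsq z == 0) = (z == 0).
Proof.
rewrite /nsq psumr_eq0; last by move=> i _; exact: sqn_ge0.
apply/allP/eqP => [h|-> i _]; last by rewrite mxE sqn_eq0 eqxx.
apply/colP => i; rewrite mxE; apply/eqP.
by rewrite -sqn_eq0; exact: h (mem_index_enum i).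
Qed.

Lemma colv_neq0 k (z : 'cV[C]_k) : z != 0 -> exists j, z j 0 != 0.
Proof.
move=> z0; apply/existsP; apply: contraT; rewrite negb_exists => /forallP h.
case/eqP: z0; apply/colP => j; rewrite mxE; apply/eqP.
by have := h j; rewrite negbK.
Qed.

Lemma delta_mx_coef k (i : 'I_k) (w : 'cV[C]_k) j :
  (delta_mx i i *m w) j 0 = (j == i)%:R * w i 0.
Proof.
rewrite mxE (bigD1 i)//= big1 => [|l li]; first by rewrite mxE eqxx andbT addr0.
by rewrite mxE (negPf li) andbF mul0r.
Qed.

Lemma nsq_gt0 k (z : 'cV[C]_k) : (0 < nsq z) = (z != 0).
Proof. by rewrite lt_neqAle nsq_ge0 andbT eq_sym nsq_eq0. Qed.

Lemma nsqZ k (c : C) (z : 'cV[C]_k) : nsq (c *: z) = sqn c * nsq z.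
Proof. by rewrite /nsq mulr_sumr; apply: eq_bigr => i _; rewrite mxE sqnM. Qed.

Lemma sqn_le_nsq k (z : 'cV[C]_k) i : sqn (z i 0) <= nsq z.
Proof.
by rewrite /nsq (bigD1 i)//= lerDl sumr_ge0// => j _; exact: sqn_ge0.
Qed.

Lemma line_projE k (z : 'cV[C]_k) :
  line_proj z = ((nsq z)^-1)%:C *: (z *m z^t*).
Proof. by rewrite /line_proj dot_nsq fmorphV. Qed.

Lemma line_proj_coef k (z : 'cV[C]_k) i j :
  line_proj z i j = ((nsq z)^-1)%:C * (z i 0 * (z j 0)^*%R).
Proof. by rewrite line_projE !mxE big_ord1 !mxE. Qed.

Lemma sqn_line_proj k (z : 'cV[C]_k) i j : sqn (line_proj z i j) <= 1.
Proof.
rewrite line_proj_coef !sqnM sqnJ.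
have [->|z0] := eqVneq z 0; first by rewrite mxE /sqn /= !(mul0r,mulr0,expr0n,addr0).
have n0 : 0 < nsq z by rewrite nsq_gt0.
have -> : sqn ((nsq z)^-1)%:C = ((nsq z)^-1)^+2 by rewrite /sqn/= expr0n addr0.
rewrite exprVn mulrC ler_pdivrMr ?exprn_gt0// mul1r expr2.
by apply: ler_pM; rewrite ?sqn_ge0 ?sqn_le_nsq.
Qed.

Lemma sqr_le1_norm (x : R) : x ^+ 2 <= 1 -> `|x| <= 1.
Proof. by rewrite -{1}(expr1n R 2) -[x ^+ 2]real_normK ?num_real// ler_pXn2r ?nnegrE. Qed.

Lemma Re_line_proj k (z : 'cV[C]_k) i j : `|rRe (line_proj z i j)| <= 1.
Proof. exact/sqr_le1_norm/(le_trans (Re_sqr_sqn _))/sqn_line_proj. Qed.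

Lemma Im_line_proj k (z : 'cV[C]_k) i j : `|rIm (line_proj z i j)| <= 1.
Proof. exact/sqr_le1_norm/(le_trans (Im_sqr_sqn _))/sqn_line_proj. Qed.

(** Hermitian forms are evaluated on a line through the trace pairing, which
    is linear in the form and whose second argument is a bounded function. *)
Definition hq k (H : 'M[C]_k) (z : 'cV[C]_k) : R := rRe (\tr (H *m line_proj z)).

Lemma hqB k (H K : 'M[C]_k) z : hq (H - K) z = hq H z - hq K z.
Proof. by rewrite /hq mulmxBl raddfB ReB. Qed.

Definition mnorm k (H : 'M[C]_k) : R :=
  \sum_i \sum_j (`|rRe (H i j)| + `|rIm (H i j)|).

Lemma hq_bound k (H : 'M[C]_k) z : `|hq H z| <= mnorm H.
Proof.
rewrite /hq /mxtrace Re_sum (le_trans (ler_norm_sum _ _ _))//.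
apply: ler_sum => i _; rewrite mxE Re_sum (le_trans (ler_norm_sum _ _ _))//.
apply: ler_sum => j _; rewrite ReM (le_trans (ler_normB _ _))// !normrM.
by apply: lerD; rewrite ler_piMr// ?Re_line_proj ?Im_line_proj.
Qed.

(** The factor by which g scales squared lengths on the line of z. By
    [stretch_hq] it is the value on that line of the Hermitian form g^* g. *)
Definition stretch m k (g : 'M[C]_(m, k)) (z : 'cV[C]_k) : R := nsq (g *m z) / nsq z.

Lemma trCM m k l (A : 'M[C]_(m, k)) (B : 'M[C]_(k, l)) :
  (A *m B)^t* = B^t* *m A^t*.
Proof. by rewrite trmx_mul map_mxM. Qed.

Lemma stretch_hq m k (g : 'M[C]_(m, k)) z : stretch g z = hq (g^t* *m g) z.
Proof.
rewrite /hq line_projE -scalemxAr mxtraceZ ReZl /stretch mulrC; congr (_ * _).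
rewrite -mulmxA mxtrace_mulC mulmxA -mulmxA -trCM mxtrace_mulC.
by rewrite /mxtrace big_ord1 dot_nsq.
Qed.

Lemma stretch_ge0 m k (g : 'M[C]_(m, k)) z : 0 <= stretch g z.
Proof. by rewrite divr_ge0// nsq_ge0. Qed.

Lemma stretch_gt0 m k (g : 'M[C]_(m, k)) z : z != 0 -> (0 < stretch g z) = (g *m z != 0).
Proof. by move=> z0; rewrite /stretch pmulr_lgt0 ?invr_gt0 nsq_gt0. Qed.

Lemma stretch_eq0 m k (g : 'M[C]_(m, k)) z : z != 0 -> (stretch g z == 0) = (g *m z == 0).
Proof.
by move=> z0; rewrite /stretch mulf_eq0 invr_eq0 !nsq_eq0 (negPf z0) orbF.
Qed.

Lemma stretch_bound m k (g : 'M[C]_(m, k)) z : stretch g z <= mnorm (g^t* *m g).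
Proof. by rewrite stretch_hq (le_trans (ler_norm _))// hq_bound. Qed.

Lemma stretchM m k l (g : 'M[C]_(m, k)) (h : 'M[C]_(k, l)) z :
  h *m z != 0 -> stretch (g *m h) z = stretch g (h *m z) * stretch h z.
Proof. by move=> hz; rewrite /stretch mulmxA mulrA divfK// nsq_eq0. Qed.

Lemma stretch1 k (z : 'cV[C]_k) : z != 0 -> stretch 1%:M z = 1.
Proof. by move=> z0; rewrite /stretch mul1mx divff// nsq_eq0. Qed.

Lemma hq1 k (z : 'cV[C]_k) : z != 0 -> hq 1%:M z = 1.
Proof.
by move=> z0; rewrite -(stretch1 z0) stretch_hq trmx1 map_mx1 mulmx1.
Qed.

Lemma unit_nz k (g : 'M[C]_k) (z : 'cV[C]_k) :
  g \in unitmx -> z != 0 -> g *m z != 0.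
Proof.
move=> ug; apply: contraNneq => gz.
by rewrite -[z]mul1mx -(mulVmx ug) -mulmxA gz mulmx0.
Qed.

Lemma line_proj_mul m k (g : 'M[C]_(m, k)) (z : 'cV[C]_k) : z != 0 ->
  line_proj (g *m z) = ((stretch g z)^-1)%:C *: (g *m line_proj z *m g^t*).
Proof.
move=> z0; rewrite !line_projE -scalemxAr -scalemxAl scalerA -rmorphM/=.
rewrite trCM !mulmxA; congr (_%:C *: _).
by rewrite /stretch invf_div mulrAC divff ?mul1r// nsq_eq0.
Qed.

Lemma line_proj_herm k (z : 'cV[C]_k) : (line_proj z)^t* = line_proj z.
Proof.
apply/matrixP => i j.
have -> : (line_proj z)^t* i j = (line_proj z j i)^*%R by rewrite !mxE.
rewrite !line_proj_coef !rmorphM/= conjCK; congr (_ * _); last by rewrite mulrC.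
by rewrite conj_Creal//; apply/complex_realP; exists (nsq z)^-1.
Qed.
End Algebra.

(** * Random lines and their averaged projector *)

Section RandomLine.
Context d (T : measurableType d) (R : realType) (P : probability T R).
Local Notation C := R[i].

Lemma bounded_integrable (D : set T) (f : T -> R) (M : R) : measurable D ->
  measurable_fun D f -> (forall t, D t -> `|f t| <= M) ->
  P.-integrable D (EFin \o f).
Proof.
move=> mD mf fM; apply: measurable_bounded_integrable => //.
  by rewrite ltey_eq fin_num_measure.
exists M; split; first exact: num_real.
by move=> x Mx t Dt; apply: le_trans (ltW Mx); exact: fM.
Qed.

Definition mass (S : set T) : R := fine (P S).

Lemma mass_fin S : measurable S -> P S = (mass S)%:E.
Proof. by move=> mS; rewrite fineK// fin_num_measure. Qed.

Lemma mass_le S S' : measurable S -> measurable S' -> S `<=` S' -> mass S <= mass S'.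
Proof.
by move=> mS mS' SS'; rewrite -lee_fin -!mass_fin// le_measure ?inE.
Qed.

Lemma mass_le1 S : measurable S -> mass S <= 1.
Proof. by move=> mS; rewrite -lee_fin -mass_fin// probability_le1. Qed.

Lemma mass_set0 : mass set0 = 0.
Proof. by rewrite /mass measure0. Qed.

Lemma mass_setD S S' : measurable S -> measurable S' ->
  mass (S `\` S') = mass S - mass (S `&` S').
Proof.
move=> mS mS'; apply: EFin_inj; rewrite EFinB -!mass_fin//; first last.
- exact: measurableD.
- exact: measurableI.
- by rewrite measureD// ltey_eq fin_num_measure.
Qed.

Lemma mass_setU_le S S' : measurable S -> measurable S' ->
  mass (S `|` S') <= mass S + mass S'.
Proof.
move=> mS mS'; rewrite -lee_fin EFinD -!mass_fin//; last exact: measurableU.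
exact: measureU2.
Qed.

Lemma Rint_cst D (a : R) : measurable D -> \int[P]_(t in D) a = a * mass D.
Proof. by move=> mD; rewrite Rintegral_cst. Qed.

Lemma Rint_sum (D : set T) I (r : seq I) (f : I -> T -> R) : measurable D ->
  (forall i, P.-integrable D (EFin \o f i)) ->
  P.-integrable D (EFin \o (fun t => \sum_(i <- r) f i t)) /\
  \int[P]_(t in D) (\sum_(i <- r) f i t) = \sum_(i <- r) \int[P]_(t in D) f i t.
Proof.
move=> mD fi; elim: r => [|i r [IH1 IH2]].
  have -> : (fun t => \sum_(i <- [::]) f i t) = (fun=> 0).
    by apply/funext => t; rewrite big_nil.
  rewrite big_nil Rint_cst ?mul0r//; split=> //.
  by apply: (@bounded_integrable _ _ 0) => // t _; rewrite normr0.
have -> : (fun t => \sum_(i <- i :: r) f i t) =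
    (fun t => f i t + \sum_(i <- r) f i t).
  by apply/funext => t; rewrite big_cons.
split; first exact: (integrableD mD (fi i) IH1).
by rewrite big_cons RintegralD// IH2.
Qed.

(** Lines are observed through their projectors only: the vector z t itself,
    a choice of representative, need not depend measurably on t. *)
Definition random_line k (D : set T) (z : T -> 'cV[C]_k) : Prop :=
  [/\ measurable D, forall t, D t -> z t != 0,
      forall i j, measurable_fun D (fun t => rRe (line_proj (z t) i j)) &
      forall i j, measurable_fun D (fun t => rIm (line_proj (z t) i j))].

(** The measure is balanced when this matrix is scalar. *)
Definition avg k (D : set T) (z : T -> 'cV[C]_k) : 'M[C]_k :=
  \matrix_(i, j) ((\int[P]_(t in D) rRe (line_proj (z t) i j))
                +i* (\int[P]_(t in D) rIm (line_proj (z t) i j))).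

Lemma measurable_fun_inv (D : set T) (f : T -> R) :
  (forall t, D t -> 0 < f t) -> measurable_fun D f ->
  measurable_fun D (fun t => (f t)^-1).
Proof.
move=> f0 mf.
(* For f > 0 the inverse is a composition of measurable maps. *)
apply: (@eq_measurable_fun _ _ _ _ _ (fun t => expR (- ln (f t)))).
  by move=> t /[!inE] /f0 ft; rewrite expRN lnK.
apply: measurableT_comp; first exact: measurable_expR.
by apply: measurableT_comp => //; apply: measurableT_comp => //; exact: measurable_ln.
Qed.

Section Props.
Variables (k : nat) (D : set T) (z : T -> 'cV[C]_k).
Hypothesis zl : random_line D z.

Let mD : measurable D. Proof. by case: zl. Qed.
Let z0 t : D t -> z t != 0. Proof. by case: zl => _ h _ _; exact: h. Qed.

Lemma random_line_integrable_Re i j :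
  P.-integrable D (EFin \o (fun t => rRe (line_proj (z t) i j))).
Proof.
by case: zl => _ _ h _; apply: (@bounded_integrable _ _ 1) => // t _; exact: Re_line_proj.
Qed.

Lemma random_line_integrable_Im i j :
  P.-integrable D (EFin \o (fun t => rIm (line_proj (z t) i j))).
Proof.
by case: zl => _ _ _ h; apply: (@bounded_integrable _ _ 1) => // t _; exact: Im_line_proj.
Qed.

Lemma measurable_hq (H : 'M[C]_k) : measurable_fun D (fun t => hq H (z t)).
Proof.
case: zl => _ _ mRe mIm.
rewrite /hq /mxtrace; under eq_fun do rewrite Re_sum.
apply: measurable_sum => i; under eq_fun do rewrite mxE Re_sum.
apply: measurable_sum => j; under eq_fun do rewrite ReM.
by apply: measurable_funB; apply: measurable_funM.
Qed.

Lemma hq_integrable (H : 'M[C]_k) : P.-integrable D (EFin \o (fun t => hq H (z t))).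
Proof.
apply: (@bounded_integrable _ _ (mnorm H)) => //; first exact: measurable_hq.
by move=> t _; exact: hq_bound.
Qed.

(** All integrals of Hermitian forms reduce to the averaged projector, by
    linearity of the trace pairing. *)
Lemma Rint_hq (H : 'M[C]_k) :
  \int[P]_(t in D) hq H (z t) = rRe (\tr (H *m avg D z)).
Proof.
rewrite /hq /mxtrace Re_sum; under eq_Rintegral do rewrite Re_sum.
have int2 i j : P.-integrable D (EFin \o (fun t => rRe (H i j * line_proj (z t) j i))).
  apply: (@bounded_integrable _ _ (`|rRe (H i j)| + `|rIm (H i j)|)) => // [|t _].
    case: zl => _ _ mRe mIm; under eq_fun do rewrite ReM.
    by apply: measurable_funB; apply: measurable_funM.
  rewrite ReM (le_trans (ler_normB _ _))// !normrM.
  by apply: lerD; rewrite ler_piMr// ?Re_line_proj ?Im_line_proj.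
have int1 i : P.-integrable D (EFin \o (fun t => rRe ((H *m line_proj (z t)) i i))).
  under [fun t => rRe _]eq_fun do rewrite mxE Re_sum.
  by have [] := Rint_sum (index_enum _) mD (int2 i).
have [_ ->] := Rint_sum (index_enum _) mD int1.
apply: eq_bigr => i _; rewrite mxE Re_sum.
under eq_Rintegral do rewrite mxE Re_sum.
have [_ ->] := Rint_sum (index_enum _) mD (int2 i).
apply: eq_bigr => j _; rewrite ReM mxE /=.
under eq_Rintegral do rewrite ReM.
have iRe := random_line_integrable_Re j i; have iIm := random_line_integrable_Im j i.
rewrite RintegralB//; last 2 first.
- by rewrite (_ : _ \o _ = fun t => (rRe (H i j))%:E * (rRe (line_proj (z t) j i))%:E)%E//; exact: integrableZl.
- by rewrite (_ : _ \o _ = fun t => (rIm (H i j))%:E * (rIm (line_proj (z t) j i))%:E)%E//; exact: integrableZl.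
by rewrite !RintegralZl.
Qed.

Lemma measurable_stretch l (g : 'M[C]_(l, k)) : measurable_fun D (fun t => stretch g (z t)).
Proof. by under eq_fun do rewrite stretch_hq; exact: measurable_hq. Qed.

Lemma measurable_ln_stretch l (g : 'M[C]_(l, k)) : measurable_fun D (fun t => ln (stretch g (z t))).
Proof.
by apply: measurableT_comp; [exact: measurable_ln|exact: measurable_stretch].
Qed.

Lemma measurable_ker l (B : 'M[C]_(l, k)) : measurable (D `&` [set t | B *m z t = 0]).
Proof.
rewrite (_ : _ `&` _ = D `&` (fun t => stretch B (z t)) @^-1` [set 0]).
  exact: measurable_stretch.
apply/seteqP; split => t [Dt /= h]; split => //.
  by apply/eqP; rewrite stretch_eq0 ?h// z0.
by apply/eqP; rewrite -(stretch_eq0 _ (z0 Dt)) h.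
Qed.

Lemma measurable_stretch_lt l (B : 'M[C]_(l, k)) (a : R) :
  measurable (D `&` [set t | stretch B (z t) < a]).
Proof.
rewrite (_ : _ `&` _ = D `&` (fun t => stretch B (z t)) @^-1` `]-oo, a[%classic).
  exact: measurable_stretch.
by apply/seteqP; split => t [Dt /=]; rewrite in_itv.
Qed.

Lemma random_line_mul l (g : 'M[C]_(l, k)) (D' : set T) : measurable D' ->
  D' `<=` D -> (forall t, D' t -> g *m z t != 0) ->
  random_line D' (fun t => g *m z t).
Proof.
move=> mD' D'D gz0; case: (zl) => _ _ mRe mIm.
have E t i j : D' t -> line_proj (g *m z t) i j =
    ((stretch g (z t))^-1)%:C *
      (\sum_j0 (\sum_j1 g i j1 * line_proj (z t) j1 j0) * (g^t* ) j0 j).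
  move=> Dt; rewrite line_proj_mul ?z0//; last exact: D'D.
  by rewrite mxE; congr (_ * _); rewrite mxE; apply: eq_bigr => j0 _; rewrite !mxE.
have mq : measurable_fun D' (fun t => (stretch g (z t))^-1).
  apply: measurable_fun_inv => [t D't|]; first by rewrite stretch_gt0 ?gz0// z0//; exact: D'D.
  by apply: (measurable_funS mD D'D); exact: measurable_stretch.
split=> // i j.
- apply: (@eq_measurable_fun _ _ _ _ _ (fun t => (stretch g (z t))^-1 *
    rRe (\sum_j0 (\sum_j1 g i j1 * line_proj (z t) j1 j0) * (g^t* ) j0 j))).
    by move=> t /[!inE] D't; rewrite E// ReZl.
  apply: measurable_funM => //; apply: (measurable_funS mD D'D).
  under eq_fun do rewrite Re_sum; apply: measurable_sum => j0.
  under eq_fun do rewrite ReM Re_sum Im_sum.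
  apply: measurable_funB; apply: measurable_funM => //; apply: measurable_sum => j1.
    by under eq_fun do rewrite ReM; apply: measurable_funB; apply: measurable_funM.
  by under eq_fun do rewrite ImM; apply: measurable_funD; apply: measurable_funM.
- apply: (@eq_measurable_fun _ _ _ _ _ (fun t => (stretch g (z t))^-1 *
    rIm (\sum_j0 (\sum_j1 g i j1 * line_proj (z t) j1 j0) * (g^t* ) j0 j))).
    by move=> t /[!inE] D't; rewrite E// ImZl.
  apply: measurable_funM => //; apply: (measurable_funS mD D'D).
  under eq_fun do rewrite Im_sum; apply: measurable_sum => j0.
  under eq_fun do rewrite ImM Re_sum Im_sum.
  apply: measurable_funD; apply: measurable_funM => //; apply: measurable_sum => j1.
    by under eq_fun do rewrite ReM; apply: measurable_funB; apply: measurable_funM.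
  by under eq_fun do rewrite ImM; apply: measurable_funD; apply: measurable_funM.
Qed.

Lemma random_line_unit (g : 'M[C]_k) : g \in unitmx -> random_line D (fun t => g *m z t).
Proof. by move=> ug; apply: random_line_mul => // t Dt; rewrite unit_nz// z0. Qed.

Lemma avg_herm : (avg D z)^t* = avg D z.
Proof.
apply/matrixP => i j.
have E t : line_proj (z t) i j = (line_proj (z t) j i)^*%R.
  by rewrite -[in LHS]line_proj_herm !mxE.
have ReE t : rRe (line_proj (z t) j i) = rRe (line_proj (z t) i j).
  by rewrite (E t); case: (line_proj _ _ _).
have ImE t : rIm (line_proj (z t) j i) = -1 * rIm (line_proj (z t) i j).
  by rewrite (E t); case: (line_proj _ _ _) => a b /=; rewrite mulN1r opprK.
rewrite !mxE; apply: complex_ext => /=.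
  by apply: eq_Rintegral => t _.
rewrite (@eq_Rintegral _ _ _ _ _ _ _ (fun t _ => ImE t)).
by rewrite RintegralZl ?mulN1r ?opprK//; exact: random_line_integrable_Im.
Qed.

Lemma tr_avg : \tr (avg D z) = (mass D)%:C.
Proof.
apply: complex_ext; last first.
  have : rIm (\tr (avg D z)) = - rIm (\tr (avg D z)).
    by rewrite -[in LHS]avg_herm trace_map_mx mxtrace_tr; case: (\tr _).
  by move=> /= ?; lra.
rewrite -[avg D z]mul1mx -Rint_hq.
rewrite (@eq_Rintegral _ _ _ _ _ (fun=> 1)); first by rewrite Rint_cst// mul1r.
by move=> t /[!inE] Dt; rewrite hq1// z0.
Qed.

End Props.
End RandomLine.

(** * Entrywise limits of complex matrices *)

Section Topology.
Variable R : realType.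
Local Notation C := R[i].

(** Real and imaginary parts are kept apart because the integrals and the
    estimates on them are real. *)
Definition ccvg T (F : set_system T) (f : T -> C) (a : C) : Prop :=
  (fun x => rRe (f x)) @ F --> rRe a /\ (fun x => rIm (f x)) @ F --> rIm a.

Section Filter.
Context T (F : set_system T) {FF : Filter F}.
Implicit Types f g : T -> C.

Lemma ccvg_cst a : ccvg F (fun=> a) a.
Proof. by split; exact: cvg_cst. Qed.

Lemma ccvgD f g a b : ccvg F f a -> ccvg F g b -> ccvg F (fun x => f x + g x) (a + b).
Proof.
move=> [fr fi] [gr gi]; split; rewrite ?ReD ?ImD.
  by under eq_fun do rewrite ReD; exact: cvgD.
by under eq_fun do rewrite ImD; exact: cvgD.
Qed.

Lemma ccvgM f g a b : ccvg F f a -> ccvg F g b -> ccvg F (fun x => f x * g x) (a * b).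
Proof.
move=> [fr fi] [gr gi]; split; rewrite ?ReM ?ImM.
  by under eq_fun do rewrite ReM; apply: cvgB; exact: cvgM.
by under eq_fun do rewrite ImM; apply: cvgD; exact: cvgM.
Qed.

Lemma ccvgJ f a : ccvg F f a -> ccvg F (fun x => (f x)^*%R) (a^*%R).
Proof.
have rJ (c : C) : rRe c^*%R = rRe c by case: c.
have iJ (c : C) : rIm c^*%R = - rIm c by case: c.
move=> [fr fi]; split; rewrite ?rJ ?iJ.
  by under eq_fun do rewrite rJ.
by under eq_fun do rewrite iJ; exact: cvgN.
Qed.

Lemma ccvg_sum I (r : seq I) (P : pred I) (f : I -> T -> C) (a : I -> C) :
  (forall i, P i -> ccvg F (f i) (a i)) ->
  ccvg F (fun x => \sum_(i <- r | P i) f i x) (\sum_(i <- r | P i) a i).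
Proof.
move=> h; elim: r => [|i r IH].
  rewrite big_nil; under [fun x => _]eq_fun do rewrite big_nil; exact: ccvg_cst.
rewrite big_cons; under [fun x => _]eq_fun do rewrite big_cons.
by case: ifPn => // Pi; apply: ccvgD => //; exact: h.
Qed.

Lemma ccvg_prod I (r : seq I) (P : pred I) (f : I -> T -> C) (a : I -> C) :
  (forall i, P i -> ccvg F (f i) (a i)) ->
  ccvg F (fun x => \prod_(i <- r | P i) f i x) (\prod_(i <- r | P i) a i).
Proof.
move=> h; elim: r => [|i r IH].
  rewrite big_nil; under [fun x => _]eq_fun do rewrite big_nil; exact: ccvg_cst.
rewrite big_cons; under [fun x => _]eq_fun do rewrite big_cons.
by case: ifPn => // Pi; apply: ccvgM => //; exact: h.
Qed.

Lemma ccvg_normP f a :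
  ccvg F f a <-> forall e : R, 0 < e -> \forall x \near F, `|a - f x| < e%:C.
Proof.
split=> [[fr fi] e e0|h].
  have e20 : 0 < e / 2 by lra.
  move/cvgrPdist_lt : fr => /(_ _ e20) fr; move/cvgrPdist_lt : fi => /(_ _ e20) fi.
  near=> x; apply: le_lt_trans (normc_le_ReIm _) _; rewrite ReB ImB ltcR.
  have : `|rRe a - rRe (f x)| < e / 2 by near: x.
  have : `|rIm a - rIm (f x)| < e / 2 by near: x.
  lra.
split; apply/cvgrPdist_lt => e /h; apply: filterS => x.
  by rewrite -ReB => /(le_lt_trans (normc_ge_Re _)); rewrite ltcR.
rewrite -ImB => h'.
have : `|rIm (a - f x)|%:C < e%:C.
  apply: le_lt_trans h'; rewrite normc_def lecR -[leLHS]sqrtr_sqr ler_sqrt ?lerDr ?sqr_ge0//.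
  by rewrite addr_ge0 ?sqr_ge0.
by rewrite ltcR.
Unshelve. all: by end_near.
Qed.

Lemma complex_gt0 (e : C) : 0 < e -> exists2 r : R, 0 < r & e = r%:C.
Proof.
case: e => a b; rewrite ltcE /= => /andP[/eqP -> a0].
by exists a.
Qed.

Lemma mx_cvgP m n (f : T -> 'M[C]_(m, n)) (L : 'M[C]_(m, n)) :
  (f @ F --> L) <-> forall i j, ccvg F (fun x => f x i j) (L i j).
Proof.
split=> [h i j|h].
  apply/ccvg_normP => e e0.
  have e0' : 0 < e%:C by rewrite ltcR.
  move/cvg_ballP : h => /(_ _ e0'); apply: filterS => x [_ /(_ i j)].
  by rewrite -ball_normE.
apply/cvg_ballP => e /[dup] e0 /complex_gt0[r r0 er].
have : \forall x \near F, forall i j, `|L i j - f x i j| < r%:C.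
  apply: filter_forall => i; apply: filter_forall => j.
  by have /ccvg_normP := h i j; exact.
by apply: filterS => x hx; split => // i j; rewrite -ball_normE /= er; exact: hx.
Qed.
End Filter.

Definition ccont (X : topologicalType) (f : X -> C) := forall x, ccvg (nbhs x) f (f x).

Lemma ccont_entry m n i j : ccont (fun M : 'M[C]_(m, n) => M i j).
Proof. by move=> M; have /mx_cvgP := @cvg_id _ (nbhs M); exact. Qed.

Lemma ccont_mulmx (X : topologicalType) m n p (f : X -> 'M[C]_(m, n)) (g : X -> 'M[C]_(n, p)) :
  (forall i j, ccont (fun x => f x i j)) -> (forall i j, ccont (fun x => g x i j)) ->
  forall i j, ccont (fun x => (f x *m g x) i j).
Proof.
move=> cf cg i j x; rewrite mxE; under [fun x => _]eq_fun do rewrite mxE.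
by apply: ccvg_sum => l _; apply: ccvgM; [exact: cf|exact: cg].
Qed.

Lemma ccont_trC (X : topologicalType) m n (f : X -> 'M[C]_(m, n)) :
  (forall i j, ccont (fun x => f x i j)) -> forall i j, ccont (fun x => (f x)^t* i j).
Proof.
move=> cf i j x; rewrite !mxE; under [fun x => _]eq_fun do rewrite !mxE.
by apply: ccvgJ; exact: cf.
Qed.

Lemma ccont_det (X : topologicalType) n (f : X -> 'M[C]_n) :
  (forall i j, ccont (fun x => f x i j)) -> ccont (fun x => \det (f x)).
Proof.
move=> cf x; apply: ccvg_sum => s _; apply: ccvgM; first exact: ccvg_cst.
by apply: ccvg_prod => i _; exact: cf.
Qed.

Lemma closed_ccont (X : topologicalType) (f : X -> C) (a : C) :
  ccont f -> closed [set x | f x = a].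
Proof.
move=> cf.
rewrite (_ : [set x | _] = (fun x => rRe (f x)) @^-1` [set rRe a] `&`
  (fun x => rIm (f x)) @^-1` [set rIm a]).
  apply: closedI; apply: closed_comp.
  - by move=> x _; case: (cf x).
  - exact: closed_eq.
  - by move=> x _; case: (cf x).
  - exact: closed_eq.
apply/seteqP; split => [x /= -> //|x [/= h1 h2]]; exact: complex_ext.
Qed.

Definition box m n (c : R) : set 'M[C]_(m, n) :=
  [set M | forall i j, `|rRe (M i j)| <= c /\ `|rIm (M i j)| <= c].

(** A box is the continuous image of a real cube. *)
Lemma compact_box m n c : compact (@box m n c).
Proof.
pose rho (v : 'rV[R]_(m * n + m * n)) : 'M[C]_(m, n) :=
  \matrix_(i, j) (v 0 (lshift _ (mxvec_index i j)) +i* v 0 (rshift _ (mxvec_index i j))).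
have crho : continuous rho.
  move=> v; apply/(@mx_cvgP _ (nbhs v) _) => i j; split; rewrite mxE /=.
    by under eq_fun do rewrite mxE/=; exact: coord_continuous.
  by under eq_fun do rewrite mxE/=; exact: coord_continuous.
have -> : @box m n c = rho @` [set v : 'rV[R]_(m * n + m * n) | forall i, `[- c, c]%classic (v 0 i)].
  apply/seteqP; split => [M hM|M [v hv <-] i j].
    exists (row_mx (mxvec (map_mx (@rRe R) M)) (mxvec (map_mx (@rIm R) M))); last first.
      apply/matrixP => i j; rewrite mxE row_mxEl row_mxEr !mxvecE !mxE.
      by case: (M i j).
    move=> /= i; rewrite in_itv/= -ler_norml.
    case: (split_ordP i) => {}i ->; case/mxvec_indexP: i => i j.
      by rewrite row_mxEl mxvecE mxE; case: (hM i j).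
    by rewrite row_mxEr mxvecE mxE; case: (hM i j).
  rewrite mxE/= !ler_norml; split.
    by have := hv (lshift _ (mxvec_index i j)); rewrite /= in_itv.
  by have := hv (rshift _ (mxvec_index i j)); rewrite /= in_itv.
apply: continuous_compact; first exact: continuous_subspaceT.
have := @rV_compact R _ (fun=> `[- c, c]%classic) (fun=> @segment_compact R _ _).
exact.
Qed.

End Topology.

(** * A uniform margin for the mass near subspaces *)

Section Gap.
Context d (T : measurableType d) (R : realType) (P : probability T R).
Local Notation C := R[i].
Local Notation mu := (mass P).

Lemma mnormB_near (X : topologicalType) k (f : X -> 'M[C]_k) (x0 : X) (e : R) :
  (forall i j, ccont (fun x => f x i j)) -> 0 < e ->
  \forall x \near x0, mnorm (f x - f x0) < e.
Proof.
move=> cf e0; pose K : R := (k * k)%:R + 1.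
have K0 : 0 < K by rewrite ltr_pwDr.
have e'0 : 0 < e / K / 2 by rewrite !divr_gt0.
have : \forall x \near x0, forall i j,
    `|rRe (f x0 i j) - rRe (f x i j)| < e / K / 2 /\
    `|rIm (f x0 i j) - rIm (f x i j)| < e / K / 2.
  apply: filter_forall => i; apply: filter_forall => j.
  have [/cvgrPdist_lt/(_ _ e'0) h1 /cvgrPdist_lt/(_ _ e'0) h2] := cf i j x0.
  by apply: filterS2 h1 h2.
apply: filterS => x hx.
apply: (@le_lt_trans _ _ (\sum_(i < k) \sum_(j < k) e / K)).
  apply: ler_sum => i _; apply: ler_sum => j _; rewrite !mxE ReB ImB.
  have [] := hx i j; rewrite !(distrC (_ (f x0 _ _))); lra.
rewrite sumr_const card_ord sumr_const card_ord -mulrnA -mulr_natr mulrAC.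
by rewrite ltr_pdivrMr// ltr_pM2l// /K ltrDl.
Qed.

Lemma unitary_box k (V : 'M[C]_k) : V *m V^t* = 1%:M -> box 1 V.
Proof.
move=> VV i j.
have Vij : sqn (V i j) <= 1.
  have /matrixP/(_ i i) := VV; rewrite !mxE eqxx => /(congr1 (@rRe R)) /= E.
  rewrite -E Re_sum (bigD1 j)//= !mxE mulrC mul_conj_sqn /= lerDl sumr_ge0// => l _.
  by rewrite !mxE mulrC mul_conj_sqn /= sqn_ge0.
by split; apply: sqr_le1_norm; apply: le_trans Vij; rewrite ?Re_sqr_sqn ?Im_sqr_sqn.
Qed.

Lemma compact_unitary k : compact [set V : 'M[C]_k | V *m V^t* = 1%:M].
Proof.
apply: subclosed_compact (@compact_box R k k 1) _.
  rewrite (_ : [set V | _] = \bigcap_(ij in [set: 'I_k * 'I_k])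
    [set V : 'M[C]_k | (V *m V^t* ) ij.1 ij.2 = (1%:M : 'M[C]_k) ij.1 ij.2]).
    apply: closed_bigI => -[i j] _; apply: closed_ccont => /=.
    apply: (@ccont_mulmx R 'M[C]_k) => i' j'; first exact: ccont_entry.
    by apply: (@ccont_trC R 'M[C]_k) => i'' j''; exact: ccont_entry.
  apply/seteqP; split => [V /= VV [i j] _ /=|V h]; first by rewrite VV.
  by apply/matrixP => i j; exact: (h (i, j)).
exact: unitary_box.
Qed.

Variables (k : nat) (D : set T) (z : T -> 'cV[C]_k).
Hypothesis zl : random_line D z.
Let mD : measurable D. Proof. by case: zl. Qed.
Let z0 t : D t -> z t != 0. Proof. by case: zl => _ h _ _; exact: h. Qed.

(** A subspace of C^k is encoded as the kernel of a matrix B, of dimension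
    k - \rank B; its share of the mass is proportional to that dimension. The
    condition on the rank leaves out the zero space and the whole space. *)
Definition strictly_spread : Prop := forall B : 'M[C]_k, (0 < \rank B < k)%N ->
  mu (D `&` [set t | B *m z t = 0]) * k%:R < mu D * (k - \rank B)%:R.

(** The neighbourhoods of the kernel decrease to it as e tends to 0, and a
    finite measure is continuous along decreasing sequences. *)
Lemma ker_limit (B : 'M[C]_k) (a : R) : mu (D `&` [set t | B *m z t = 0]) < a ->
  exists2 e : R, 0 < e & mu (D `&` [set t | stretch B (z t) < e]) < a.
Proof.
move=> ha; pose F n := D `&` [set t | stretch B (z t) < n.+1%:R^-1].
have mF n : measurable (F n) by exact: measurable_stretch_lt.
have capF : \bigcap_n F n = D `&` [set t | B *m z t = 0].
  apply/seteqP; split => [t h|t [Dt /= Bt] n _]; last first.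
    split=> //=; rewrite (_ : stretch B (z t) = 0) ?invr_gt0//.
    by apply/eqP; rewrite stretch_eq0 ?Bt// z0.
  have Dt : D t by have [] := h 0%N I.
  split=> //=; apply/eqP; rewrite -stretch_eq0 ?z0// eq_le stretch_ge0 andbT.
  apply/ler_addgt0Pl => e e0; rewrite addr0.
  have [n _ hn] : exists2 n : nat, True & n.+1%:R^-1 < e.
    have := @near_infty_natSinv_lt R (PosNum e0); case=> n _ /(_ n (leqnn n)) h'.
    by exists n.
  by have [_ /= hn'] := h n I; exact: ltW (lt_trans hn' hn).
have mK : measurable (D `&` [set t | B *m z t = 0]) by exact: (measurable_ker zl).
have : P \o F @ \oo --> P (\bigcap_n F n).
  apply: nonincreasing_cvg_mu => //; first by rewrite ltey_eq fin_num_measure.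
    by rewrite capF.
  move=> n p np; apply/subsetPset => t [Dt /= h]; split=> //=.
  by apply: lt_le_trans h _; rewrite lef_pV2 ?posrE// ler_nat ltnS.
rewrite capF (mass_fin _ mK).
have -> : P \o F = EFin \o (mu \o F) by apply/funext => n /=; rewrite mass_fin.
move/fine_cvgP => [_ /cvgrPdist_lt].
have ha' : 0 < a - mu (D `&` [set t | B *m z t = 0]) by lra.
move=> /(_ _ ha') [n _ /(_ n (leqnn n))] /= hn; exists n.+1%:R^-1 => //.
by move: hn; rewrite -/(F n) ltr_distl; lra.
Qed.

(** Up to unitary matrices a subspace is the kernel of a coordinate projector,
    so the subspaces of given dimension form a compact family; and an estimate
    of the mass near one of them persists for its neighbours, with a smaller
    neighbourhood. *)
Lemma uniform_gap : strictly_spread -> exists dl : R, [/\ 0 < dl, dl < 1 &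
  forall (V : 'M[C]_k) j, V *m V^t* = 1%:M -> (0 < j < k)%N ->
   mu (D `&` [set t | stretch (pid_mx j *m V : 'M[C]_k) (z t) < dl]) <= mu D * (1 - j%:R / k%:R) - dl].
Proof.
move=> st.
have [_ cvr] := near_covering_withinP [set V : 'M[C]_k | V *m V^t* = 1%:M].
have {}cvr := cvr ((compact_near_coveringP _).1 (@compact_unitary k)).
have : \forall dl \near (0 : R)^'+, forall j : 'I_k, (0 < j)%N ->
    [set V : 'M[C]_k | V *m V^t* = 1%:M] `<=`
  [set V | mu (D `&` [set t | stretch (pid_mx j *m V : 'M[C]_k) (z t) < dl]) <=
           mu D * (1 - j%:R / k%:R) - dl].
  apply: filter_forall => j.
  have [->|j0] := posnP j; first by apply: nearW.
  suff : \forall dl \near (0 : R)^'+, [set V : 'M[C]_k | V *m V^t* = 1%:M] `<=`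
  [set V | mu (D `&` [set t | stretch (pid_mx j *m V : 'M[C]_k) (z t) < dl]) <=
           mu D * (1 - j%:R / k%:R) - dl] by apply: filterS.
  apply: cvr => V /= VV.
  have uV : V \in unitmx by have [] := mulmx1_unit VV.
  set B := pid_mx j *m V : 'M[C]_k.
  have rB : \rank B = j by rewrite mxrankMfree ?row_free_unit// rank_pid_mx// ltnW.
  have k0 : (0 < k%:R :> R) by rewrite ltr0n (leq_trans _ (ltn_ord j)).
  have : mu (D `&` [set t | B *m z t = 0]) < mu D * (1 - j%:R / k%:R).
    have := st B; rewrite rB j0 ltn_ord => /(_ isT).
    rewrite -ltr_pdivlMr// -mulrA natrB 1?ltnW// mulrBl divff ?gt_eqF//.
  set a := mu D * _ => ha.
  have [e e0 he] : exists2 e : R, 0 < e & mu (D `&` [set t | stretch B (z t) < e]) <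
      (a + mu (D `&` [set t | B *m z t = 0])) / 2.
    by apply: ker_limit; lra.
  have e20 : 0 < e / 2 by lra.
  have g0 : 0 < (a - mu (D `&` [set t | B *m z t = 0])) / 2 by lra.
  pose f (W : 'M[C]_k) : 'M[C]_k := ((pid_mx j : 'M[C]_k) *m W)^t* *m (pid_mx j *m W).
  have cf i i' : ccont (fun W => f W i i').
    have c1 i1 i2 : ccont (fun W : 'M[C]_k => (pid_mx j *m W : 'M[C]_k) i1 i2).
      apply: (@ccont_mulmx R 'M[C]_k) => ? ?; last exact: ccont_entry.
      by move=> ?; exact: ccvg_cst.
    apply: (@ccont_mulmx R 'M[C]_k) => // ? ?.
    exact: (@ccont_trC R 'M[C]_k).
  near=> W dl => _.
  have hW : mnorm (f W - f V) < e / 2 by near: W; exact: (@mnormB_near 'M[C]_k k f V _ cf).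
  have hdl : dl < e / 2 by near: dl; exact: nbhs_right_lt.
  have hdl' : dl <= (a - mu (D `&` [set t | B *m z t = 0])) / 2.
    by near: dl; exact: nbhs_right_le.
  have : mu (D `&` [set t | stretch (pid_mx j *m W : 'M[C]_k) (z t) < dl]) <=
         mu (D `&` [set t | stretch B (z t) < e]).
    apply: mass_le; [exact: measurable_stretch_lt|exact: measurable_stretch_lt|].
    move=> t [Dt /= h]; split=> //=.
    have : `|hq (f W - f V) (z t)| <= mnorm (f W - f V) by exact: hq_bound.
    have -> : hq (f W - f V) (z t) =
        stretch (pid_mx j *m W : 'M[C]_k) (z t) - stretch B (z t) by rewrite hqB !stretch_hq.
    rewrite ler_norml => /andP[h1 h2]; lra.
  rewrite /= -/a; lra.
have dlp : \forall dl \near (0 : R)^'+, 0 < dl by exact: nbhs_right_gt.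
have dl1 : \forall dl \near (0 : R)^'+, dl < 1 by exact: nbhs_right_lt.
move=> h; have [dl [h1 [h2 h3]]] := filter_ex (filterI h (filterI dlp dl1)).
exists dl; split=> // V j VV /andP[j0 jk].
exact: (h1 (Ordinal jk) j0 V VV).
Unshelve. all: by end_near.
Qed.
End Gap.

(** * Polar decomposition with sorted singular values *)

Section Spectral.
Variable R : realType.
Local Notation C := R[i].

(** The exponents are halved because the b_i will be the logarithms of the
    eigenvalues of g^* g. *)
Definition expdiag n (b : nat -> R) : 'M[C]_n :=
  diag_mx (\row_i (expR (b i / 2))%:C).

Lemma pid_mx_coef n j (w : 'cV[C]_n) i :
  ((pid_mx j : 'M[C]_n) *m w) i 0 = if (i < j)%N then w i 0 else 0.
Proof.
rewrite mxE (bigD1 i)//= big1 ?addr0 => [|l li]; rewrite !mxE.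
  by rewrite eqxx/=; case: ifP; rewrite ?mul1r ?mul0r.
by rewrite eq_sym (negPf (_ : val l != val i)) ?mul0r.
Qed.

Lemma expdiag_coef n b (w : 'cV[C]_n) i :
  (expdiag n b *m w) i 0 = (expR (b i / 2))%:C * w i 0.
Proof. by rewrite mul_diag_mx !mxE. Qed.

Lemma sqn_expdiag n b (w : 'cV[C]_n) i :
  sqn ((expdiag n b *m w) i 0) = expR (b i) * sqn (w i 0).
Proof.
rewrite expdiag_coef sqnM; congr (_ * _).
by rewrite /sqn /= expr0n addr0 -expRM_natl; congr expR; lra.
Qed.

Lemma unitary_nsq k (V : 'M[C]_k) (z : 'cV[C]_k) :
  V *m V^t* = 1%:M -> nsq (V *m z) = nsq z.
Proof.
move=> /mulmx1C VV; apply: (@complexI R).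
by rewrite -!dot_nsq trCM mulmxA -(mulmxA (z^t* )) VV mulmx1.
Qed.

Lemma exists_sorting_perm n (x : 'I_n.+1 -> R) :
  exists s : 'S_n.+1, forall i j : 'I_n.+1, (i <= j)%N -> x (s j) <= x (s i).
Proof.
pose t := [tuple x i | i < n.+1].
pose u := sort_tuple (fun a b : R => b <= a) t.
have /tuple_permP[s us] : perm_eq u t by rewrite perm_sort.
exists s => i j ij.
have nthu (l : 'I_n.+1) : nth 0 u l = x (s l).
  have := congr1 (fun v => nth 0 v l) us; rewrite /= => ->.
  by rewrite (nth_map l) ?size_enum_ord// nth_ord_enum !tnth_mktuple.
rewrite -!nthu.
have st : sorted (fun a b : R => b <= a) u.
  by apply: sort_sorted => a b; exact: le_total.
apply: (sorted_leq_nth _ _ _ st) => //; rewrite ?inE ?size_tuple//.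
by move=> a b c /= ba ac; exact: le_trans ac ba.
Qed.

Lemma conj_sqn_gt0 (c : C) (r : R) : c = r%:C -> 0 < r -> c = (expR (ln r / 2))%:C^*%R * (expR (ln r / 2))%:C.
Proof.
move=> -> r0; rewrite mul_conj_sqn; congr (_%:C).
by rewrite /sqn /= expr0n addr0 -expRM_natl (_ : 2%:R * (ln r / 2) = ln r) ?lnK//; lra.
Qed.

(** The spectral theorem for g^* g with sorted eigenvalues. Of the polar
    decomposition of g only g^* g is kept, since the functional below depends on
    nothing else. *)
Lemma unit_expdiag n (g : 'M[C]_n.+1) : g \in unitmx ->
  exists (V : 'M[C]_n.+1) (b : nat -> R),
  [/\ V *m V^t* = 1%:M,
      forall i j, (i <= j)%N -> (j < n.+1)%N -> b j <= b i &
      g^t* *m g = (expdiag n.+1 b *m V)^t* *m (expdiag n.+1 b *m V)].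
Proof.
move=> ug; set H := g^t* *m g.
have Hn : H \is normalmx by apply/normalmxP; rewrite /H trCM trmxCK.
have HE := orthomx_spectralP Hn.
set U := spectralmx H in HE; set sp := spectral_diag H in HE.
have UU : U *m U^t* = 1%:M by apply/unitarymxP/spectral_unitarymx.
have UU' := mulmx1C UU.
have spr i : exists2 r : R, 0 < r & sp 0 i = r%:C.
  pose e : 'cV[C]_n.+1 := delta_mx i 0.
  exists (nsq (g *m (U^t* *m e))).
    rewrite nsq_gt0 unit_nz//; apply: contraTneq isT => Ue.
    have : U *m (U^t* *m e) = e by rewrite mulmxA UU mul1mx.
    rewrite Ue mulmx0 => /esym/matrixP/(_ i 0); rewrite !mxE !eqxx => /eqP.
    by rewrite oner_eq0.
  rewrite -dot_nsq trCM -mulmxA (mulmxA (g^t* )) -/H HE.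
  rewrite invmx_unitary ?spectral_unitarymx//.
  rewrite trCM trmxCK !mulmxA -(mulmxA _ U) UU mulmx1 -(mulmxA _ U) UU mulmx1.
  rewrite -mulmxA mul_diag_mx mxE (bigD1 i)//= big1 ?addr0 => [|l li]; rewrite !mxE ?eqxx ?(negPf li).
    by rewrite rmorph1 mul1r mulr1.
  by rewrite mulr0 mulr0.
pose x i := rRe (sp 0 i).
have x0 i : 0 < x i by have [r r0] := spr i; rewrite /x => ->.
have spx i : sp 0 i = (x i)%:C by have [r r0] := spr i; rewrite /x => ->.
have [s hs] := exists_sorting_perm x.
exists (row_perm s U), (fun l => ln (x (s (inord l)))); split.
- rewrite row_permE trCM mulmxA -(mulmxA _ U) UU mulmx1.
  by rewrite tr_perm_mx map_perm_mx -perm_mxM mulgV perm_mx1.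
- move=> i j ij jn; rewrite ler_ln ?posrE//; apply: hs.
  by rewrite !inordK// (leq_ltn_trans ij).
- rewrite HE invmx_unitary ?spectral_unitarymx//.
  apply/matrixP => a b; rewrite !mxE (reindex_inj (@perm_inj _ s)).
  apply: eq_bigr => i _; rewrite /expdiag mul_mx_diag mul_diag_mx !mxE inord_val.
  rewrite spx (conj_sqn_gt0 (erefl _) (x0 _)) rmorphM/=.
  by rewrite -!mulrA mulrCA.
Qed.

Lemma expdiag_sum0 n (g V : 'M[C]_n.+1) b : V *m V^t* = 1%:M ->
  g^t* *m g = (expdiag n.+1 b *m V)^t* *m (expdiag n.+1 b *m V) ->
  \det g = 1 -> \sum_(i < n.+1) b i = 0.
Proof.
move=> VV gg dg.
have dc (A : 'M[C]_n.+1) : \det (A^t* ) = (\det A)^*%R by rewrite det_map_mx det_tr.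
have dd (A : 'M[C]_n.+1) : \det (A^t* *m A) = (sqn (\det A))%:C.
  by rewrite det_mulmx dc mul_conj_sqn.
have dV : sqn (\det V) = 1 by apply: (@complexI R); rewrite -dd (mulmx1C VV) det1.
have := congr1 determinant gg; rewrite !dd det_mulmx sqnM dV mulr1 dg.
rewrite det_diag; under eq_bigr do rewrite mxE.
rewrite -rmorph_prod /= -expR_sum => /complexI.
rewrite /sqn /= expr0n /= !addr0 expr1n -expRM_natl -[LHS]expR0 => /expR_inj/esym.
by rewrite -mulr_suml mulrC divfK.
Qed.
End Spectral.

(** * Coercivity of the Kempf-Ness functional *)

Section Coercive.
Context d (T : measurableType d) (R : realType) (P : probability T R).
Local Notation C := R[i].
Local Notation mu := (mass P).

(** The upper bound for the inverse of g, at g z, is the lower bound for g. *)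
Lemma ln_stretch_bounded k (g : 'M[C]_k) : g \in unitmx ->
  exists L, forall z, z != 0 -> `|ln (stretch g z)| <= L.
Proof.
move=> ug; pose M (g : 'M[C]_k) := `|ln (mnorm (g^t* *m g))|.
have up (h : 'M[C]_k) z : h \in unitmx -> z != 0 -> ln (stretch h z) <= M h.
  move=> uh z0; apply: le_trans (ler_norm _).
  have q0 : 0 < stretch h z by rewrite stretch_gt0 ?unit_nz.
  by rewrite ler_ln ?posrE ?stretch_bound//; exact: lt_le_trans q0 (stretch_bound _ _).
exists (M g + M (invmx g)) => z z0; rewrite ler_norml; apply/andP; split; last first.
  by apply: le_trans (up _ _ ug z0) _; rewrite lerDl normr_ge0.
have gz0 : g *m z != 0 by rewrite unit_nz.
have /(congr1 (@ln R)) : stretch (invmx g) (g *m z) * stretch g z = 1 by rewrite -stretchM// mulVmx// stretch1.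
rewrite lnM ?posrE ?stretch_gt0 ?unit_nz ?unitmx_inv// ln1.
have := up (invmx g) (g *m z); rewrite unitmx_inv => /(_ ug gz0).
have : 0 <= M g by exact: normr_ge0.
lra.
Qed.

Lemma stretch_pid_sum k j (V : 'M[C]_k) z :
  stretch (pid_mx j *m V : 'M[C]_k) z =
  \sum_(i < k | (i < j)%N) sqn ((V *m z) i 0) / nsq z.
Proof.
rewrite /stretch -mulmxA /nsq mulr_suml [RHS]big_mkcond; apply: eq_bigr => i _.
by rewrite pid_mx_coef; case: ifP; rewrite // /sqn /= !expr0n addr0 mul0r.
Qed.

Lemma stretch_expdiag_sum k (b : nat -> R) (V : 'M[C]_k) z :
  stretch (expdiag k b *m V) z = \sum_(i < k) expR (b i) * (sqn ((V *m z) i 0) / nsq z).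
Proof.
rewrite /stretch -mulmxA /nsq mulr_suml; apply: eq_bigr => i _.
by rewrite sqn_expdiag mulrA.
Qed.

(** Let J be the first index such that the coordinates 0, ..., J of V z carry a
    proportion dl of |z|^2. Since b_J is the least weight among these
    coordinates, |e^(b/2) V z|^2 is at least dl e^(b_J) |z|^2; the sum on the left
    telescopes from b_n up to b_J. *)
Lemma ln_stretch_lower n (V : 'M[C]_n.+1) (b : nat -> R) (dl : R) (z : 'cV[C]_n.+1) :
  V *m V^t* = 1%:M -> 0 < dl -> dl < 1 -> z != 0 ->
  (forall i j, (i <= j)%N -> (j < n.+1)%N -> b j <= b i) ->
  ln dl + b n + \sum_(0 <= j < n)
     (b j - b j.+1) * (dl <= stretch (pid_mx j.+1 *m V : 'M[C]_n.+1) z)%R%:R <=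
  ln (stretch (expdiag n.+1 b *m V) z).
Proof.
move=> VV dl0 dl1 z0 bd; set s := fun j => stretch (pid_mx j *m V : 'M[C]_n.+1) z.
have p0 (i : 'I_n.+1) : 0 <= sqn ((V *m z) i 0) / nsq z by rewrite divr_ge0 ?sqn_ge0 ?nsq_ge0.
have smono i j : (i <= j)%N -> s i <= s j.
  move=> ij; rewrite /s !stretch_pid_sum big_mkcond [leRHS]big_mkcond; apply: ler_sum => l _.
  case: ifP => li; last by case: ifP.
  by rewrite (leq_trans li ij).
have s1 : dl <= s n.+1.
  by rewrite /s pid_mx_1 mul1mx /stretch unitary_nsq// divff ?ltW// nsq_eq0.
have exJ : exists j, (dl <= s j.+1) by exists n.
have [J dlJ minJ] := ex_minnP exJ.
have Jn : (J <= n)%N by exact: minJ.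
have low : dl * expR (b J) <= stretch (expdiag n.+1 b *m V) z.
  apply: (@le_trans _ _ (s J.+1 * expR (b J))); first by rewrite ler_pM2r ?expR_gt0.
  rewrite /s stretch_pid_sum stretch_expdiag_sum mulr_suml big_mkcond; apply: ler_sum => i _.
  case: ifP => iJ; last by rewrite mulr_ge0 ?expR_ge0.
  by rewrite mulrC ler_wpM2r// ler_expR bd.
have -> : ln dl + b n + \sum_(0 <= j < n) (b j - b j.+1) * (dl <= s j.+1)%R%:R =
    ln (dl * expR (b J)).
  rewrite lnM ?posrE ?expR_gt0// expRK -addrA; congr (_ + _).
  rewrite (@big_cat_nat _ _ _ J)//= big_nat big1 ?add0r => [|j /andP[_ jJ]]; last first.
    case: (boolP (dl <= s j.+1)) => [/minJ|_]; last by rewrite mulr0.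
    by rewrite leqNgt jJ.
  rewrite big_nat (eq_bigr (fun j => - (b j.+1 - b j))); last first.
    move=> j /andP[Jj _]; rewrite (le_trans dlJ (smono _ _ _))// mulr1; lra.
  by rewrite -big_nat sumrN telescope_sumr//; lra.
have dJ : 0 < dl * expR (b J) by rewrite mulr_gt0 ?expR_gt0.
by rewrite ler_ln// posrE//; exact: lt_le_trans dJ low.
Qed.

Lemma abel_sum n (b : nat -> R) :
  \sum_(0 <= j < n) (b j - b j.+1) * j.+1%:R = \sum_(0 <= j < n.+1) b j - n.+1%:R * b n.
Proof.
elim: n => [|n IH]; first by rewrite big_geq// big_nat1 mul1r subrr.
rewrite big_nat_recr//= IH [in RHS]big_nat_recr//= -[n.+2%:R]natr1; lra.
Qed.

Variables (n : nat) (D : set T) (z : T -> 'cV[C]_n.+1).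
Hypothesis zl : random_line D z.
Let mD : measurable D. Proof. by case: zl. Qed.
Let z0 t : D t -> z t != 0. Proof. by case: zl => _ h _ _; exact: h. Qed.

Lemma ln_stretch_integrable (g : 'M[C]_n.+1) : g \in unitmx ->
  P.-integrable D (EFin \o (fun t => ln (stretch g (z t)))).
Proof.
move=> ug; have [L hL] := ln_stretch_bounded ug.
by apply: (@bounded_integrable _ _ _ _ _ _ L) => // [|t /z0 /hL//]; exact: measurable_ln_stretch.
Qed.

(** The Kempf-Ness functional of the random line z. *)
Definition Psi (g : 'M[C]_n.+1) : R := \int[P]_(t in D) ln (stretch g (z t)).

Lemma eq_Psi (g h : 'M[C]_n.+1) : g^t* *m g = h^t* *m h -> Psi g = Psi h.
Proof.
by move=> gh; apply: eq_Rintegral => t _; rewrite !stretch_hq gh.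
Qed.

Lemma expdiag_unit k (b : nat -> R) : expdiag k b \in unitmx.
Proof.
rewrite unitmxE unitfE det_diag; apply/prodf_neq0 => i _.
by rewrite mxE fmorph_eq0 gt_eqF ?expR_gt0.
Qed.

(** Integrate [ln_stretch_lower]. By the margin, the j-th step function has
    integral at least mu D (j + 1) / (n + 1) + dl. By Abel summation and since
    the b_i sum to 0, the parts proportional to mu D cancel b_n; the parts dl
    add up to dl (b_0 - b_n). *)
Lemma Psi_expdiag (V : 'M[C]_n.+1) (b : nat -> R) (dl : R) :
  V *m V^t* = 1%:M -> 0 < dl -> dl < 1 ->
  (forall i j, (i <= j)%N -> (j < n.+1)%N -> b j <= b i) ->
  \sum_(i < n.+1) b i = 0 ->
  (forall j, (0 < j < n.+1)%N ->
    mu (D `&` [set t | stretch (pid_mx j *m V : 'M[C]_n.+1) (z t) < dl]) <=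
    mu D * (1 - j%:R / n.+1%:R) - dl) ->
  mu D * ln dl + dl * (b 0%N - b n) <= Psi (expdiag n.+1 b *m V).
Proof.
move=> VV dl0 dl1 bd sb gapV.
have uV : V \in unitmx by have [] := mulmx1_unit VV.
pose A j := D `&` [set t | stretch (pid_mx j *m V : 'M[C]_n.+1) (z t) < dl].
have mA j : measurable (A j) by exact: measurable_stretch_lt.
pose f j t : R := (b j - b j.+1) * (1 - \1_(A j.+1) t).
have iI j : P.-integrable D (EFin \o (\1_(A j) : T -> R)).
  apply: (@bounded_integrable _ _ _ _ _ _ 1) => [//||t _].
    by apply: measurable_funTS; exact: measurable_indic.
  by rewrite indicE; case: (_ \in _); rewrite ?normr1 ?normr0.
have icst (a : R) : P.-integrable D (EFin \o (fun=> a)).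
  by apply: (@bounded_integrable _ _ _ _ _ _ `|a|).
have if_ j : P.-integrable D (EFin \o f j).
  apply: (@bounded_integrable _ _ _ _ _ _ `|b j - b j.+1|) => [//||t _].
    by apply: measurable_funM => //; apply: measurable_funB => //.
  by rewrite normrM ler_piMr// indicE; case: (_ \in _); rewrite ?subrr ?subr0 ?normr1 ?normr0.
have intf j : \int[P]_(t in D) f j t = (b j - b j.+1) * (mu D - mu (A j.+1)).
  rewrite /f RintegralZl//; last first.
    by have := integrableB mD (icst 1) (iI j.+1); exact.
  rewrite RintegralB// Rint_cst// mul1r; congr (_ * (_ - _)).
  rewrite /Rintegral integral_indic// /mass (_ : _ `&` _ = A j.+1)//.
  by apply/setIidPl => t [].
have [isum sumE] := Rint_sum (index_iota 0 n) mD if_.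
apply: (@le_trans _ _ (\int[P]_(t in D) (ln dl + b n + \sum_(0 <= j < n) f j t))); last first.
  apply: le_Rintegral => //.
  - by have := integrableD mD (icst (ln dl + b n)) isum; exact.
  - by apply: ln_stretch_integrable; rewrite unitmx_mul expdiag_unit.
  - move=> t Dt; apply: le_trans (ln_stretch_lower VV dl0 dl1 (z0 Dt) bd).
    rewrite lerD2l; apply: ler_sum => j _; rewrite /f indicE.
    rewrite [in leLHS](_ : (t \in A j.+1) = ~~ (dl <= stretch (pid_mx j.+1 *m V : 'M[C]_n.+1) (z t))).
      by case: (dl <= _); rewrite ?subrr ?subr0.
    by rewrite -ltNge; apply/idP/idP => [/set_mem[]//|h]; exact/mem_set.
rewrite RintegralD// sumE Rint_cst//.
have low j : (j < n)%N -> (b j - b j.+1) * (mu D / n.+1%:R * j.+1%:R + dl) <=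
   \int[P]_(t in D) f j t.
  move=> jn; rewrite intf; apply: ler_wpM2l; first by rewrite subr_ge0 bd.
  have : mu (A j.+1) <= mu D * (1 - j.+1%:R / n.+1%:R) - dl := gapV j.+1 jn.
  have -> : mu D * (1 - j.+1%:R / n.+1%:R) = mu D - mu D / n.+1%:R * j.+1%:R.
    by rewrite mulrBr mulr1 -mulrA [_^-1 * _]mulrC.
  by move: (mu D / n.+1%:R * j.+1%:R) (mu (A j.+1)) => x y; lra.
apply: (@le_trans _ _ ((ln dl + b n) * mu D + \sum_(0 <= j < n)
   (b j - b j.+1) * (mu D / n.+1%:R * j.+1%:R + dl))); last first.
  rewrite lerD2l big_nat [leRHS]big_nat; apply: ler_sum => j /andP[_ jn]; exact: low.
have -> : \sum_(0 <= j < n) (b j - b j.+1) * (mu D / n.+1%:R * j.+1%:R + dl) =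
   mu D / n.+1%:R * (\sum_(0 <= j < n) (b j - b j.+1) * j.+1%:R) + dl * (b 0%N - b n).
  rewrite [b 0%N - b n](_ : _ = \sum_(0 <= j < n) (b j - b j.+1)); last first.
    rewrite (eq_bigr (fun j => - (b j.+1 - b j))); last by move=> j _; rewrite opprB.
    by rewrite sumrN telescope_sumr// opprB.
  rewrite !mulr_sumr -big_split/=; apply: eq_bigr => j _; ring.
rewrite abel_sum big_mkord sb sub0r mulrN mulrA divfK ?pnatr_eq0//; lra.
Qed.

(** Since the b_i sum to 0, b_n is nonpositive, so [Psi_expdiag] bounds b_0,
    which is the logarithm of the largest eigenvalue of g^* g. *)
Lemma Psi_coercive : strictly_spread P D z -> exists c : R, 0 <= c /\
  forall g : 'M[C]_n.+1, \det g = 1 -> Psi g <= 0 -> box c g.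
Proof.
move=> st; have [dl [dl0 dl1 hdl]] := uniform_gap zl st.
pose c : R := n.+1%:R * expR (- (mu D * ln dl) / dl).
have c0 : 0 <= c by rewrite mulr_ge0 ?expR_ge0.
exists (1 + c); split; first by rewrite addr_ge0.
move=> g dg Pg.
have ug : g \in unitmx by rewrite unitmxE dg unitr1.
have [V [b [VV bd gg]]] := unit_expdiag ug.
have sb := expdiag_sum0 VV gg dg.
have low := Psi_expdiag VV dl0 dl1 bd sb (fun j => hdl V j VV).
rewrite -(eq_Psi gg) in low.
have bn : b n <= 0.
  rewrite leNgt; apply/negP => bn0; have : 0 < \sum_(i < n.+1) b i.
    rewrite big_ord_recl ltr_pwDl//; first by apply: lt_le_trans bn0 _; exact: bd.
    apply: sumr_ge0 => i _; apply: ltW; apply: lt_le_trans bn0 _.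
    by apply: bd => //; rewrite -ltnS; exact: ltn_ord.
  by rewrite sb ltxx.
have b0 : b 0%N <= - (mu D * ln dl) / dl.
  by rewrite ler_pdivlMr//; nra.
have trg : rRe (\tr (g^t* *m g)) <= c.
  rewrite gg trCM mulmxA mxtrace_mulC !mulmxA VV mul1mx.
  have -> : c = \sum_(i < n.+1) expR (- (mu D * ln dl) / dl).
    by rewrite sumr_const card_ord -mulr_natl.
  rewrite /mxtrace Re_sum; apply: ler_sum => i _.
  rewrite /expdiag tr_diag_mx map_diag_mx mul_diag_mx !mxE eqxx mulr1n mul_conj_sqn /=.
  rewrite /sqn /= expr0n addr0 -expRM_natl ler_expR.
  rewrite (_ : 2%:R * (b i / 2) = b i); last by lra.
  by apply: le_trans b0; apply: bd => //.
have sij i j : sqn (g i j) <= (1 + c) ^+ 2.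
  apply: (@le_trans _ _ c); last by nra.
  apply: le_trans trg; rewrite /mxtrace Re_sum (bigD1 j)//= mxE Re_sum (bigD1 i)//=.
  rewrite !mxE mul_conj_sqn /= -addrA lerDl addr_ge0// sumr_ge0// => l _.
    by rewrite !mxE mul_conj_sqn sqn_ge0.
  by rewrite mxE Re_sum sumr_ge0// => l' _; rewrite !mxE mul_conj_sqn sqn_ge0.
have nsq x : x ^+ 2 <= (1 + c) ^+ 2 -> `|x| <= 1 + c.
  by rewrite -[x ^+ 2]real_normK ?num_real// ler_pXn2r ?nnegrE// addr_ge0.
by move=> i j; split; apply: nsq; apply: le_trans (sij i j); rewrite ?Re_sqr_sqn ?Im_sqr_sqn.
Qed.
End Coercive.

(** * Existence of balanced positions *)

Section Existence.
Context d (T : measurableType d) (R : realType) (P : probability T R).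
Local Notation C := R[i].
Local Notation mu := (mass P).

Lemma ln_le_subr1 (x : R) : 0 < x -> ln x <= x - 1.
Proof.
move=> x0; have := @le_ln1Dx R (x - 1).
by rewrite (_ : 1 + (x - 1) = x); [apply; lra|ring].
Qed.

Lemma ln_sub1_eq (x : R) : 0 < x -> x - 1 - ln x = 0 -> x = 1.
Proof.
move=> x0 h; have y0 : 0 < Num.sqrt x by rewrite sqrtr_gt0.
have xy : x = Num.sqrt x ^+ 2 by rewrite sqr_sqrtr// ltW.
have lnx : ln x = 2 * ln (Num.sqrt x) by rewrite {1}xy lnXn// mulr_natl.
have : ln x <= 2 * (Num.sqrt x - 1).
  by have := ln_le_subr1 y0; lra.
have : (Num.sqrt x - 1) ^+ 2 = x - 2 * Num.sqrt x + 1 by rewrite {2}xy; ring.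
move=> h1 h2; have : (Num.sqrt x - 1) ^+ 2 <= 0 by lra.
rewrite le_eqVlt ltNge sqr_ge0 orbF sqrf_eq0 subr_eq0 => /eqP y1.
by rewrite xy y1 expr1n.
Qed.

Lemma ln_dist (c a b : R) : 0 < c -> c <= a -> c <= b -> `|ln a - ln b| <= `|a - b| / c.
Proof.
move=> c0; wlog ba : a b / b <= a.
  move=> H ca cb; have [ba|/ltW ab] := leP b a; first exact: H.
  by rewrite distrC (distrC a); apply: H.
move=> ca cb; have b0 : 0 < b by lra.
have a0 : 0 < a by lra.
rewrite ger0_norm ?subr_ge0 ?ler_ln// ger0_norm ?subr_ge0// -ln_div//.
apply: (@le_trans _ _ (a / b - 1)); first by rewrite ln_le_subr1// divr_gt0.
have -> : a / b - 1 = (a - b) / b by rewrite mulrBl divff// gt_eqF.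
by rewrite ler_wpM2l ?subr_ge0// lef_pV2.
Qed.

Lemma Re_tr_quad k (x : R) (X M : 'M[C]_k) : M^t* = M ->
  rRe (\tr ((x%:C *: (X + X^t* ) + (x ^+ 2)%:C *: (X^t* *m X)) *m M)) =
  2 * x * rRe (\tr (X *m M)) + x ^+ 2 * rRe (\tr (X^t* *m X *m M)).
Proof.
move=> Mh.
have XM : rRe (\tr (X^t* *m M)) = rRe (\tr (X *m M)).
  have -> : X^t* *m M = (M *m X)^t* by rewrite trCM Mh.
  by rewrite trace_map_mx mxtrace_tr mxtrace_mulC; case: (\tr _).
rewrite mulmxDl -!scalemxAl mxtraceD !mxtraceZ ReD !ReZl mulmxDl mxtraceD ReD XM.
by congr (_ + _); ring.
Qed.

(** A quadratic polynomial vanishing at 0 that keeps its sign has a critical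
    point there. *)
Lemma quad_nonneg (a b : R) : (forall t, 0 <= 2 * t * a + t ^+ 2 * b) -> a = 0.
Proof.
move=> h; have b0 : 0 <= b.
  by have := h 1; have := h (-1); rewrite sqrrN expr1n; lra.
have c0 : 0 < (b + 1) ^+ 2 by rewrite exprn_gt0//; lra.
(* The denominator is b + 1 rather than b, which may be 0. *)
have := h (- a / (b + 1)).
have -> : 2 * (- a / (b + 1)) * a + (- a / (b + 1)) ^+ 2 * b =
    - (a ^+ 2 * (b + 2)) / (b + 1) ^+ 2 by field; lra.
rewrite ler_pdivlMr// mul0r oppr_ge0 pmulr_lle0; last by lra.
by move=> a2; apply/eqP; rewrite -sqrf_eq0 eq_le a2 sqr_ge0.
Qed.

(** Block elimination exchanges the determinant of 1 + u v^* with that of the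
    1 x 1 matrix 1 + v^* u. *)
Lemma det_transvection k (u v : 'cV[C]_k) : v^t* *m u = 0 ->
  \det (1%:M + u *m v^t* ) = 1.
Proof.
move=> vu.
have E : block_mx (1%:M : 'M[C]_1) 0 (- u) 1%:M *m
         block_mx 1%:M (v^t* ) 0 (1%:M + u *m v^t* ) =
         block_mx 1%:M (v^t* ) 0 1%:M *m block_mx 1%:M 0 (- u) 1%:M.
  rewrite !mulmx_block !(mul1mx, mulmx1, mul0mx, mulmx0, addr0, add0r).
  by rewrite mulmxN vu oppr0 addr0 mulNmx addrCA addNr addr0.
have := congr1 determinant E.
by rewrite !det_mulmx !det_ublock !det_lblock !det1 !mul1r.
Qed.

(** Two distinct basis vectors show that off-diagonal entries vanish; then
    e_i + e_j and e_i - e_j show that diagonal entries agree. *)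
Lemma scalar_mx_of_orth k (M : 'M[C]_k.+1) :
  (forall u v : 'cV[C]_k.+1, v^t* *m u = 0 -> v^t* *m M *m u = 0) ->
  M = (M 0 0)%:M.
Proof.
move=> h.
pose e (i : 'I_k.+1) : 'cV[C]_k.+1 := delta_mx i 0.
have ee i j : (e i)^t* *m e j = (i == j)%:R%:M :> 'M[C]_1.
  rewrite /e trmx_delta map_delta_mx mul_delta_mx_cond.
  by apply/matrixP => a b; rewrite !ord1 !mxE; case: eqVneq; rewrite /= ?mxE // ?mulr1n ?mulr0n.
have eM i j : (e i)^t* *m M *m e j = (M i j)%:M :> 'M[C]_1.
  rewrite /e trmx_delta map_delta_mx -rowE -colE.
  by apply/matrixP => a b; rewrite !ord1 !mxE.
have off i j : i != j -> M i j = 0.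
  move=> ij; have := h (e j) (e i); rewrite ee (negPf ij) => /(_ (raddf0 _)).
  by rewrite eM => /matrixP/(_ 0 0); rewrite !mxE.
have trCB (x y : 'cV[C]_k.+1) : (x - y)^t* = x^t* - y^t*.
  by apply/matrixP => a b; rewrite !mxE rmorphB.
have diag i j : i != j -> M i i = M j j.
  move=> ij; have := h (e i + e j) (e i - e j).
  rewrite !trCB !mulmxBl !mulmxDr !ee !eM !eqxx (negPf ij) eq_sym (negPf ij).
  rewrite (off i j ij) (off j i); last by rewrite eq_sym.
  have -> : (0%:R)%:M = 0 :> 'M[C]_1 by rewrite raddf0.
  rewrite addr0 add0r subrr => /(_ (erefl _)); rewrite addr0 add0r.
  by move=> /matrixP/(_ 0 0); rewrite !mxE => /eqP; rewrite subr_eq0 => /eqP.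
apply/matrixP => i j; rewrite [RHS]mxE.
case: (eqVneq i j) => [<-|ij]; last by rewrite mulr0n off.
by rewrite mulr1n; case: (eqVneq i 0) => [->//|/diag].
Qed.

Variables (n : nat) (D : set T) (z : T -> 'cV[C]_n.+1).
Hypothesis zl : random_line D z.
Let mD : measurable D. Proof. by case: zl. Qed.
Let z0 t : D t -> z t != 0. Proof. by case: zl => _ h _ _; exact: h. Qed.
Local Notation Psi := (Psi P D z).

Lemma det1_unit (g : 'M[C]_n.+1) : \det g = 1 -> g \in unitmx.
Proof. by move=> dg; rewrite unitmxE dg unitr1. Qed.

(** Near g0 the factor |g z|^2 / |z|^2 stays above a positive constant, where ln
    is Lipschitz; and it depends on g^* g linearly, with bounded coefficients. *)
Lemma Psi_continuous : {within [set g : 'M[C]_n.+1 | \det g = 1], continuous Psi}.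
Proof.
apply/subspace_continuousP => g0 dg0; apply/cvgrPdist_le => e e0.
have ug0 := det1_unit dg0.
have [L hL] := ln_stretch_bounded ug0.
pose c := expR (- L).
have c0 : 0 < c by exact: expR_gt0.
have qc t : D t -> c <= stretch g0 (z t).
  move=> Dt; have q0 : 0 < stretch g0 (z t) by rewrite stretch_gt0 ?unit_nz ?z0.
  rewrite -[leRHS]lnK ?posrE// ler_expR.
  by have := hL _ (z0 Dt); rewrite ler_norml => /andP[].
pose f (g : 'M[C]_n.+1) := g^t* *m g.
have cf i j : ccont (fun g => f g i j).
  apply: (@ccont_mulmx R 'M[C]_n.+1) => ? ?; last exact: ccont_entry.
  by apply: (@ccont_trC R 'M[C]_n.+1) => ? ?; exact: ccont_entry.
have c2 : 0 < c / 2 by lra.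
have ec2 : 0 < e * (c / 2) by rewrite mulr_gt0.
have N1 := @mnormB_near R 'M[C]_n.+1 _ f g0 _ cf c2.
have N2 := @mnormB_near R 'M[C]_n.+1 _ f g0 _ cf ec2.
apply: filterS2 N1 N2 => g /= h1 h2 dg.
have ug := det1_unit dg.
have qd t : `|stretch g0 (z t) - stretch g (z t)| <= mnorm (f g - f g0).
  by rewrite distrC !stretch_hq -hqB hq_bound.
have i0 := ln_stretch_integrable P zl ug0; have i1 := ln_stretch_integrable P zl ug.
rewrite /Psi -RintegralB//.
have iB : P.-integrable D (EFin \o (fun t => ln (stretch g0 (z t)) - ln (stretch g (z t)))).
  by have := integrableB mD i0 i1; exact.
apply: le_trans (le_normr_Rintegral mD iB) _.
apply: (@le_trans _ _ (\int[P]_(t in D) e)); last first.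
  by rewrite Rint_cst// ger_pMr// mass_le1.
apply: le_Rintegral => //.
- by have := integrable_norm iB; exact.
- by apply: (@bounded_integrable _ _ _ _ _ _ `|e|).
move=> t Dt; have := qd t => qdt.
have := qc t Dt => qct.
have : c / 2 <= stretch g (z t) by have := le_trans (ler_norm _) qdt; lra.
move=> qcg; apply: le_trans (ln_dist c2 _ qcg) _; first by lra.
by rewrite ler_pdivrMr//; apply: le_trans qdt _; exact: ltW.
Qed.

Lemma Psi1 : Psi 1%:M = 0.
Proof.
rewrite /Psi (@eq_Rintegral _ _ _ _ _ (fun=> 0)) ?Rint_cst ?mul0r// => t /[!inE] Dt.
by rewrite stretch1 ?ln1// z0.
Qed.

(** Where Psi is at most its value 0 at the identity, g stays in a compact set. *)
Lemma Psi_min : strictly_spread P D z -> exists2 g : 'M[C]_n.+1, \det g = 1 &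
  forall h, \det h = 1 -> Psi g <= Psi h.
Proof.
move=> st; have [c [c0 hc]] := Psi_coercive zl st.
pose K := @box R n.+1 n.+1 (c + 1) `&` [set g | \det g = 1].
have cK : compact K.
  apply: subclosed_compact (@compact_box R n.+1 n.+1 (c + 1)) _; last by move=> ? [].
  apply: closedI; first by apply: compact_closed; [|exact: compact_box].
  by apply: closed_ccont; apply: (@ccont_det R 'M[C]_n.+1) => i j; exact: ccont_entry.
have K1 : K 1%:M.
  split; last by rewrite /= det1.
  move=> i j; rewrite mxE; case: eqVneq => _ /=; rewrite ?normr0 ?normr1; lra.
have [||g gK hg] := @compact_EVT_max _ R (fun g => - Psi g) K _ cK.
- by exists 1%:M.
- apply: continuous_subspaceW (_ : K `<=` [set g | \det g = 1]) _; first by move=> ? [].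
  by move=> x; apply: continuousN; exact: Psi_continuous.
have [_ dg] : K g by exact: set_mem gK.
exists g; first exact: dg.
move=> h dh.
have /orP[hP|hP] := le_total (Psi h) 0.
  have hK : h \in K.
    apply/mem_set; split => // i j; have [h1 h2] := hc h dh hP i j.
    split; lra.
  by have := hg h hK; rewrite lerN2.
apply: le_trans hP; rewrite -Psi1.
by have := hg 1%:M (mem_set K1); rewrite lerN2.
Qed.

(** First variation at a minimum g of Psi along the unipotent paths
    (1 + t u v^* ) g with v^* u = 0, which stay in the special linear group. Since
    ln x <= x - 1, Psi varies by at most a quadratic polynomial in t, whose linear
    coefficient must vanish. *)
Theorem strictly_spread_balanced : strictly_spread P D z -> exists2 g : 'M[C]_n.+1, \det g = 1 &
  avg P D (fun t => g *m z t) = (mu D / n.+1%:R)%:C%:M.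
Proof.
move=> st; have [g dg gmin] := Psi_min st; exists g => //.
have ug := det1_unit dg.
have wl := random_line_unit zl ug.
set w := fun t => g *m z t in wl *; set M := avg P D w.
have Mh : M^t* = M by exact: avg_herm.
have w0 t : D t -> w t != 0 by move=> Dt; rewrite unit_nz ?z0.
have ReX0 (u v : 'cV[C]_n.+1) : v^t* *m u = 0 -> rRe (\tr (u *m v^t* *m M)) = 0.
  move=> vu; set X := u *m v^t*.
  pose a := rRe (\tr (X *m M)); pose b := rRe (\tr (X^t* *m X *m M)).
  have ab (t : R) : 0 <= 2 * t * a + t ^+ 2 * b.
    pose Y : 'M[C]_n.+1 := 1%:M + t%:C *: X.
    have YY : Y^t* *m Y - 1%:M = t%:C *: (X + X^t* ) + (t ^+ 2)%:C *: (X^t* *m X).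
      have -> : Y^t* = 1%:M + t%:C *: X^t*.
        apply/matrixP => i j; rewrite !mxE rmorphD rmorphM rmorph_nat [i == j]eq_sym.
        by congr (_ + _ * _); apply: conj_Creal; apply/complex_realP; exists t.
      rewrite /Y mulmxDl !mulmxDr !mul1mx mulmx1 -scalemxAl -scalemxAr scalerA.
      rewrite scalerDr -rmorphM -expr2 [LHS]addrC !addrA addNr add0r.
      by rewrite (addrC (_ *: X)) -!addrA; congr (_ + _).
    have dY : \det Y = 1.
      rewrite /Y /X scalemxAl; apply: det_transvection.
      by rewrite -scalemxAr vu scaler0.
    have uY := det1_unit dY.
    have : Psi g <= Psi (Y *m g) by apply: gmin; rewrite det_mulmx dY dg mul1r.
    rewrite -subr_ge0 /Psi -RintegralB//; last 2 first.
    - by apply: ln_stretch_integrable; rewrite ?unitmx_mul ?uY.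
    - exact: ln_stretch_integrable.
    move=> /le_trans; apply.
    apply: (@le_trans _ _ (\int[P]_(s in D) hq (t%:C *: (X + X^t* ) + (t ^+ 2)%:C *: (X^t* *m X)) (w s))).
      apply: le_Rintegral => //; last 2 first.
      - exact: hq_integrable.
      - move=> s Ds; rewrite stretchM ?w0// lnM ?posrE ?stretch_gt0 ?unit_nz ?z0// addrK.
        rewrite (le_trans (ln_le_subr1 _))// ?stretch_gt0 ?unit_nz ?z0//.
        rewrite -[X in _ - X](hq1 (w0 _ Ds)) stretch_hq -hqB.
        rewrite le_eqVlt; apply/orP; left; apply/eqP; congr (hq _ _).
        exact: YY.
      have := integrableB mD (ln_stretch_integrable P zl (_ : Y *m g \in unitmx)) (ln_stretch_integrable P zl ug).
      by apply; rewrite unitmx_mul uY.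
    by rewrite (Rint_hq P wl) Re_tr_quad.
  exact: quad_nonneg ab.
have X0 (u v : 'cV[C]_n.+1) : v^t* *m u = 0 -> v^t* *m M *m u = 0.
  move=> vu; have vuM : \tr (u *m v^t* *m M) = (v^t* *m M *m u) 0 0.
    by rewrite -mulmxA mxtrace_mulC /mxtrace big_ord1.
  apply/matrixP => i j; rewrite !ord1 [RHS]mxE -vuM; apply: complex_ext.
    exact: ReX0.
  (* The imaginary part comes from replacing u by i u. *)
  have := ReX0 ('i%C *: u) v; rewrite -scalemxAr vu scaler0 => /(_ (erefl _)).
  rewrite -!scalemxAl mxtraceZ ReM /= mul0r mul1r sub0r => /eqP.
  by rewrite oppr_eq0 => /eqP.
have /scalar_mx_of_orth MM := X0.
have := tr_avg P wl; rewrite -/M MM mxtrace_scalar => h; congr (_%:M).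
apply: (@mulIf _ n.+1%:R); first by rewrite pnatr_eq0.
by rewrite mulr_natr h -(rmorph_nat (real_complex R)) -rmorphM /= divfK ?pnatr_eq0.
Qed.
End Existence.

(** * Rigidity of balanced positions *)

Section Jensen.
Context d (T : measurableType d) (R : realType) (P : probability T R).
Local Notation C := R[i].
Local Notation mu := (mass P).
Variables (n : nat) (D : set T) (z : T -> 'cV[C]_n.+1).
Hypothesis zl : random_line D z.
Let mD : measurable D. Proof. by case: zl. Qed.
Let z0 t : D t -> z t != 0. Proof. by case: zl => _ h _ _; exact: h. Qed.
Local Notation Psi := (Psi P D z).
Hypothesis bal : avg P D z = (mu D / n.+1%:R)%:C%:M.

Section Fixed.
Variables (V : 'M[C]_n.+1) (b : nat -> R).
Hypotheses (VV : V *m V^t* = 1%:M) (sb : \sum_(i < n.+1) b i = 0).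

Let p (i : 'I_n.+1) t : R := sqn ((V *m z t) i 0) / nsq (z t).
Let S t : R := stretch (expdiag n.+1 b *m V) (z t).

Let pE i t : p i t = stretch (delta_mx i i *m V) (z t).
Proof.
rewrite /p /stretch -mulmxA; congr (_ / _); rewrite /nsq (bigD1 i)//= big1 => [|j ji].
  by rewrite delta_mx_coef eqxx mul1r addr0.
by rewrite delta_mx_coef (negPf ji) mul0r /sqn /= expr0n addr0.
Qed.

Let p_ge0 i t : 0 <= p i t.
Proof. by rewrite pE stretch_ge0. Qed.

Let sum_p t : D t -> \sum_(i < n.+1) p i t = 1.
Proof.
by move=> Dt; rewrite /p -mulr_suml -/(nsq _) unitary_nsq// divff// nsq_eq0 z0.
Qed.

Let S_gt0 t : D t -> 0 < S t.
Proof.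
move=> Dt; have uV : V \in unitmx by have [] := mulmx1_unit VV.
by rewrite stretch_gt0 ?unit_nz ?z0// unitmx_mul expdiag_unit.
Qed.

Let SE t : S t = \sum_(i < n.+1) expR (b i) * p i t.
Proof. by rewrite /S stretch_expdiag_sum. Qed.

Let int_p i : \int[P]_(t in D) p i t = mu D / n.+1%:R.
Proof.
under eq_Rintegral do rewrite pE stretch_hq.
rewrite (Rint_hq _ zl) bal mul_mx_scalar mxtraceZ trCM.
rewrite mulmxA mxtrace_mulC !mulmxA VV mul1mx.
rewrite trmx_delta map_delta_mx mul_delta_mx /mxtrace (bigD1 i)//= big1 => [|j ji].
  by rewrite mxE !eqxx addr0 mulr1.
by rewrite mxE (negPf ji).
Qed.

(** The deficit in Jensen's inequality for ln, with the weights p i t. *)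
Let J t : R := ln (S t) - \sum_(i < n.+1) b i * p i t.

Let JE t : D t ->
  J t = \sum_(i < n.+1) p i t * (expR (b i) / S t - 1 - ln (expR (b i) / S t)).
Proof.
move=> Dt; have S0 := S_gt0 Dt.
under eq_bigr => i _ do rewrite ln_div ?posrE ?expR_gt0// expRK.
have -> : \sum_(i < n.+1) p i t * (expR (b i) / S t - 1 - (b i - ln (S t))) =
  (\sum_(i < n.+1) expR (b i) * p i t) / S t - \sum_(i < n.+1) p i t - \sum_(i < n.+1) b i * p i t +
  ln (S t) * \sum_(i < n.+1) p i t.
  rewrite mulr_suml mulr_sumr -!sumrB -big_split/=; apply: eq_bigr => i _.
  by rewrite mulrBr mulrBr; ring.
by rewrite -SE sum_p// divff ?gt_eqF// mulr1 subrr sub0r addrC.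
Qed.

Let term_ge0 i t : D t -> 0 <= p i t * (expR (b i) / S t - 1 - ln (expR (b i) / S t)).
Proof.
move=> Dt; rewrite mulr_ge0// subr_ge0 ln_le_subr1// divr_gt0 ?expR_gt0//; exact: S_gt0.
Qed.

Let J_ge0 t : D t -> 0 <= J t.
Proof. by move=> Dt; rewrite JE//; apply: sumr_ge0 => i _; exact: term_ge0. Qed.

Let uEV : expdiag n.+1 b *m V \in unitmx.
Proof. by rewrite unitmx_mul expdiag_unit; have [] := mulmx1_unit VV. Qed.

Let ip i : P.-integrable D (EFin \o (fun t => p i t)).
Proof.
rewrite (_ : _ \o _ = EFin \o (fun t => hq ((delta_mx i i *m V)^t* *m (delta_mx i i *m V)) (z t))).
  exact: hq_integrable.
by apply/funext => t /=; rewrite pE stretch_hq.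
Qed.

Let ibp (i : 'I_n.+1) : P.-integrable D (EFin \o (fun t => b i * p i t)).
Proof. by have := integrableZl mD (b i) (ip i); exact. Qed.

Let iJ : P.-integrable D (EFin \o J).
Proof.
have [isum _] := Rint_sum (index_enum 'I_n.+1) mD ibp.
by have := integrableB mD (ln_stretch_integrable P zl uEV) isum; exact.
Qed.

Let int_J : \int[P]_(t in D) J t = Psi (expdiag n.+1 b *m V).
Proof.
have [isum sumE] := Rint_sum (index_enum 'I_n.+1) mD ibp.
rewrite RintegralB//; last exact: ln_stretch_integrable.
rewrite sumE (eq_bigr (fun i : 'I_n.+1 => b i * (mu D / n.+1%:R))).
  by rewrite -mulr_suml sb mul0r subr0.
by move=> i _; rewrite RintegralZl// int_p.
Qed.

Lemma Psi_expdiag_ge0 : 0 <= Psi (expdiag n.+1 b *m V).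
Proof. by rewrite -int_J; apply: Rintegral_ge0. Qed.

(** If Psi vanishes, so does Jensen's deficit at almost every line: e^(b_i) takes
    the same value at all coordinates i that are nonzero on the line. If b
    dropped after the index r, almost every line would lie in one of two
    complementary subspaces; being strictly spread, z gives them less mass than
    their shares, which add up to the total. *)
Lemma Psi_expdiag_eq0 : strictly_spread P D z -> Psi (expdiag n.+1 b *m V) = 0 ->
  (forall i j, (i <= j)%N -> (j < n.+1)%N -> b j <= b i) ->
  forall r, (r < n)%N -> b r.+1 = b r.
Proof.
move=> st P0 bd r rn; apply/eqP/contraT => br.
have {}br : b r.+1 < b r by rewrite lt_neqAle br bd.
have uV : V \in unitmx by have [] := mulmx1_unit VV.
have aeJ : ae_eq P D (EFin \o J) (cst 0)%E.
  apply/(ae_eq_integral_abs _ mD); first exact: measurable_int iJ.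
  rewrite (@eq_integral _ _ _ _ _ (EFin \o J)); last first.
    by move=> t /[!inE] Dt; rewrite /= ger0_norm// J_ge0.
  have := int_J; rewrite P0 /Rintegral => h.
  rewrite -[LHS]fineK ?h//.
  by apply: integrable_fin_num => //; exact: iJ.
have [N [mN N0 hN]] := aeJ.
pose A1 := D `&` [set t | (pid_mx r.+1 *m V : 'M[C]_n.+1) *m z t = 0].
pose A2 := D `&` [set t | (copid_mx r.+1 *m V : 'M[C]_n.+1) *m z t = 0].
have mA1 : measurable A1 by exact: measurable_ker.
have mA2 : measurable A2 by exact: measurable_ker.
have cover : D `<=` A1 `|` A2 `|` N.
  move=> t Dt; have [Nt|Nt] := pselect (N t); [by right|left].
  have Jt : J t = 0.
    apply: contra_notP Nt => Jt; apply: hN => /= h; apply: Jt.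
    by have [] := h Dt.
  have pt (i : 'I_n.+1) : p i t = 0 \/ expR (b i) = S t.
    have : p i t * (expR (b i) / S t - 1 - ln (expR (b i) / S t)) = 0.
      move: Jt; rewrite JE// => /eqP; rewrite psumr_eq0; last by move=> ? _; exact: term_ge0.
      by move=> /allP/(_ i (mem_index_enum i))/eqP.
    move=> /eqP; rewrite mulf_eq0 => /orP[/eqP ->|/eqP h]; [by left|right].
    have S0 := S_gt0 Dt.
    have := ln_sub1_eq (divr_gt0 (expR_gt0 (b i)) S0) h => /(congr1 ( *%R^~ (S t))).
    by rewrite divfK ?gt_eqF// mul1r.
  have p0 i : p i t = 0 -> (V *m z t) i 0 = 0.
    move/eqP; rewrite mulf_eq0 invr_eq0 nsq_eq0 (negPf (z0 Dt)) orbF sqn_eq0.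
    by move/eqP.
  have [/existsP[i /andP[ir pi]]|] := boolP [exists i : 'I_n.+1, (i <= r)%N && (p i t != 0)].
    right; split=> //=; rewrite -mulmxA; apply/colP => j.
    have -> : (copid_mx r.+1 *m (V *m z t)) j 0 = (V *m z t) j 0 - (pid_mx r.+1 *m (V *m z t)) j 0.
      by rewrite /copid_mx mulmxBl mul1mx [LHS]mxE [X in _ + X]mxE.
    rewrite pid_mx_coef [RHS]mxE; case: ifP => jr; first by rewrite subrr.
    rewrite subr0; apply: p0; have [//|] := pt j.
    have [pi0|<-] := pt i; first by rewrite pi0 eqxx in pi.
    move/expR_inj => bji.
    have jr' : (r < j)%N by rewrite ltnNge -ltnS jr.
    have : b j <= b r.+1 by apply: bd.
    have : b r <= b i by apply: bd => //; apply: ltn_trans rn _.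
    lra.
  rewrite negb_exists => /forallP h; left; split=> //=; rewrite -mulmxA; apply/colP => j.
  rewrite pid_mx_coef [RHS]mxE; case: ifP => // jr; apply: p0.
  by have := h j; rewrite -ltnS jr /= negbK => /eqP.
have : mu D <= mu A1 + mu A2.
  have mN0 : mu N = 0 by rewrite /mass N0.
  have mA12 : measurable (A1 `|` A2) by exact: measurableU.
  apply: le_trans (mass_le P mD (measurableU _ _ mA12 mN) cover) _.
  apply: le_trans (mass_setU_le P mA12 mN) _; rewrite mN0 addr0.
  exact: mass_setU_le.
have r1 : \rank (pid_mx r.+1 *m V : 'M[C]_n.+1) = r.+1.
  by rewrite mxrankMfree ?row_free_unit// rank_pid_mx// ltnW.
have r2 : \rank (copid_mx r.+1 *m V : 'M[C]_n.+1) = (n.+1 - r.+1)%N.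
  by rewrite mxrankMfree ?row_free_unit// rank_copid_mx// ltnW.
have := st _ (_ : (0 < \rank (pid_mx r.+1 *m V : 'M[C]_n.+1) < n.+1)%N).
rewrite r1 !ltnS rn => /(_ isT); rewrite -/A1.
have := st _ (_ : (0 < \rank (copid_mx r.+1 *m V : 'M[C]_n.+1) < n.+1)%N).
have r2' : (0 < n.+1 - r.+1 < n.+1)%N by rewrite subSS subn_gt0 rn ltnS leq_subr.
rewrite r2 r2' => /(_ isT); rewrite -/A2 subKn//; last exact: ltnW.
rewrite natrB 1?ltnW// => h2 h1 h.
have : mu D * n.+1%:R < mu D * n.+1%:R.
  apply: (@le_lt_trans _ _ ((mu A1 + mu A2) * n.+1%:R)); first by rewrite ler_wpM2r.
  by rewrite mulrDl; apply: lt_le_trans (ltrD h1 h2) _; rewrite -mulrDr subrK.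
by rewrite ltxx.
Qed.
End Fixed.

Lemma Psi_ge0 (g : 'M[C]_n.+1) : \det g = 1 -> 0 <= Psi g.
Proof.
move=> dg; have [V [b [VV bd gg]]] := unit_expdiag (det1_unit dg).
by rewrite (eq_Psi P D z gg) Psi_expdiag_ge0// (expdiag_sum0 VV gg dg).
Qed.

Lemma Psi_eq0_unitary (g : 'M[C]_n.+1) : strictly_spread P D z ->
  \det g = 1 -> Psi g = 0 -> g^t* *m g = 1%:M.
Proof.
move=> st dg; have [V [b [VV bd gg]]] := unit_expdiag (det1_unit dg).
have sb := expdiag_sum0 VV gg dg.
rewrite (eq_Psi P D z gg) => /(Psi_expdiag_eq0 VV sb st) => /(_ bd) bS.
have bc r : (r <= n)%N -> b r = b 0%N.
  by elim: r => // r IH rn; rewrite bS// IH// ltnW.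
have b0 : b 0%N = 0.
  move: sb; rewrite (eq_bigr (fun=> b 0%N)) => [|i _]; last by rewrite bc// -ltnS.
  by rewrite sumr_const card_ord => /eqP; rewrite mulrn_eq0 => /eqP.
rewrite gg (_ : expdiag n.+1 b = 1%:M) ?mul1mx; first exact: mulmx1C.
have bi (i : 'I_n.+1) : b i = 0 by rewrite bc ?b0// -ltnS ltn_ord.
apply/matrixP => i j; rewrite !mxE bi mul0r expR0.
by case: eqVneq.
Qed.
End Jensen.

(** * Initial forms and balanced degenerations *)

Section InitialForm.
Variable R : realType.
Local Notation C := R[i].

Definition wmax k (al : 'I_k -> nat) (w : 'cV[C]_k) : nat :=
  \max_(j | w j 0 != 0) al j.

(** Under diag(s^al) with s growing, the coordinates of greatest weight dominate,
    so the line of w tends to the line of its initial form. *)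
Definition initial_form k (al : 'I_k -> nat) (w : 'cV[C]_k) : 'cV[C]_k :=
  \col_i (if al i == wmax al w then w i 0 else 0).

Lemma initial_form_neq0 k (al : 'I_k -> nat) (w : 'cV[C]_k) : w != 0 -> initial_form al w != 0.
Proof.
move=> /colv_neq0[j wj].
have c0 : (0 < #|[pred j | (w j 0 != 0)%R]|)%N by apply/card_gt0P; exists j.
have [j' wj' jmax] := eq_bigmax_cond al c0.
apply: contraTneq isT => /colP/(_ j'); rewrite !mxE /wmax jmax eqxx => h.
by move: wj'; rewrite inE h eqxx.
Qed.

Lemma initial_form_cst k (w : 'cV[C]_k) : initial_form (fun=> 0%N) w = w.
Proof.
apply/colP => i; rewrite mxE /wmax (_ : \max_(j | _) _ = 0%N) ?eqxx//.
by apply/eqP; rewrite -leqn0; apply/bigmax_leqP.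
Qed.

(** All weights on the upper block are made larger than those on the lower one,
    so that the lower block counts only where the upper one vanishes. *)
Lemma initial_form_block r s (al2 : 'I_r -> nat) (al1 : 'I_s -> nat) :
  exists al : 'I_(r + s) -> nat,
    (forall (x : 'cV[C]_r) y, x != 0 -> initial_form al (col_mx x y) = col_mx (initial_form al2 x) 0) /\
    (forall y : 'cV[C]_s, initial_form al (col_mx 0 y) = col_mx 0 (initial_form al1 y)).
Proof.
(* Shifting by N puts the weights of the upper block above all others. *)
pose N := (\max_j al1 j).+1.
pose al (i : 'I_(r + s)) := match fintype.split i with
  inl a => (al2 a + N)%N | inr b => al1 b end.
exists al.
have alL a : al (lshift s a) = (al2 a + N)%N by rewrite /al (unsplitK (inl a)).
have alR b : al (rshift r b) = al1 b by rewrite /al (unsplitK (inr b)).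
have al1N b : (al1 b < N)%N by rewrite ltnS; exact: leq_bigmax.
split=> [x y x0|y].
  have [a xa] := colv_neq0 x0.
  have wE : wmax al (col_mx x y) = (wmax al2 x + N)%N.
    rewrite /wmax big_split_ord/=.
    under eq_bigl do rewrite col_mxEu.
    under [X in maxn _ X]eq_bigl do rewrite col_mxEd.
    under eq_bigr do rewrite alL.
    under [X in maxn _ X]eq_bigr do rewrite alR.
    have c0 : (0 < #|[pred j | (x j 0 != 0)%R]|)%N by apply/card_gt0P; exists a.
    have -> : \max_(i | x i 0 != 0) (al2 i + N)%N = (\max_(i | (x i 0 != 0)%R) al2 i + N)%N.
      apply/eqP; rewrite eqn_leq; apply/andP; split.
        by apply/bigmax_leqP => i xi; rewrite leq_add2r; apply: leq_bigmax_cond.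
      have [i xi ->] := eq_bigmax_cond al2 c0.
      exact: (@leq_bigmax_cond _ _ (fun i => al2 i + N)%N).
    apply/maxn_idPl; apply/bigmax_leqP => i _.
    by apply: leq_trans (ltnW (al1N i)) _; exact: leq_addl.
  apply/colP => i; rewrite [LHS]mxE wE; case: (split_ordP i) => {}i ->.
    by rewrite !col_mxEu alL eqn_add2r mxE.
  rewrite !col_mxEd alR mxE ltn_eqF//.
  by apply: leq_trans (al1N i) _; exact: leq_addl.
have wE : wmax al (col_mx 0 y) = wmax al1 y.
  rewrite /wmax big_split_ord/=.
  rewrite big_pred0 ?max0n; last by move=> a; rewrite col_mxEu mxE eqxx.
  under eq_bigl do rewrite col_mxEd.
  by under eq_bigr do rewrite alR.
apply/colP => i; rewrite [LHS]mxE wE; case: (split_ordP i) => {}i ->.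
  by rewrite !col_mxEu mxE if_same.
by rewrite !col_mxEd alR mxE.
Qed.

Lemma nsq_col_mx r s (x : 'cV[C]_r) (y : 'cV[C]_s) :
  nsq (col_mx x y) = nsq x + nsq y.
Proof.
rewrite /nsq big_split_ord/=; congr (_ + _); apply: eq_bigr => i _.
  by rewrite col_mxEu.
by rewrite col_mxEd.
Qed.

Lemma nsq0 k : nsq (0 : 'cV[C]_k) = 0.
Proof. by apply/eqP; rewrite nsq_eq0. Qed.

Lemma line_proj_col_mx0 r s (x : 'cV[C]_r) :
  line_proj (col_mx x (0 : 'cV[C]_s)) = block_mx (line_proj x) 0 0 0.
Proof.
rewrite !line_projE nsq_col_mx nsq0 addr0 tr_col_mx map_row_mx mul_col_row.
by rewrite !mul0mx trmx0 map_mx0 !mulmx0 scale_block_mx !scaler0.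
Qed.

Lemma line_proj_col_0mx r s (y : 'cV[C]_s) :
  line_proj (col_mx (0 : 'cV[C]_r) y) = block_mx 0 0 0 (line_proj y).
Proof.
rewrite !line_projE nsq_col_mx nsq0 add0r tr_col_mx map_row_mx mul_col_row.
by rewrite !mul0mx trmx0 map_mx0 !mulmx0 scale_block_mx !scaler0.
Qed.
End InitialForm.

Section Semi.
Context d (T : measurableType d) (R : realType) (P : probability T R).
Local Notation C := R[i].
Local Notation mu := (mass P).

Definition spread k (D : set T) (z : T -> 'cV[C]_k) : Prop := forall B : 'M[C]_k,
  mu (D `&` [set t | B *m z t = 0]) * k%:R <= mu D * (k - \rank B)%:R.

Lemma eq_avg k (D : set T) (w w' : T -> 'cV[C]_k) :
  (forall t, D t -> w t = w' t) -> avg P D w = avg P D w'.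
Proof.
move=> h; apply/matrixP => i j; rewrite [LHS]mxE [RHS]mxE.
apply: complex_ext; rewrite /=.
  by apply: eq_Rintegral => t /[!inE] /h ->.
by apply: eq_Rintegral => t /[!inE] /h ->.
Qed.

Lemma eq_random_line k (D : set T) (w w' : T -> 'cV[C]_k) :
  (forall t, D t -> w t = w' t) -> random_line D w -> random_line D w'.
Proof.
move=> h [mD w0 m1 m2]; split; first exact: mD.
- by move=> t Dt; rewrite -h// w0.
- by move=> i j; apply: eq_measurable_fun (m1 i j) => t /[!inE] /h ->.
- by move=> i j; apply: eq_measurable_fun (m2 i j) => t /[!inE] /h ->.
Qed.

Lemma random_line_setU k (D D' : set T) (w : T -> 'cV[C]_k) :
  random_line D w -> random_line D' w -> random_line (D `|` D') w.
Proof.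
move=> [mD w0 m1 m2] [mD' w0' m1' m2']; split; first exact: measurableU.
- by move=> t []; [exact: w0|exact: w0'].
- by move=> i j; apply/measurable_funU.
- by move=> i j; apply/measurable_funU.
Qed.

Lemma avg_setU k (D D' : set T) (w : T -> 'cV[C]_k) :
  random_line D w -> random_line D' w -> [disjoint D & D'] ->
  avg P (D `|` D') w = avg P D w + avg P D' w.
Proof.
move=> wD wD' DD'; have wU := random_line_setU wD wD'.
have [mD _ _ _] := wD; have [mD' _ _ _] := wD'.
apply/matrixP => i j; rewrite !mxE /= Rintegral_setU//; last exact: random_line_integrable_Re.
by rewrite Rintegral_setU//; exact: random_line_integrable_Im.
Qed.

Lemma Rint0 (D : set T) : \int[P]_(t in D) (0 : R) = 0.
Proof. by rewrite /Rintegral integral0. Qed.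

Lemma avg_col_mx0 r s (D : set T) (x : T -> 'cV[C]_r) :
  avg P D (fun t => col_mx (x t) (0 : 'cV[C]_s)) = block_mx (avg P D x) 0 0 0.
Proof.
apply/matrixP => i j; rewrite mxE.
under eq_Rintegral do rewrite line_proj_col_mx0.
under [X in _ +i* X]eq_Rintegral do rewrite line_proj_col_mx0.
case: (split_ordP i) => {}i ->; case: (split_ordP j) => {}j ->.
- under eq_Rintegral do rewrite block_mxEul.
  by under [X in _ +i* X]eq_Rintegral do rewrite block_mxEul; rewrite block_mxEul mxE.
- under eq_Rintegral do rewrite block_mxEur mxE.
  by under [X in _ +i* X]eq_Rintegral do rewrite block_mxEur mxE; rewrite block_mxEur mxE !Rint0.
- under eq_Rintegral do rewrite block_mxEdl mxE.
  by under [X in _ +i* X]eq_Rintegral do rewrite block_mxEdl mxE; rewrite block_mxEdl mxE !Rint0.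
- under eq_Rintegral do rewrite block_mxEdr mxE.
  by under [X in _ +i* X]eq_Rintegral do rewrite block_mxEdr mxE; rewrite block_mxEdr mxE !Rint0.
Qed.

Lemma avg_col_0mx r s (D : set T) (y : T -> 'cV[C]_s) :
  avg P D (fun t => col_mx (0 : 'cV[C]_r) (y t)) = block_mx 0 0 0 (avg P D y).
Proof.
apply/matrixP => i j; rewrite mxE.
under eq_Rintegral do rewrite line_proj_col_0mx.
under [X in _ +i* X]eq_Rintegral do rewrite line_proj_col_0mx.
case: (split_ordP i) => {}i ->; case: (split_ordP j) => {}j ->.
- under eq_Rintegral do rewrite block_mxEul mxE.
  by under [X in _ +i* X]eq_Rintegral do rewrite block_mxEul mxE; rewrite block_mxEul mxE !Rint0.
- under eq_Rintegral do rewrite block_mxEur mxE.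
  by under [X in _ +i* X]eq_Rintegral do rewrite block_mxEur mxE; rewrite block_mxEur mxE !Rint0.
- under eq_Rintegral do rewrite block_mxEdl mxE.
  by under [X in _ +i* X]eq_Rintegral do rewrite block_mxEdl mxE; rewrite block_mxEdl mxE !Rint0.
- under eq_Rintegral do rewrite block_mxEdr.
  by under [X in _ +i* X]eq_Rintegral do rewrite block_mxEdr; rewrite block_mxEdr mxE.
Qed.

Lemma random_line_col_mx0 r s (D : set T) (x : T -> 'cV[C]_r) : random_line D x ->
  random_line D (fun t => col_mx (x t) (0 : 'cV[C]_s)).
Proof.
move=> xl; have [mD x0 _ _] := xl.
apply: (@eq_random_line _ _ (fun t => col_mx 1%:M 0 *m x t)) => [t Dt|].
  by rewrite mul_col_mx mul1mx mul0mx.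
apply: (random_line_mul xl) => // t Dt; rewrite mul_col_mx mul1mx mul0mx.
by rewrite -nsq_eq0 nsq_col_mx nsq0 addr0 nsq_eq0 x0.
Qed.

Lemma random_line_col_0mx r s (D : set T) (y : T -> 'cV[C]_s) : random_line D y ->
  random_line D (fun t => col_mx (0 : 'cV[C]_r) (y t)).
Proof.
move=> xl; have [mD x0 _ _] := xl.
apply: (@eq_random_line _ _ (fun t => col_mx 0 1%:M *m y t)) => [t Dt|].
  by rewrite mul_col_mx mul1mx mul0mx.
apply: (random_line_mul xl) => // t Dt; rewrite mul_col_mx mul1mx mul0mx.
by rewrite -nsq_eq0 nsq_col_mx nsq0 add0r nsq_eq0 x0.
Qed.

(** As s grows, diag(s^al) g moves each line z t to its initial form; the limit
    is required to be balanced. *)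
Definition degenerates k (D : set T) (z : T -> 'cV[C]_k) : Prop :=
  exists g : 'M[C]_k, exists al : 'I_k -> nat,
  [/\ g \in unitmx, random_line D (fun t => initial_form al (g *m z t)) &
      avg P D (fun t => initial_form al (g *m z t)) = (mu D / k%:R)%:C%:M].

Lemma degenerates_unit k (D : set T) (z : T -> 'cV[C]_k) (h : 'M[C]_k) :
  h \in unitmx -> degenerates D (fun t => h *m z t) -> degenerates D z.
Proof.
move=> uh [g [al [ug rl av]]]; exists (g *m h), al; split.
- by rewrite unitmx_mul ug.
- by apply: eq_random_line rl => t _; rewrite mulmxA.
- by rewrite -av; apply: eq_avg => t _; rewrite mulmxA.
Qed.

Lemma spread_unit k (D : set T) (z : T -> 'cV[C]_k) (h : 'M[C]_k) :
  h \in unitmx -> spread D z -> spread D (fun t => h *m z t).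
Proof.
move=> uh sz B; have := sz (B *m h).
rewrite mxrankMfree ?row_free_unit//.
by under eq_set do rewrite -mulmxA.
Qed.

Lemma strictly_spread_unit k (D : set T) (z : T -> 'cV[C]_k) (h : 'M[C]_k) :
  h \in unitmx -> strictly_spread P D z -> strictly_spread P D (fun t => h *m z t).
Proof.
move=> uh st B Bn; have := st (B *m h).
rewrite mxrankMfree ?row_free_unit// => /(_ Bn).
by under eq_set do rewrite -mulmxA.
Qed.

Section Split.
Variables (r s : nat) (D : set T) (z : T -> 'cV[C]_(r + s)).
Hypotheses (r0 : (0 < r)%N) (s0 : (0 < s)%N).
Hypotheses (zl : random_line D z) (zs : spread D z).
Let D1 := D `&` [set t | usubmx (z t) = 0].
Let D2 := D `\` D1.
Hypothesis D1E : mu D1 * (r + s)%:R = mu D * s%:R.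

Let rs0 : 0 < (r + s)%:R :> R. Proof. by rewrite ltr0n addn_gt0 r0. Qed.
Let mD : measurable D. Proof. by case: zl. Qed.
Let z0 t : D t -> z t != 0. Proof. by case: zl => _ h _ _; exact: h. Qed.

Let usubE t : usubmx (z t) = row_mx 1%:M 0 *m z t.
Proof. by rewrite -[in RHS](vsubmxK (z t)) mul_row_col mul1mx mul0mx addr0. Qed.
Let dsubE t : dsubmx (z t) = row_mx 0 1%:M *m z t.
Proof. by rewrite -[in RHS](vsubmxK (z t)) mul_row_col mul1mx mul0mx add0r. Qed.

Let mD1 : measurable D1.
Proof.
rewrite (_ : D1 = D `&` [set t | (row_mx 1%:M 0 : 'M[C]_(r, r + s)) *m z t = 0]).
  exact: measurable_ker.
by congr (_ `&` _); apply/seteqP; split => t /=; rewrite usubE.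
Qed.
Let mD2 : measurable D2. Proof. exact: measurableD. Qed.

Let D1D : D1 `<=` D. Proof. by move=> t []. Qed.
Let D2D : D2 `<=` D. Proof. by move=> t []. Qed.

Let D1m : mu D1 / s%:R = mu D / (r + s)%:R.
Proof.
have s1 : 0 < s%:R :> R by rewrite ltr0n.
by apply/eqP; rewrite eqr_div; [rewrite D1E|rewrite gt_eqF|rewrite gt_eqF].
Qed.

Let D2E : mu D2 * (r + s)%:R = mu D * r%:R.
Proof.
rewrite /D2 mass_setD// (_ : D `&` D1 = D1); last by apply/setIidPr.
by rewrite mulrBl D1E natrD; ring.
Qed.

Let D2m : mu D2 / r%:R = mu D / (r + s)%:R.
Proof.
have r1 : 0 < r%:R :> R by rewrite ltr0n.
by apply/eqP; rewrite eqr_div; [rewrite D2E|rewrite gt_eqF|rewrite gt_eqF].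
Qed.

Let z2 t := usubmx (z t).
Let z1 t := dsubmx (z t).

Let z2_neq0 t : D2 t -> z2 t != 0.
Proof. by move=> [Dt nD1]; apply/eqP => h; apply: nD1. Qed.

Let z1_neq0 t : D1 t -> z1 t != 0.
Proof.
move=> [Dt /= h]; apply: contraNneq (z0 Dt) => h'.
by rewrite -(vsubmxK (z t)) h -/(z1 t) h' col_mx0.
Qed.

Let rl2 : random_line D2 z2.
Proof.
apply: (@eq_random_line _ _ (fun t => row_mx 1%:M 0 *m z t)) => [t _|]; first by rewrite -usubE.
by apply: (random_line_mul zl) => // t /z2_neq0; rewrite -usubE.
Qed.

Let rl1 : random_line D1 z1.
Proof.
apply: (@eq_random_line _ _ (fun t => row_mx 0 1%:M *m z t)) => [t _|]; first by rewrite -dsubE.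
by apply: (random_line_mul zl) => // t /z1_neq0; rewrite -dsubE.
Qed.

Let semi2 : spread D2 z2.
Proof.
move=> B.
have : mu (D2 `&` [set t | B *m z2 t = 0]) * (r + s)%:R <= mu D * (r - \rank B)%:R.
  have := zs (block_mx B 0 0 0).
  rewrite rank_diag_block_mx mxrank0 addn0.
  have -> : D `&` [set t | (block_mx B 0 0 0 : 'M[C]_(r + s)) *m z t = 0] = D `&` [set t | B *m z2 t = 0].
    apply/seteqP; split => t [Dt /= h]; split=> //=.
      move: h; rewrite -[X in _ *m X](vsubmxK (z t)) mul_block_col !mul0mx !addr0.
      by move=> /(congr1 usubmx); rewrite col_mxKu linear0.
    rewrite -(vsubmxK (z t)) mul_block_col !mul0mx !addr0.
    by rewrite -/(z2 t) h col_mx0.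
  set K := D `&` [set t | B *m z2 t = 0].
  have mK : measurable K.
    rewrite (_ : K = D `&` [set t | (B *m row_mx 1%:M 0 : 'M[C]_(r, r + s)) *m z t = 0]).
      exact: measurable_ker.
    by congr (_ `&` _); apply/seteqP; split => t /=; rewrite /z2 usubE mulmxA.
  have -> : D2 `&` [set t | B *m z2 t = 0] = K `\` D1.
    by apply/seteqP; split => t; rewrite /K /D2 /setD /=; tauto.
  rewrite mass_setD// (_ : K `&` D1 = D1); last first.
    by apply/setIidPr => t [Dt /= h]; split=> //=; rewrite /z2 h mulmx0.
  have rB : (\rank B <= r)%N by exact: rank_leq_row.
  rewrite mulrBl D1E -addnBAC// !natrD mulrDr; lra.
move=> H; rewrite -(ler_pM2r rs0) mulrAC.
apply: (@le_trans _ _ (mu D * (r - \rank B)%:R * r%:R)); first by rewrite ler_wpM2r.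
by rewrite [leRHS]mulrAC D2E mulrAC.
Qed.

Let semi1 : spread D1 z1.
Proof.
move=> B.
have : mu (D1 `&` [set t | B *m z1 t = 0]) * (r + s)%:R <= mu D * (s - \rank B)%:R.
  have := zs (block_mx 1%:M 0 0 B).
  rewrite rank_diag_block_mx mxrank1 subnDl.
  have -> // : D `&` [set t | (block_mx 1%:M 0 0 B : 'M[C]_(r + s)) *m z t = 0] = D1 `&` [set t | B *m z1 t = 0].
  apply/seteqP; split => t.
    move=> [Dt /=]; rewrite -[X in _ *m X](vsubmxK (z t)) mul_block_col !mul0mx addr0 add0r mul1mx => h.
    by split; [split=> //|]; [move: h => /(congr1 usubmx)|move: h => /(congr1 dsubmx)]; rewrite ?col_mxKu ?col_mxKd linear0.
  move=> [[Dt /= h1] /= h2]; split=> //=.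
  rewrite -(vsubmxK (z t)) mul_block_col !mul0mx addr0 add0r mul1mx h1.
  by rewrite -/(z1 t) h2 col_mx0.
move=> H; rewrite -(ler_pM2r rs0) mulrAC.
apply: (@le_trans _ _ (mu D * (s - \rank B)%:R * s%:R)); first by rewrite ler_wpM2r.
by rewrite [leRHS]mulrAC D1E mulrAC.
Qed.

(** The subspace where the upper block vanishes carries exactly its share. Then
    the lines in it, and the upper blocks of the other lines, satisfy the
    inequalities with the same ratio of mass to dimension; their degenerations,
    put into blocks, average to the same scalar. *)
Lemma degenerates_split :
  (forall D' (z' : T -> 'cV[C]_r), random_line D' z' -> spread D' z' -> degenerates D' z') ->
  (forall D' (z' : T -> 'cV[C]_s), random_line D' z' -> spread D' z' -> degenerates D' z') ->
  degenerates D z.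
Proof.
move=> IHr IHs.
have [g2 [al2 [ug2 rg2 av2]]] := IHr _ _ rl2 semi2.
have [g1 [al1 [ug1 rg1 av1]]] := IHs _ _ rl1 semi1.
have [al [alu ald]] := initial_form_block R al2 al1.
pose g := block_mx g2 0 0 g1.
have ug : g \in unitmx.
  by rewrite unitmxE /g det_ublock unitrM -!unitmxE ug2.
have gz t : g *m z t = col_mx (g2 *m z2 t) (g1 *m z1 t).
  by rewrite -[in LHS](vsubmxK (z t)) mul_block_col !mul0mx addr0 add0r.
have on2 t : D2 t -> initial_form al (g *m z t) = col_mx (initial_form al2 (g2 *m z2 t)) 0.
  by move=> /z2_neq0 z20; rewrite gz alu// unit_nz.
have on1 t : D1 t -> initial_form al (g *m z t) = col_mx 0 (initial_form al1 (g1 *m z1 t)).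
  by move=> [Dt /= h]; rewrite gz {1}/z2 h mulmx0 ald.
have DE : D = D2 `|` D1.
  apply/seteqP; split => [t Dt|t [[]|[]]//].
  by have [h|h] := pselect (D1 t); [right|left].
have r2 : random_line D2 (fun t => initial_form al (g *m z t)).
  by apply: eq_random_line (random_line_col_mx0 s rg2) => t /on2.
have r1 : random_line D1 (fun t => initial_form al (g *m z t)).
  by apply: eq_random_line (random_line_col_0mx r rg1) => t /on1.
have D21 : [disjoint D2 & D1].
  by rewrite disj_set2E; apply/eqP/seteqP; split => // t [[_ h] /h].
exists g, al; split; [exact: ug|rewrite DE; exact: random_line_setU|].
rewrite {1}DE (avg_setU r2 r1 D21).
rewrite (eq_avg on2) (eq_avg on1) avg_col_mx0 avg_col_0mx av2 av1 D1m D2m.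
by rewrite add_block_mx !addr0 add0r -scalar_mx_block.
Qed.
End Split.

(** By induction on the dimension. Either the line is strictly spread and can be
    balanced without degeneration, or some subspace carries exactly its share and
    splits the problem into two smaller ones. *)
Theorem spread_degenerates k (D : set T) (z : T -> 'cV[C]_k) :
  random_line D z -> spread D z -> degenerates D z.
Proof.
have [N kN] := ubnP k; elim: N k kN D z => // N IH k kN D z zl zs.
case: k => [|n] in kN z zl zs *.
  exists 1%:M, (fun=> 0%N); split; first by rewrite unitmx1.
    by apply: eq_random_line zl => t _; rewrite initial_form_cst mul1mx.
  by apply/matrixP => -[].
have [st|nst] := pselect (strictly_spread P D z).
  have [g dg av] := strictly_spread_balanced zl st; exists g, (fun=> 0%N); split.
  - exact: det1_unit.
  - apply: (@eq_random_line _ _ (fun t => g *m z t)) => [t _|]; first by rewrite initial_form_cst.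
    exact: (random_line_unit zl (det1_unit dg)).
  - by rewrite -av; apply: eq_avg => t _; rewrite initial_form_cst.
have [B [Bn BE]] : exists B : 'M[C]_n.+1, (0 < \rank B < n.+1)%N /\
   mu (D `&` [set t | B *m z t = 0]) * n.+1%:R = mu D * (n.+1 - \rank B)%:R.
  apply: contra_notP nst => h B Bn; rewrite lt_neqAle zs andbT.
  by apply/eqP => BE; apply: h; exists B.
(* Row reduction makes the subspace a coordinate subspace. *)
pose h := row_ebase B; have uh : h \in unitmx by exact: row_ebase_unit.
apply: (degenerates_unit uh).
have KE t : (B *m z t = 0) <-> (pid_mx (\rank B) : 'M[C]_n.+1) *m (h *m z t) = 0.
  rewrite -{1}(mulmx_ebase B) -!mulmxA; split => [|->]; last by rewrite mulmx0.
  by move=> /(congr1 (mulmx (invmx (col_ebase B)))); rewrite mulmx0 mulKmx// col_ebase_unit.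
have hl := random_line_unit zl uh; have hs := spread_unit uh zs.
have {}BE : mu (D `&` [set t | (pid_mx (\rank B) : 'M[C]_n.+1) *m (h *m z t) = 0]) * n.+1%:R
    = mu D * (n.+1 - \rank B)%:R.
  rewrite -BE; congr (mu (_ `&` _) * _).
  by apply/seteqP; split => t /= /KE.
move: (\rank B) Bn BE => r /andP[r0 rn].
have [s sE] : exists s, n.+1 = (r + s)%N by exists (n.+1 - r)%N; rewrite subnKC// ltnW.
have s0 : (0 < s)%N by rewrite -(ltn_add2l r) addn0 -sE.
have rN : (r < N)%N by exact: leq_trans rn _.
have sN : (s < N)%N by apply: leq_trans (_ : (s < n.+1)%N) _; rewrite // sE -{1}(add0n s) ltn_add2r.
suff : forall w : T -> 'cV[C]_n.+1, random_line D w -> spread D w ->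
    mu (D `&` [set t | (pid_mx r : 'M[C]_n.+1) *m w t = 0]) * n.+1%:R
      = mu D * (n.+1 - r)%:R -> degenerates D w.
  by apply.
clear -IH sE r0 s0 rN sN; move: (n.+1) sE => k kE; subst k => w wl ws.
rewrite addKn => BE.
apply: (degenerates_split r0 s0 wl ws); last 2 first.
- by move=> D' z'; apply: IH.
- by move=> D' z'; apply: IH.
rewrite -BE; congr (mu (_ `&` _) * _).
apply/seteqP; split => t /=; rewrite pid_mx_block -[in X in _ *m X](vsubmxK (w t)) mul_block_col !mul0mx mul1mx !addr0.
  by move=> ->; rewrite col_mx0.
by move=> /(congr1 usubmx); rewrite col_mxKu linear0.
Qed.
End Semi.

(** * Topology of projective space *)

Section Proj.
Local Open Scope quotient_scope.
Variables (R : realType) (n : nat).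
Local Notation C := R[i].
Local Notation PS := (projspace R n).
Local Notation V := 'cV[C]_n.+1.
Local Notation pi := (\pi_PS).

Lemma nzvec_neq0 (z : nzvec R n) : \val z != 0.
Proof. exact: set_mem (valP z). Qed.

Lemma rep_neq0 (p : PS) : rep p != 0.
Proof. exact: nzvec_neq0. Qed.

Lemma val_nz_continuous : continuous (fun z : nzvec R n => \val z : V).
Proof. by apply/continuousP => B oB; exists B. Qed.

Lemma nz_cvg T (F : set_system T) (FF : Filter F) (f : T -> nzvec R n) (x : nzvec R n) :
  (fun t => \val (f t) : V) @ F --> (\val x : V) -> f @ F --> x.
Proof.
move=> h A /=; rewrite nbhsE /= => -[_ [[B oB <-] Bx]] BA.
have : nbhs (\val x : V) B by apply: open_nbhs_nbhs.
move=> /h hB; apply: (@filterS _ F FF _ _ _ hB) => t Bt; exact: BA.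
Qed.

Lemma pi_cvg T (F : set_system T) (FF : Filter F) (f : T -> nzvec R n) (x : nzvec R n) :
  (fun t => \val (f t) : V) @ F --> (\val x : V) ->
  (fun t => pi (f t)) @ F --> pi x.
Proof.
move=> /nz_cvg h; apply: (cvg_comp _ _ h).
exact: (@pi_continuous _ {eq_quot (@same_line_equiv R n)}).
Qed.

Lemma continuous_lift (f : PS -> R) (h : V -> R) :
  (forall z : nzvec R n, f (pi z) = h (\val z)) ->
  (forall w, w != 0 -> {for w, continuous h}) -> continuous f.
Proof.
move=> fh ch; apply/quotient_continuous => z.
rewrite (_ : f \o _ = h \o (fun z : nzvec R n => \val z)); last by apply/funext => x /=; rewrite fh.
by apply: continuous_comp; [exact: val_nz_continuous|apply: ch; exact: nzvec_neq0].
Qed.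

Lemma line_proj_rep_pi (z : nzvec R n) : line_proj (rep (pi z)) = line_proj (\val z).
Proof. by have [c c0 ->] := rep_pi z; rewrite line_projZ. Qed.

Lemma nsq_continuous k (w : 'cV[C]_k) : {for w, continuous (@nsq R k)}.
Proof.
have h i : ccvg (nbhs w) (fun x : 'cV[C]_k => x i 0) (w i 0) by exact: ccont_entry.
have nE (x : 'cV[C]_k) : nsq x = rRe (\sum_i (x i 0)^*%R * x i 0).
  by rewrite Re_sum; apply: eq_bigr => i _; rewrite mul_conj_sqn.
rewrite (funext nE).
suff [] : ccvg (nbhs w) (fun x => \sum_i (x i 0)^*%R * x i 0)
  (\sum_i (w i 0)^*%R * w i 0) by [].
by apply: ccvg_sum => i _; apply: ccvgM => //; exact: ccvgJ.
Qed.

Lemma line_proj_ccvg k (w : 'cV[C]_k) i j : w != 0 ->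
  ccvg (nbhs w) (fun x => line_proj x i j) (line_proj w i j).
Proof.
move=> w0; rewrite line_proj_coef; under [fun x => _]eq_fun do rewrite line_proj_coef.
apply: ccvgM; last by apply: ccvgM; [exact: ccont_entry|apply: ccvgJ; exact: ccont_entry].
split=> /=; last exact: cvg_cst.
by apply: cvgV; [rewrite nsq_eq0|exact: nsq_continuous].
Qed.

Lemma Re_line_proj_continuous i j : continuous (fun p : PS => rRe (line_proj (rep p) i j)).
Proof.
apply: (@continuous_lift _ (fun w => rRe (line_proj w i j))) => [z|w w0].
  by rewrite line_proj_rep_pi.
by have [] := line_proj_ccvg i j w0.
Qed.

Lemma Im_line_proj_continuous i j : continuous (fun p : PS => rIm (line_proj (rep p) i j)).
Proof.
apply: (@continuous_lift _ (fun w => rIm (line_proj w i j))) => [z|w w0].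
  by rewrite line_proj_rep_pi.
by have [] := line_proj_ccvg i j w0.
Qed.

Lemma open_measurable_PS (A : set PS) : open A -> measurable A.
Proof. by move=> oA; apply: sub_sigma_algebra. Qed.

Lemma continuous_measurable (f : PS -> R) : continuous f -> measurable_fun setT f.
Proof.
move=> /continuousP cf.
apply: (measurability _ (RGenOInfty.measurableE R)) => //.
move=> _ [_ [x ->] <-]; rewrite setTI; apply: open_measurable_PS.
by apply: cf; exact: rray_open.
Qed.

Lemma random_line_rep : random_line [set: PS] (@rep R n).
Proof.
split=> [//|p _|i j|i j]; first exact: rep_neq0.
- by apply: continuous_measurable; exact: Re_line_proj_continuous.
- by apply: continuous_measurable; exact: Im_line_proj_continuous.
Qed.

(** The unit sphere is compact and maps onto projective space. *)
Lemma compact_PS : compact [set: PS].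
Proof.
pose S : set V := [set w | nsq w = 1].
have cS : compact S.
  apply: subclosed_compact (@compact_box R n.+1 1 1) _.
    rewrite (_ : S = (@nsq R n.+1) @^-1` [set 1])//.
    by apply: closed_comp => [w _|]; [exact: nsq_continuous|exact: closed_eq].
  move=> w /= w1 i j; rewrite !ord1.
  by split; apply: sqr_le1_norm; rewrite -w1; apply: le_trans (sqn_le_nsq w i);
    rewrite ?Re_sqr_sqn ?Im_sqr_sqn.
pose z0 : nzvec R n := exist (fun z => z \in nzvec R n) _ (const1_nz R n).
pose s (w : V) : nzvec R n := insubd z0 w.
have sE w : w != 0 -> \val (s w) = w.
  by move=> w0; rewrite /s insubdK//; apply/mem_set.
have S0 w : S w -> w != 0.
  by move=> w1; rewrite -nsq_eq0 w1 oner_eq0.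
have -> : [set: PS] = (fun w => pi (s w)) @` S.
  apply/seteqP; split => // p _.
  pose r := Num.sqrt (nsq (rep p)).
  have r0 : 0 < r by rewrite sqrtr_gt0 nsq_gt0 rep_neq0.
  pose w := (r^-1)%:C *: rep p.
  have c0 : (r^-1)%:C != 0 :> C by rewrite fmorph_eq0 invr_eq0 gt_eqF.
  have w0 : w != 0 by rewrite scaler_eq0 negb_or c0 rep_neq0.
  exists w.
    rewrite /S /= nsqZ /sqn /= expr0n addr0 exprVn sqr_sqrtr ?nsq_ge0//.
    by rewrite mulVf// nsq_eq0 rep_neq0.
  rewrite -[RHS]reprK; apply/(@eqmodP _ (@same_line_equiv R n))/asboolP.
  exists (r%:C); first by rewrite fmorph_eq0 gt_eqF.
  by rewrite sE// /w scalerA -rmorphM divff ?gt_eqF// scale1r.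
apply: continuous_compact => //; apply/subspace_continuousP => w Sw.
apply: pi_cvg; rewrite sE ?S0//.
apply: (@cvg_trans _ (id @ within S (nbhs w))); last exact: cvg_within.
apply: near_eq_cvg; near=> x; rewrite sE//; apply: S0; near: x.
exact: withinT.
Unshelve. all: by end_near.
Qed.

Lemma continuous_bounded (f : PS -> R) : continuous f -> exists M, forall p, `|f p| <= M.
Proof.
move=> cf; have : compact (f @` setT).
  by apply: continuous_compact compact_PS; exact: continuous_subspaceT.
move=> /compact_bounded [M [_ hM]]; exists (M + 1) => p.
by apply: (hM (M + 1)); [rewrite ltrDl|exists p].
Qed.

Lemma nth_tuple_row m (M : 'M[C]_(m, n.+1)) (i : 'I_m) :
  [tuple (row j M)^T | j < m]`_i = (row i M)^T.
Proof. by rewrite -tnth_nth tnth_mktuple. Qed.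

Lemma span_rows m (M : 'M[C]_(m, n.+1)) (v : V) :
  (v \in <<[tuple (row i M)^T | i < m]>>%VS) = (v^T <= M)%MS.
Proof.
set X := [tuple _ | _ < _].
have XE (i : 'I_m) : X`_i = (row i M)^T by exact: nth_tuple_row.
apply/idP/submxP => [/coord_span ->|[u vu]].
  exists (\row_i coord X i v); rewrite mulmx_sum_row raddf_sum/=.
  by apply: eq_bigr => i _; rewrite mxE XE linearZ/= trmxK.
have -> : v = \sum_i u 0 i *: (row i M)^T.
  by rewrite -[v]trmxK vu mulmx_sum_row raddf_sum/=; apply: eq_bigr => i _; rewrite linearZ.
by apply: rpred_sum => i _; apply: rpredZ; apply: memv_span; apply/mapP; exists i; rewrite ?mem_enum.
Qed.

Lemma free_rows m (M : 'M[C]_(m, n.+1)) : row_free M -> free [tuple (row i M)^T | i < m].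
Proof.
move=> fM; apply/freeP => c h i.
have : (\row_i c i) *m M = 0.
  rewrite mulmx_sum_row -[RHS](trmx0) -h raddf_sum/=; apply: eq_bigr => j _.
  by rewrite mxE linearZ/= nth_tuple_row trmxK.
move=> cM; have /rowP/(_ i) : \row_i c i = 0.
  by apply: (row_free_inj fM); rewrite cM mul0mx.
by rewrite !mxE.
Qed.

Lemma vspace_rows (E : {vspace V}) : exists M : 'M[C]_(\dim E, n.+1),
  row_free M /\ forall v, (v \in E) = (v^T <= M)%MS.
Proof.
pose X := vbasis E; pose M : 'M[C]_(\dim E, n.+1) := \matrix_i (X`_i)^T.
have XM : X = [tuple (row i M)^T | i < \dim E].
  by apply: eq_from_tnth => i; rewrite tnth_mktuple rowK trmxK (tnth_nth 0).
exists M; split; last by move=> v; rewrite -span_rows -XM (span_basis (vbasisP E)).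
apply: inj_row_free => u uM; apply/rowP => i; rewrite mxE.
have /freeP := basis_free (vbasisP E); apply.
rewrite -[RHS]trmx0 -uM mulmx_sum_row raddf_sum/=; apply: eq_bigr => j _.
by rewrite linearZ/= rowK trmxK.
Qed.

Lemma ker_vspace (B : 'M[C]_n.+1) : exists E : {vspace V},
  \dim E = (n.+1 - \rank B)%N /\ forall v, (v \in E) <-> B *m v = 0.
Proof.
pose M := row_base (kermx B^T).
exists <<[tuple (row i M)^T | i < \rank (kermx B^T)]>>%VS; split.
  rewrite -(mxrank_tr B) -mxrank_ker.
  by have /eqP := free_rows (row_base_free (kermx B^T)); rewrite size_tuple.
move=> v; rewrite span_rows eq_row_base; split => [/sub_kermxP h|h].
  by apply: trmx_inj; rewrite trmx_mul h trmx0.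
by apply/sub_kermxP; rewrite -trmx_mul h trmx0.
Qed.

Lemma vspace_ker (E : {vspace V}) : exists B : 'M[C]_n.+1,
  \rank B = (n.+1 - \dim E)%N /\ forall v, (v \in E) <-> B *m v = 0.
Proof.
have [M [fM hM]] := vspace_rows E.
exists (cokermx M)^T; split.
  by rewrite mxrank_tr mxrank_coker (eqP fM).
move=> v; rewrite hM submxE; split => [/eqP h|h].
  by apply: trmx_inj; rewrite trmx_mul trmxK h trmx0.
by rewrite -[cokermx M]trmxK -trmx_mul h trmx0.
Qed.

End Proj.

(** * First-order expansions and the exponential *)

Section Jets.
Variable R : realType.
Local Notation C := R[i].

(** First-order expansion at 0, uniform on [0, 1]. The polynomial is read modulo
    'X^2, so that expansions multiply like polynomials. *)
Definition jet (f : R -> C) (p : {poly C}) : Prop :=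
  exists2 K : C, 0 <= K & forall t : R, 0 <= t <= 1 ->
    `|f t - (p`_0 + t%:C * p`_1)| <= K * t%:C ^+ 2.

Lemma jet_cst (a : C) : jet (fun=> a) a%:P.
Proof.
exists 0 => // t _; rewrite !coefC /= mulr0 addr0 subrr normr0 mul0r//.
Qed.

Lemma jetD f g p r : jet f p -> jet g r -> jet (fun t => f t + g t) (p + r).
Proof.
move=> [K K0 hK] [L L0 hL]; exists (K + L) => [|t t01]; first exact: addr_ge0.
rewrite !coefD mulrDl (le_trans _ (lerD (hK t t01) (hL t t01)))//.
apply: le_trans (ler_normD _ _); rewrite le_eqVlt; apply/orP; left; apply/eqP; congr `|_|.
by ring.
Qed.

Lemma jetM f g p r : jet f p -> jet g r -> jet (fun t => f t * g t) (p * r).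
Proof.
move=> [K K0 hK] [L L0 hL].
exists (K * (`|r`_0| + `|r`_1|) + L * (`|p`_0| + `|p`_1|) + K * L + `|p`_1| * `|r`_1|).
  by rewrite !addr_ge0 ?mulr_ge0 ?addr_ge0.
move=> t t01; have /andP[t0 t1] := t01.
have T0 : 0 <= t%:C :> C by rewrite ler0c.
have T1 : t%:C <= 1 :> C by rewrite -[1]/(1%:C) lecR.
set x := t%:C in T0 T1 *.
have -> : (p * r)`_0 = p`_0 * r`_0 by rewrite coefM big_ord1.
have -> : (p * r)`_1 = p`_0 * r`_1 + p`_1 * r`_0 by rewrite coefM big_ord_recl big_ord1.
have hf := hK t t01; have hg := hL t t01; rewrite -/x in hf hg.
set u := f t - _ in hf; set v := g t - _ in hg.
have -> : f t * g t - (p`_0 * r`_0 + x * (p`_0 * r`_1 + p`_1 * r`_0)) =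
  u * (r`_0 + x * r`_1) + v * (p`_0 + x * p`_1) + u * v + p`_1 * r`_1 * x ^+ 2.
  by rewrite /u /v; ring.
have lin (q : {poly C}) : `|q`_0 + x * q`_1| <= `|q`_0| + `|q`_1|.
  by rewrite (le_trans (ler_normD _ _))// lerD2l normrM ger0_norm// ler_piMl.
have x2 : x ^+ 2 <= 1 by rewrite exprn_ile1.
have x20 : 0 <= x ^+ 2 by rewrite exprn_ge0.
rewrite !(mulrDl _ _ (x ^+ 2)).
apply: le_trans (ler_normD _ _) _; apply: lerD; last first.
  by rewrite normrM (ger0_norm x20) normrM.
apply: le_trans (ler_normD _ _) _; apply: lerD; last first.
  rewrite normrM; apply: (@le_trans _ _ ((K * x ^+ 2) * (L * x ^+ 2))); first exact: ler_pM.
  rewrite mulrACA ler_wpM2l ?mulr_ge0//; exact: ler_piMl.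
apply: le_trans (ler_normD _ _) _; apply: lerD; rewrite normrM mulrAC; apply: ler_pM => //; exact: lin.
Qed.

Lemma jet_sum I (s : seq I) (P : pred I) f (p : I -> {poly C}) :
  (forall i, jet (f i) (p i)) ->
  jet (fun t => \sum_(i <- s | P i) f i t) (\sum_(i <- s | P i) p i).
Proof.
move=> h; elim: s => [|i s IH].
  rewrite big_nil; under [fun t => _]eq_fun do rewrite big_nil; exact: jet_cst.
rewrite big_cons; under [fun t => _]eq_fun do rewrite big_cons.
by case: ifP => // _; apply: jetD.
Qed.

Lemma jet_prod I (s : seq I) (P : pred I) f (p : I -> {poly C}) :
  (forall i, jet (f i) (p i)) ->
  jet (fun t => \prod_(i <- s | P i) f i t) (\prod_(i <- s | P i) p i).
Proof.
move=> h; elim: s => [|i s IH].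
  rewrite big_nil; under [fun t => _]eq_fun do rewrite big_nil.
  exact: (jet_cst 1).
rewrite big_cons; under [fun t => _]eq_fun do rewrite big_cons.
by case: ifP => // _; apply: jetM.
Qed.

Lemma jetJ f p : jet f p -> jet (fun t => (f t)^*%R) (map_poly Num.conj p).
Proof.
move=> [K K0 hK]; exists K => // t t01; apply: le_trans (hK t t01).
rewrite !coef_map/=.
have Tc : (t%:C)^*%R = t%:C :> C by apply: conj_Creal; apply/complex_realP; exists t.
have -> : (f t)^*%R - ((p`_0)^*%R + t%:C * (p`_1)^*%R) = (f t - (p`_0 + t%:C * p`_1))^*%R.
  by rewrite rmorphB rmorphD rmorphM; congr (_ - (_ + _ * _)); exact: esym.
by rewrite norm_conjC.
Qed.

Lemma jet_uniq f p r : jet f p -> jet f r -> p`_0 = r`_0 /\ p`_1 = r`_1.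
Proof.
move=> [K K0 hK] [L L0 hL].
have h t : 0 <= t <= 1 -> `|p`_0 - r`_0 + t%:C * (p`_1 - r`_1)| <= (K + L) * t%:C ^+ 2.
  move=> t01; rewrite mulrDl (le_trans _ (lerD (hK t t01) (hL t t01)))//.
  rewrite -(normrN (f t - (p`_0 + _))); apply: le_trans (ler_normD _ _).
  rewrite le_eqVlt; apply/orP; left; apply/eqP; congr `|_|; by ring.
have e0 : p`_0 = r`_0.
  have := h 0; rewrite lexx ler01 => /(_ isT); rewrite mul0r addr0 expr0n mulr0.
  by rewrite normr_le0 subr_eq0 => /eqP.
split=> //; apply/eqP; rewrite -subr_eq0 -normr_le0.
have KL0 : 0 <= K + L by exact: addr_ge0.
have /complex_realP[M KLM] : K + L \is Num.real by exact: ger0_real.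
have M0 : 0 <= M by rewrite -lecR -KLM.
have /complex_realP[y yE] : `|p`_1 - r`_1| \is Num.real by exact: normr_real.
rewrite yE -[0]/(0%:C) lecR; apply/ler_addgt0Pl => e e0'; rewrite addr0.
(* Small enough for the quadratic error, divided by t, to be below e. *)
pose t := Num.min 1 (e / (M + 1)).
have M1 : 0 < M + 1 by lra.
have t0 : 0 < t by rewrite lt_min ltr01 divr_gt0.
have t1 : t <= 1 by rewrite ge_min lexx.
have := h t; rewrite (ltW t0) t1 => /(_ isT).
have T0 : 0 < t%:C :> C by rewrite ltcR.
rewrite e0 subrr add0r normrM (ger0_norm (ltW T0)).
have -> : (K + L) * t%:C ^+ 2 = t%:C * ((K + L) * t%:C) by ring.
rewrite ler_pM2l//.
rewrite yE KLM -rmorphM lecR => /le_trans; apply.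
apply: (@le_trans _ _ ((M + 1) * t)); first by rewrite ler_pM2r// lerDl.
by rewrite mulrC -ler_pdivlMr// ge_min lexx orbT.
Qed.

Definition mjet m n (F : R -> 'M[C]_(m, n)) (A : 'M[{poly C}]_(m, n)) : Prop :=
  forall i j, jet (fun t => F t i j) (A i j).

Lemma mjetM m n p (F : R -> 'M[C]_(m, n)) (G : R -> 'M[C]_(n, p)) A B :
  mjet F A -> mjet G B -> mjet (fun t => F t *m G t) (A *m B).
Proof.
move=> hF hG i j; rewrite mxE; under [fun t => _]eq_fun do rewrite mxE.
by apply: jet_sum => l; apply: jetM.
Qed.

Lemma mjet_cst m n (M : 'M[C]_(m, n)) : mjet (fun=> M) (map_mx polyC M).
Proof. by move=> i j; rewrite mxE; exact: jet_cst. Qed.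

Lemma mjet_trC m n (F : R -> 'M[C]_(m, n)) A :
  mjet F A -> mjet (fun t => (F t)^t*) (map_mx (map_poly Num.conj) A^T).
Proof.
move=> hF i j; rewrite !mxE; under [fun t => _]eq_fun do rewrite !mxE; exact: jetJ.
Qed.

Lemma jet_det n (F : R -> 'M[C]_n) A : mjet F A -> jet (fun t => \det (F t)) (\det A).
Proof.
move=> hF; apply: jet_sum => s; apply: jetM; last by apply: jet_prod.
rewrite (_ : (-1) ^+ s = ((-1) ^+ s)%:P); first exact: jet_cst.
by rewrite rmorphXn/= rmorphN1.
Qed.

Definition poly1 n (B : 'M[C]_n) : 'M[{poly C}]_n := 1%:M + 'X *: map_mx polyC B.

Lemma poly1_coef n (B : 'M[C]_n) i j :
  (poly1 B i j)`_0 = (i == j)%:R /\ (poly1 B i j)`_1 = B i j.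
Proof.
have -> : poly1 B i j = ((i == j)%:R)%:P + 'X * (B i j)%:P.
  by rewrite !mxE polyCMn.
by rewrite 2!coefD 2!coefXM 3!coefC /= addr0 add0r.
Qed.

Lemma prod_poly1_coef n (B : 'M[C]_n) (r : seq 'I_n) :
  (\prod_(i <- r) poly1 B i i)`_0 = 1 /\
  (\prod_(i <- r) poly1 B i i)`_1 = \sum_(i <- r) B i i.
Proof.
elim: r => [|i r [IH0 IH1]]; first by rewrite !big_nil !coef1.
rewrite !big_cons !coefM big_ord1 big_ord_recl big_ord1 /=.
have [-> ->] := poly1_coef B i i.
by rewrite eqxx !IH0 !IH1 !mul1r mulr1 addrC.
Qed.

(** A permutation that moves an index moves at least two, so its term in the
    determinant is divisible by 'X^2. *)
Lemma det_poly1_coef1 n (B : 'M[C]_n) : (\det (poly1 B))`_1 = \tr B.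
Proof.
rewrite /determinant coef_sum (bigD1 1%g)//= [X in _ + X]big1 => [|s s1].
  rewrite odd_perm1 expr0 mul1r addr0; under eq_bigr do rewrite perm1.
  by have [_ ->] := prod_poly1_coef B (index_enum _).
have [i si] : exists i, s i != i.
  apply/existsP; apply: contraNT s1; rewrite negb_exists => /forallP h.
  by apply/eqP/perm.permP => i; rewrite perm1; apply/eqP; have := h i; rewrite negbK.
have ssi : s (s i) != s i by rewrite (inj_eq perm_inj).
have off a b : a != b -> poly1 B a b = 'X * (B a b)%:P.
  by move=> ab; rewrite !mxE (negPf ab) add0r.
rewrite (bigD1 i)//= (bigD1 (s i))//= !off 1?eq_sym//.
set Q := \prod_(_ | _) _; set S := (-1) ^+ _.
have -> : S * ('X * (B i (s i))%:P * ('X * (B (s i) (s (s i)))%:P * Q)) =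
   'X * ('X * (S * (B i (s i))%:P * (B (s i) (s (s i)))%:P * Q)) by ring.
by rewrite coefXM /= coefXM.
Qed.

(** The series is dominated by the exponential series of c, and all terms of
    index at least 2 have a factor t^2. *)
Lemma real_exp_series (x : nat -> R) (c t : R) : (forall k, `|x k| <= c ^+ k) ->
  0 <= t <= 1 -> exists2 l : R,
    series (fun k => t ^+ k / k`!%:R * x k) @ \oo --> l &
    `|l - (x 0%N + t * x 1%N)| <= expR c * t ^+ 2.
Proof.
move=> xc /andP[t0 t1]; pose u k := t ^+ k / k`!%:R * x k.
have c0 : 0 <= c by have := xc 1%N; rewrite expr1; apply: le_trans.
have uc k : `|u k| <= t ^+ k * exp_coeff c k.
  rewrite /u /exp_coeff /= normrM ger0_norm ?divr_ge0 ?exprn_ge0// -mulrA ler_wpM2l ?exprn_ge0//.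
  by rewrite mulrC ler_wpM2r ?invr_ge0.
have ec0 k : 0 <= exp_coeff c k by exact: exp_coeff_ge0.
have cvgu : cvgn (series u).
  apply: normed_cvg; apply: series_le_cvg (is_cvg_series_exp_coeff c) => //= k.
  by apply: le_trans (uc k) _; rewrite ler_piMl// exprn_ile1.
exists (limn (series u)) => //.
have : (fun k => `|series u k - (x 0%N + t * x 1%N)|) @ \oo -->
    `|limn (series u) - (x 0%N + t * x 1%N)|.
  by apply: cvg_norm; apply: cvgB => //; exact: cvg_cst.
move=> /cvgr_to_le; apply; exists 2%N => //= k k2.
have -> : series u k - (x 0%N + t * x 1%N) = \sum_(2 <= j < k) u j.
  rewrite /series /= (big_ltn (leq_trans _ k2))// (big_ltn k2).
  by rewrite {1 2}/u expr0 expr1 !fact0 divr1 mul1r (_ : 1`! = 1%N)// divr1; ring.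
apply: le_trans (ler_norm_sum _ _ _) _.
apply: (@le_trans _ _ (\sum_(2 <= j < k) t ^+ 2 * exp_coeff c j)).
  rewrite big_nat [leRHS]big_nat; apply: ler_sum => j /andP[j2 _].
  apply: le_trans (uc j) _; rewrite ler_wpM2r//.
  by rewrite -(subnKC j2) exprD ler_piMr ?exprn_ge0// exprn_ile1.
rewrite -mulr_sumr mulrC ler_wpM2r ?exprn_ge0//.
apply: (@le_trans _ _ (series (exp_coeff c) k)).
  rewrite /series /= (@big_cat_nat _ _ _ 2 0 k)//= lerDr.
  by rewrite sumr_ge0.
apply: (nondecreasing_cvgn_le _ (is_cvg_series_exp_coeff c) k).
apply/nondecreasing_seqP => j; rewrite -subr_ge0 seriesSB//.
Qed.

Lemma entry_mnorm n (X : 'M[C]_n) i j : `|rRe (X i j)| <= mnorm X /\ `|rIm (X i j)| <= mnorm X.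
Proof.
have h : `|rRe (X i j)| + `|rIm (X i j)| <= mnorm X.
  rewrite /mnorm (bigD1 i)//= (bigD1 j)//= -addrA lerDl addr_ge0// sumr_ge0// => l _.
  by rewrite sumr_ge0.
by split; apply: le_trans h; rewrite ?lerDl ?lerDr.
Qed.

Lemma mx_pow_bound n (X : 'M[C]_n.+1) : exists c : R, forall k i j,
  `|rRe ((X ^+ k) i j)| <= c ^+ k /\ `|rIm ((X ^+ k) i j)| <= c ^+ k.
Proof.
(* Each entry of X * X^k is a sum of n + 1 products, with two real terms in
   each of the real and imaginary parts. *)
exists (\sum_(l < n.+1) (mnorm X + mnorm X)) => k.
elim: k => [|k IH] i j.
  by rewrite !expr0 mxE; case: eqVneq => _ /=; rewrite ?normr1 ?normr0; split.
have bd l (a b : R) : `|a| <= mnorm X -> `|b| <= mnorm X ->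
    `|a * rRe ((X ^+ k) l j)| + `|b * rIm ((X ^+ k) l j)| <=
    (mnorm X + mnorm X) * (\sum_(l < n.+1) (mnorm X + mnorm X)) ^+ k.
  move=> ha hb; have [h1 h2] := IH l j.
  by rewrite mulrDl !normrM; apply: lerD; apply: ler_pM.
rewrite exprS mxE Re_sum Im_sum exprS mulr_suml; split.
  apply: le_trans (ler_norm_sum _ _ _) _; apply: ler_sum => l _.
  have [h1 h2] := entry_mnorm X i l.
  by rewrite ReM; apply: le_trans (ler_normB _ _) _; apply: bd.
apply: le_trans (ler_norm_sum _ _ _) _; apply: ler_sum => l _.
have [h1 h2] := entry_mnorm X i l.
by rewrite ImM addrC; apply: le_trans (ler_normD _ _) _; apply: bd.
Qed.

Lemma limn_mx m n (u : nat -> 'M[C]_(m.+1, n.+1)) (L : 'M[C]_(m.+1, n.+1)) :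
  (forall i j, ccvg \oo (fun k => u k i j) (L i j)) -> limn u = L.
Proof.
move=> h; have : u @ \oo --> L by apply/mx_cvgP.
by apply: cvg_lim; exact: norm_hausdorff.
Qed.

Lemma expm_term n (X : 'M[C]_n.+1) (t : R) k i j :
  ((k`!%:R)^-1 *: (t%:C *: X) ^+ k) i j = (t ^+ k / k`!%:R)%:C * (X ^+ k) i j.
Proof.
rewrite exprZn !mxE mulrA; congr (_ * _).
by rewrite rmorphM rmorphXn fmorphV rmorph_nat mulrC.
Qed.

Lemma series_mxE n (u : nat -> 'M[C]_n.+1) i j k :
  series u k i j = series (fun l => u l i j) k.
Proof. by rewrite /series /= summxE. Qed.

Lemma expm_jet n (X : 'M[C]_n.+1) : mjet (fun t => expm (t%:C *: X)) (poly1 X).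
Proof.
have [c hc] := mx_pow_bound X.
have ReX i j k : `|rRe ((X ^+ k) i j)| <= c ^+ k by case: (hc k i j).
have ImX i j k : `|rIm ((X ^+ k) i j)| <= c ^+ k by case: (hc k i j).
move=> i0 j0; exists ((expR c + expR c)%:C) => [|t t01].
  by rewrite ler0c addr_ge0// expR_ge0.
pose lr i j := sval (cid2 (real_exp_series (ReX i j) t01)).
pose li i j := sval (cid2 (real_exp_series (ImX i j) t01)).
pose L : 'M[C]_n.+1 := \matrix_(i, j) (lr i j +i* li i j).
have -> : expm (t%:C *: X) = L.
  apply: limn_mx => i j; split.
    rewrite /L mxE /= /lr; case: cid2 => l /= hl _.
    apply: cvg_trans hl; apply: near_eq_cvg; near=> k.
    rewrite series_mxE /series /= Re_sum; apply: eq_bigr => a _.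
    by rewrite expm_term ReZl.
  rewrite /L mxE /= /li; case: cid2 => l /= hl _.
  apply: cvg_trans hl; apply: near_eq_cvg; near=> k.
  rewrite series_mxE /series /= Im_sum; apply: eq_bigr => a _.
  by rewrite expm_term ImZl.
have [-> ->] := poly1_coef X i0 j0.
set w := _ - _.
apply: le_trans (normc_le_ReIm w) _; rewrite -rmorphXn -rmorphM lecR mulrDl.
have X0 : (i0 == j0)%:R = (X ^+ 0) i0 j0 by rewrite expr0 mxE.
apply: lerD; rewrite /w ?ReB ?ImB mxE /= ?ReD ?ImD ?ReZl ?ImZl X0 -(expr1 X).
  by rewrite /lr; case: cid2.
by rewrite /li; case: cid2.
Unshelve. all: by end_near.
Qed.

End Jets.

(** * Strict inequalities imply stability *)

Section Infinitesimal.
Variable R : realType.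
Local Notation C := R[i].

Lemma poly1_conj n (h X : 'M[C]_n) : h \in unitmx ->
  map_mx polyC h *m poly1 X *m map_mx polyC (invmx h) = poly1 (h *m X *m invmx h).
Proof.
move=> uh; rewrite /poly1 mulmxDr mulmx1 mulmxDl -map_mxM mulmxV// map_mx1.
by rewrite -scalemxAr -scalemxAl -!map_mxM.
Qed.

(** Compare the coefficients of t: the determinant of exp(tX) has linear
    coefficient tr X, and W^* W has linear coefficient Y^* + Y. *)
Lemma unitary_expm_su n (h X : 'M[C]_n.+1) : h \in unitmx ->
  (forall t : R, \det (expm (t%:C *: X)) = 1) ->
  (forall t : R, let W := h *m expm (t%:C *: X) *m invmx h in W^t* *m W = 1%:M) ->
  su (h *m X *m invmx h).
Proof.
move=> uh dX UX; set Y := h *m X *m invmx h.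
have jX := expm_jet X; split; last first.
  rewrite /Y mxtrace_mulC mulmxA mulVmx// mul1mx -det_poly1_coef1.
  have jd := jet_det jX.
  have jc : jet (fun t => \det (expm (t%:C *: X))) 1%:P.
    by rewrite (_ : (fun t => _) = fun=> 1); [exact: jet_cst|apply/funext => t; rewrite dX].
  by have [_ ->] := jet_uniq jd jc; rewrite coefC.
have jW : mjet (fun t => h *m expm (t%:C *: X) *m invmx h) (poly1 Y).
  by rewrite -poly1_conj//; do !apply: mjetM => //; exact: mjet_cst.
have jWW := mjetM (mjet_trC jW) jW.
apply/matrixP => i j; rewrite [RHS]mxE; apply/eqP; rewrite -addr_eq0; apply/eqP.
have jc : jet (fun t => ((h *m expm (t%:C *: X) *m invmx h)^t* *m
     (h *m expm (t%:C *: X) *m invmx h)) i j) (((1%:M : 'M[C]_n.+1) i j)%:P).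
  rewrite (_ : (fun t => _) = fun=> (1%:M : 'M[C]_n.+1) i j); first exact: jet_cst.
  by apply/funext => t; rewrite UX.
have [_] := jet_uniq (jWW i j) jc.
rewrite coefC /= mxE coef_sum => <-.
have cf l : (map_mx (map_poly Num.conj) (poly1 Y)^T i l * poly1 Y l j)`_1 =
    (i == l)%:R * Y l j + (Y^t* ) i l * (l == j)%:R.
  have [p0 p1] := poly1_coef Y l j; have [r0 r1] := poly1_coef Y l i.
  rewrite coefM big_ord_recl big_ord1 /= p0 p1.
  have -> : map_mx (map_poly Num.conj) (poly1 Y)^T i l = map_poly Num.conj (poly1 Y l i).
    by rewrite !mxE.
  rewrite !coef_map/= r0 r1 rmorph_nat [l == i]eq_sym; congr (_ + _ * _).
  by rewrite [RHS]mxE [X in _ = Num.conj X]mxE.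
rewrite (eq_bigr _ (fun l _ => cf l)) big_split/= [RHS]addrC.
congr (_ + _).
  rewrite (bigD1 j)//= big1 => [|l lj]; last by rewrite (negPf lj) mulr0.
  by rewrite eqxx mulr1 addr0.
rewrite (bigD1 i)//= big1 => [|l li]; last by rewrite [i == l]eq_sym (negPf li) mul0r.
by rewrite eqxx mul1r addr0.
Qed.
End Infinitesimal.

Section Push.
Local Open Scope quotient_scope.
Variables (R : realType) (n : nat).
Local Notation C := R[i].
Local Notation PS := (projspace R n).
Local Notation V := 'cV[C]_n.+1.
Local Notation pi := (\pi_PS).
Implicit Types (nu : probability PS R) (g : SL R n).

Lemma SL_det g : \det (val g) = 1.
Proof. exact/eqP/(valP g). Qed.

Lemma SL_unit g : val g \in unitmx.
Proof. by apply: det1_unit; exact: SL_det. Qed.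

Lemma rep_act g p : exists2 c : C, c != 0 & rep (SL_act g p) = c *: (val g *m rep p).
Proof. exact: rep_pi. Qed.

Lemma Rint_distribution nu (phi : {mfun PS >-> PS}) (f : PS -> R) (M : R) :
  measurable_fun setT f -> (forall p, `|f p| <= M) ->
  \int[distribution nu phi]_p f p = \int[nu]_p f (phi p).
Proof.
move=> mf fM; rewrite /Rintegral; congr fine.
rewrite integral_distribution//; first exact/measurable_EFinP.
apply: (@bounded_integrable _ _ _ nu setT (f \o phi) M) => // [|p _].
  by apply: measurableT_comp.
exact: fM.
Qed.

Lemma avg_distribution nu (phi : {mfun PS >-> PS}) (w : PS -> V) :
  (forall p, line_proj (rep (phi p)) = line_proj (w p)) ->
  avg (distribution nu phi) setT (@rep R n) = avg nu setT w.
Proof.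
move=> h; have [_ _ mRe mIm] := random_line_rep R n.
apply/matrixP => i j; rewrite [LHS]mxE [RHS]mxE; apply: complex_ext; rewrite /=.
  rewrite (@Rint_distribution _ _ _ 1) => [|//|p]; last exact: Re_line_proj.
  by apply: eq_Rintegral => p _; rewrite h.
rewrite (@Rint_distribution _ _ _ 1) => [|//|p]; last exact: Im_line_proj.
by apply: eq_Rintegral => p _; rewrite h.
Qed.

Lemma avg_push nu g : avg (push g nu) setT (@rep R n) = avg nu setT (fun p => val g *m rep p).
Proof.
by apply: avg_distribution => p; have [c c0 ->] := rep_act g p; rewrite line_projZ.
Qed.

Lemma momentum_avgE nu : momentum_avg nu =
  - 'i%R *: (avg nu setT (@rep R n) - (n.+1%:R^-1)%:M).
Proof.
have [mT _ mRe mIm] := random_line_rep R n.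
have iE (w : C) : rRe (- 'i%R * w) = rIm w /\ rIm (- 'i%R * w) = - rRe w.
  by rewrite -complexiE; case: w => a b /=; split; ring.
apply/matrixP => i j; rewrite [LHS]mxE.
have e0 : rIm (((n.+1%:R^-1)%:M : 'M[C]_n.+1) i j) = 0.
  by rewrite mxE -(rmorph_nat (real_complex R)) -fmorphV; case: eqVneq.
set a := ((n.+1%:R^-1)%:M : 'M[C]_n.+1) i j in e0 *.
have lin (c : C) (A B : 'M[C]_n.+1) : (c *: (A - B)) i j = c * (A i j - B i j).
  by rewrite !mxE.
have mE p : momentum p i j = - 'i%R * (line_proj (rep p) i j - a).
  exact: lin.
have iRe : nu.-integrable setT (EFin \o (fun p => rRe (line_proj (rep p) i j))).
  exact: (random_line_integrable_Re nu (random_line_rep R n)).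
have iIm : nu.-integrable setT (EFin \o (fun p => rIm (line_proj (rep p) i j))).
  exact: (random_line_integrable_Im nu (random_line_rep R n)).
have icst (b : R) : nu.-integrable setT (EFin \o (fun=> b)).
  by apply: (@bounded_integrable _ _ _ _ _ _ `|b|).
have m1 : mass nu setT = 1 by rewrite /mass probability_setT.
have RHSE : (- 'i%R *: (avg nu setT (@rep R n) - (n.+1%:R^-1)%:M)) i j =
   - 'i%R * (avg nu setT (@rep R n) i j - a) by exact: lin.
rewrite RHSE; apply: complex_ext; rewrite /=.
  rewrite (iE _).1 ImB e0 subr0 mxE /=.
  by apply: eq_Rintegral => p _; rewrite mE (iE _).1 ImB e0 subr0.
rewrite (iE _).2 ReB mxE /=.
under eq_Rintegral do rewrite mE (iE _).2 ReB opprB.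
by rewrite RintegralB// Rint_cst// m1 mulr1 opprB.
Qed.

Lemma momentum_avg_eq0 nu :
  momentum_avg nu = 0 <-> avg nu setT (@rep R n) = (n.+1%:R^-1)%:M.
Proof.
rewrite momentum_avgE; split => [/eqP|->]; last by rewrite subrr scaler0.
by rewrite scaler_eq0 oppr_eq0 (negPf (neq0Ci _))/= subr_eq0 => /eqP.
Qed.

Lemma measurable_linsub (E : {vspace V}) : measurable (linsub E).
Proof.
have [B [_ EB]] := vspace_ker E.
rewrite (_ : linsub E = setT `&` [set p | B *m rep p = 0]).
  exact: (measurable_ker (random_line_rep R n)).
by rewrite setTI; apply/seteqP; split => p /EB.
Qed.

Lemma linsub_dimE (E : {vspace V}) : E != 0%VS -> (linsub_dim E + 1)%N = \dim E.
Proof. by move=> E0; rewrite /linsub_dim addn1 prednK// lt0n dimv_eq0. Qed.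

Lemma ker_linsub (B : 'M[C]_n.+1) : exists E : {vspace V},
  \dim E = (n.+1 - \rank B)%N /\ linsub E = setT `&` [set p | B *m rep p = 0].
Proof.
have [E [dE EB]] := ker_vspace B; exists E; split=> //.
by rewrite setTI; apply/seteqP; split => p /EB.
Qed.

Lemma linsub_strictly_spread nu :
  (forall E : {vspace V}, E != 0%VS -> E != fullv ->
       (nu (linsub E) < ((linsub_dim E + 1)%:R / n.+1%:R)%:E)%E) ->
  strictly_spread nu setT (@rep R n).
Proof.
move=> h B /andP[B0 BN]; have [E [dE <-]] := ker_linsub B.
have E0 : E != 0%VS by rewrite -dimv_eq0 dE subn_eq0 -ltnNge.
have Ef : E != fullv.
  apply: contraTneq B0 => Ef; move: dE; rewrite Ef dimvf /dim/= muln1 => dE.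
  by rewrite -leqNgt leqn0 -(subKn (ltnW BN)) -dE subnn.
have := h E E0 Ef; rewrite linsub_dimE// dE (mass_fin nu (measurable_linsub E)) lte_fin.
by rewrite ltr_pdivlMr// /mass probability_setT mul1r.
Qed.

Lemma linsub_spread nu :
  (forall E : {vspace V}, E != 0%VS -> E != fullv ->
       (nu (linsub E) <= ((linsub_dim E + 1)%:R / n.+1%:R)%:E)%E) ->
  spread nu setT (@rep R n).
Proof.
move=> h B; have [E [dE EB]] := ker_linsub B; rewrite -EB.
have m1 : mass nu setT = 1 by rewrite /mass probability_setT.
rewrite m1 mul1r.
have [E0|E0] := eqVneq E 0%VS.
  rewrite (_ : linsub E = set0) ?mass_set0 ?mul0r//.
  apply/seteqP; split => // p; rewrite /linsub /= E0 memv0 => /eqP p0.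
  by have := rep_neq0 p; rewrite p0 eqxx.
have [Ef|Ef] := eqVneq E fullv.
  move: dE; rewrite Ef dimvf /dim/= muln1 => <-.
  by rewrite ler_piMl// mass_le1//; rewrite -Ef; exact: measurable_linsub.
have := h E E0 Ef; rewrite linsub_dimE// dE (mass_fin nu (measurable_linsub E)) lee_fin.
by rewrite ler_pdivlMr.
Qed.

(** Both W and its inverse have determinant 1, so Psi is nonnegative at both in
    the balanced position. Invariance of nu under k makes the two values
    opposite, hence zero. *)
Lemma Psi_stabilizer nu (g : 'M[C]_n.+1) (k : SL R n) :
  strictly_spread nu setT (@rep R n) -> g \in unitmx ->
  avg nu setT (fun p => g *m rep p) = (mass nu setT / n.+1%:R)%:C%:M ->
  stabilizer nu k ->
  let W := g *m val k *m invmx g in W^t* *m W = 1%:M.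
Proof.
move=> st ug bal stk W.
have rl := random_line_unit (random_line_rep R n) ug.
have uk := SL_unit k.
have dk := SL_det k.
have dg : \det g * \det (invmx g) = 1 by rewrite -det_mulmx mulmxV// det1.
have dW : \det W = 1 by rewrite /W !det_mulmx dk mulr1 dg.
pose W' := g *m invmx (val k) *m invmx g.
have dW' : \det W' = 1 by rewrite /W' !det_mulmx det_inv dk invr1 mulr1 dg.
have qW p : stretch W (g *m rep p) = nsq (g *m (val k *m rep p)) / nsq (g *m rep p).
  by rewrite /stretch /W -!mulmxA mulKmx.
have qW' p : stretch W' (g *m rep p) = nsq (g *m (invmx (val k) *m rep p)) / nsq (g *m rep p).
  by rewrite /stretch /W' -!mulmxA mulKmx.
apply: (Psi_eq0_unitary rl bal (strictly_spread_unit ug st) dW).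
have P1 := Psi_ge0 rl bal dW; have P2 := Psi_ge0 rl bal dW'.
suff PP : Psi nu setT (fun p => g *m rep p) W' = - Psi nu setT (fun p => g *m rep p) W.
  by apply/eqP; rewrite eq_le P1 andbT; rewrite PP oppr_ge0 in P2.
have [L hL] := ln_stretch_bounded (det1_unit dW').
have inv (f : PS -> R) : measurable_fun setT f -> (forall p, `|f p| <= L) ->
    \int[nu]_p f p = \int[nu]_p f (SL_act k p).
  move=> mf fL; rewrite -(@Rint_distribution nu (SL_act k) f L)// /Rintegral; congr fine.
  by apply: eq_measure_integral => A mA _; exact: esym (stk A mA).
rewrite /Psi -mulN1r -RintegralZl//; last exact: (ln_stretch_integrable nu rl (det1_unit dW)).
rewrite (_ : Rintegral nu setT (fun p => ln (stretch W' (g *m rep p))) =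
  \int[nu]_p ln (stretch W' (g *m rep (SL_act k p)))); last first.
  apply: (inv (fun p => ln (stretch W' (g *m rep p)))); first exact: (measurable_ln_stretch rl).
  by move=> p; apply: hL; rewrite unit_nz// rep_neq0.
apply: eq_Rintegral => p _; rewrite qW' qW mulN1r.
have [c c0 ->] := rep_act k p.
rewrite -!scalemxAr mulKmx// !nsqZ -mulf_div divff ?sqn_eq0// mul1r.
by rewrite -lnV ?posrE ?divr_gt0 ?nsq_gt0 ?unit_nz ?rep_neq0// invf_div.
Qed.

Theorem strictly_spread_stable nu : strictly_spread nu setT (@rep R n) -> stable nu.
Proof.
move=> st; have [g dg bal] := strictly_spread_balanced (random_line_rep R n) st.
have ug := det1_unit dg.
pose gS : SL R n := exist (fun g : 'M[C]_n.+1 => \det g == 1) g (introT eqP dg).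
have m1 : mass nu setT = 1 by rewrite /mass probability_setT.
split.
  exists gS; apply/momentum_avg_eq0; rewrite avg_push bal m1 mul1r fmorphV.
  by rewrite rmorph_nat.
exists gS => _ [X lX <-]; rewrite /Ad /=; apply: unitary_expm_su => // t.
  by have [k _ <-] := lX t; exact: SL_det.
have [k sk <-] := lX t; exact: (Psi_stabilizer st ug bal sk).
Qed.
End Push.

(** * Mass of subspaces for semi-stable measures *)

Section Frame.
Variables (R : realType) (n : nat).
Local Notation C := R[i].
Local Notation PS := (projspace R n).
Local Notation V := 'cV[C]_n.+1.
Implicit Types (nu : probability PS R).

Lemma pid_fix_sub k d (W : 'M[C]_k) (x : 'rV[C]_k) :
  (x <= \sum_(l < k | (l < d)%N) <<row l W>>)%MS -> exists u, x = u *m (pid_mx d : 'M[C]_k) *m W.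
Proof.
move=> /submx_trans h.
have /h /submxP[u ->] : (\sum_(l < k | (l < d)%N) <<row l W>> <= (pid_mx d : 'M[C]_k) *m W)%MS.
  apply/sumsmx_subP => l ld; rewrite genmxE.
  have <- : row l ((pid_mx d : 'M[C]_k) *m W) = row l W.
    have rp : row l (pid_mx d : 'M[C]_k) = delta_mx 0 l.
      by apply/rowP => j; rewrite !mxE eqxx ld andbT eq_sym.
    by rewrite row_mul rp -rowE.
  exact: row_sub.
by exists u; rewrite mulmxA.
Qed.

(** A unitary frame adapted to g E: the first dim E rows come from the Gram-
    Schmidt process on a basis of g E, so that the other coordinates of W g v
    vanish for v in E. *)
Lemma adapted_frame (E : {vspace V}) (g : 'M[C]_n.+1) : exists W : 'M[C]_n.+1,
  W *m W^t* = 1%:M /\ forall v, v \in E ->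
    (pid_mx (\dim E) : 'M[C]_n.+1) *m (W *m (g *m v)) = W *m (g *m v).
Proof.
have [M [_ hM]] := vspace_rows E.
set d := \dim E in M hM *.
pose A := row_ebase (M *m g^T); pose U := schmidt A.
have UU : U *m U^t* = 1%:M by apply/unitarymxP; apply: schmidt_unitarymx.
have UJ : map_mx Num.conj U *m U^T = 1%:M.
  have := congr1 (map_mx Num.conj) UU; rewrite map_mxM map_mx1 /= => <-.
  by congr (_ *m _); apply/matrixP => i j; rewrite !mxE conjCK.
(* Subspaces of column vectors are handled as row spaces of transposes, hence
   the conjugate of the matrix produced by Gram-Schmidt. *)
exists (map_mx Num.conj U); split.
  rewrite -UJ; congr (_ *m _); apply/matrixP => i j; by rewrite !mxE conjCK.
move=> v; rewrite hM => /submxP[u vu].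
have [x gv] : exists x : 'rV[C]_n.+1, (g *m v)^T = x *m (pid_mx d : 'M[C]_n.+1) *m U.
  apply: pid_fix_sub.
  have -> : (g *m v)^T = u *m (M *m g^T) by rewrite trmx_mul vu mulmxA.
  rewrite -(mulmx_ebase (M *m g^T)) !mulmxA mulmx_sum_row.
  apply: summx_sub => i _; have [id|di] := ltnP i d.
    apply: scalemx_sub; apply: submx_trans (row_schmidt_sub A i) _.
    apply/sumsmx_subP => l li.
    by apply: (sumsmx_sup l) => //; exact: leq_ltn_trans li id.
  rewrite mxE big1 ?scale0r ?sub0mx// => l _.
  rewrite [pid_mx _ _ _]mxE (_ : (val l == val i) = false) ?mulr0//.
  by apply/negbTE; rewrite neq_ltn (leq_trans (ltn_ord l) di).
have -> : g *m v = U^T *m ((pid_mx d : 'M[C]_n.+1) *m x^T).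
  by rewrite -[g *m v]trmxK gv !trmx_mul tr_pid_mx mulmxA.
rewrite !(mulmxA (map_mx _ U)) UJ mul1mx mulmxA pid_mx_id//.
by rewrite (leq_trans (dimvS (subvf E)))// dimvf /dim/= muln1.
Qed.

(** For a line in E, |B g z| = |g z|, so the lines of E contribute their mass to
    the integral of |B g z|^2 / |g z|^2. *)
Lemma mass_frame nu (E : {vspace V}) (g W : 'M[C]_n.+1) d : g \in unitmx ->
  W *m W^t* = 1%:M ->
  (forall v, v \in E -> (pid_mx d : 'M[C]_n.+1) *m (W *m (g *m v)) = W *m (g *m v)) ->
  let B := pid_mx d *m W : 'M[C]_n.+1 in
  mass nu (linsub E) + \int[nu]_(p in ~` linsub E) stretch B (g *m rep p) =
  rRe (\tr (B^t* *m B *m avg nu setT (fun p => g *m rep p))).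
Proof.
move=> ug WW hE B; have rl := random_line_unit (random_line_rep R n) ug.
have mE := measurable_linsub E.
have iq : nu.-integrable setT (EFin \o (fun p => stretch B (g *m rep p))).
  rewrite (_ : _ \o _ = EFin \o (fun p => hq (B^t* *m B) (g *m rep p))).
    exact: (hq_integrable nu rl).
  by apply/funext => p /=; rewrite stretch_hq.
have -> : rRe (\tr (B^t* *m B *m avg nu setT (fun p => g *m rep p))) =
    \int[nu]_p stretch B (g *m rep p).
  by rewrite -(Rint_hq nu rl); apply: eq_Rintegral => p _; rewrite stretch_hq.
have <- : \int[nu]_(p in linsub E) stretch B (g *m rep p) = mass nu (linsub E).
  rewrite (@eq_Rintegral _ _ _ _ _ (fun=> 1)) ?Rint_cst ?mul1r// => p /[!inE] /hE pE.
  have gp : g *m rep p != 0 by rewrite unit_nz// rep_neq0.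
  by rewrite /stretch /B -mulmxA pE unitary_nsq// divff// nsq_eq0.
have EU : setT = linsub E `|` ~` linsub E by rewrite setUv.
rewrite [in RHS]EU Rintegral_setU//.
- exact: measurableC.
- by rewrite -EU.
- by rewrite disj_set2E setICr.
Qed.

Lemma tr_frame (W : 'M[C]_n.+1) d : W *m W^t* = 1%:M -> (d <= n.+1)%N ->
  let B := pid_mx d *m W : 'M[C]_n.+1 in \tr (B^t* *m B) = d%:R.
Proof.
move=> WW dn B; rewrite /B trCM mulmxA mxtrace_mulC !mulmxA WW mul1mx.
rewrite tr_pid_mx map_pid_mx pid_mx_id// /mxtrace.
rewrite (eq_bigr (fun i : 'I_n.+1 => if (i < d)%N then 1 else 0)); last first.
  by move=> i _; rewrite mxE eqxx /=; case: ifP.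
by rewrite -big_mkcond/= (big_ord_narrow dn) sumr_const card_ord.
Qed.

Lemma weak_eval (f : PS -> R) (nu : weak_prob R n) (e : R) : continuous f -> 0 < e ->
  \forall mu \near nu, `|\int[nu]_p f p - \int[mu : weak_prob R n]_p f p| < e.
Proof.
move=> cf e0; pose F : continuousType PS R := mkcts cf.
have c2 : continuous (fun h : {ptws continuousType PS R -> R} => h F).
  move=> h.
  by have := @proj_continuous (continuousType PS R) (fun=> (R : topologicalType)) F h; exact.
pose U := (fun h : {ptws continuousType PS R -> R} => h F) @^-1` (ball (\int[nu]_p f p) e).
have oU : open U by move/continuousP : c2; apply; exact: ball_open.
have on : open_nbhs (nu : weak_prob R n) (@integral_ev R n @^-1` U).
  by split; [exists U|exact: ballxx].
exact: open_nbhs_nbhs on.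
Qed.

Lemma tr_mnorm k (H A : 'M[C]_k) (e : R) :
  (forall i j, `|rRe (A i j)| <= e /\ `|rIm (A i j)| <= e) ->
  rRe (\tr (H *m A)) <= mnorm H * e.
Proof.
move=> hA; rewrite /mxtrace Re_sum /mnorm mulr_suml; apply: ler_sum => i _.
rewrite mxE Re_sum mulr_suml; apply: ler_sum => j _.
have [h1 h2] := hA j i.
rewrite ReM (le_trans (ler_norm _))// (le_trans (ler_normB _ _))// !normrM mulrDl.
by apply: lerD; apply: ler_wpM2l.
Qed.

(** The bound does not depend on the frame, which varies with the element of the
    orbit that approximates a balanced measure. *)
Lemma mnorm_frame (W : 'M[C]_n.+1) d : W *m W^t* = 1%:M ->
  let B := pid_mx d *m W : 'M[C]_n.+1 in
  mnorm (B^t* *m B) <= \sum_(i < n.+1) \sum_(j < n.+1) (\sum_(l < n.+1) 2 + \sum_(l < n.+1) 2).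
Proof.
move=> WW /=; set B : 'M[C]_n.+1 := pid_mx d *m W; have hW := unitary_box WW.
have hB i j : `|rRe (B i j)| <= 1 /\ `|rIm (B i j)| <= 1.
  have -> : B i j = if (i < d)%N then W i j else 0.
    have -> : B i j = ((pid_mx d : 'M[C]_n.+1) *m col j W) i 0.
      by rewrite [LHS]mxE [RHS]mxE; apply: eq_bigr => l _; rewrite [col j W l 0]mxE.
    by rewrite pid_mx_coef [col j W i 0]mxE.
  by case: ifP => _; [exact: hW|rewrite normr0; split; exact: ler01].
clearbody B; apply: ler_sum => i _; apply: ler_sum => j _.
have bd (a b a' b' : R) : `|a| <= 1 -> `|b| <= 1 -> `|a'| <= 1 -> `|b'| <= 1 ->
    `|a * b| + `|a' * b'| <= 2.
  move=> h1 h2 h3 h4; rewrite !normrM.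
  by have := ler_pM (normr_ge0 _) (normr_ge0 _) h1 h2;
     have := ler_pM (normr_ge0 _) (normr_ge0 _) h3 h4; lra.
have JE (x : C) : rRe x^*%R = rRe x /\ `|rIm x^*%R| = `|rIm x|.
  by case: x => a b /=; rewrite normrN.
rewrite mxE Re_sum Im_sum; apply: lerD; apply: le_trans (ler_norm_sum _ _ _) _;
  apply: ler_sum => l _; rewrite !mxE.
- have [h1 h2] := hB l i; have [h3 h4] := hB l j.
  rewrite ReM (le_trans (ler_normB _ _))//; apply: bd => //; rewrite ?(JE _).1 ?(JE _).2//.
- have [h1 h2] := hB l i; have [h3 h4] := hB l j.
  rewrite ImM (le_trans (ler_normD _ _))//; apply: bd => //; rewrite ?(JE _).1 ?(JE _).2//.
Qed.

(** By [mass_frame] the mass of E is at most the pairing of the averaged projector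
    of some translate of nu with a projector of rank dim E; when the translate is
    close to a balanced measure, this is close to dim E / (n + 1). *)
Theorem semistable_mass nu (E : {vspace V}) : semistable nu ->
  mass nu (linsub E) <= (\dim E)%:R / n.+1%:R.
Proof.
move=> [nu' [clo /momentum_avg_eq0 bal]].
set d := \dim E.
have dn : (d <= n.+1)%N by rewrite (leq_trans (dimvS (subvf E)))// dimvf /dim/= muln1.
apply/ler_addgt0Pr => e e0.
pose K : R := \sum_(i < n.+1) \sum_(j < n.+1) (\sum_(l < n.+1) 2 + \sum_(l < n.+1) 2).
have K0 : 0 <= K by apply: sumr_ge0 => i _; apply: sumr_ge0 => j _; rewrite addr_ge0 ?sumr_ge0.
have K1 : 0 < K + 1 by lra.
have e'0 : 0 < e / (K + 1) by rewrite divr_gt0.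
have nearA : \forall mu \near (nu' : weak_prob R n), forall i j : 'I_n.+1,
   `|rRe ((n.+1%:R^-1)%:M i j - avg mu setT (@rep R n) i j)| <= e / (K + 1) /\
   `|rIm ((n.+1%:R^-1)%:M i j - avg mu setT (@rep R n) i j)| <= e / (K + 1).
  have FF : Filter (nbhs (nu' : weak_prob R n)) by exact: nbhs_filter.
  apply: (@filter_forall _ _ _ _ FF) => i; apply: (@filter_forall _ _ _ _ FF) => j.
  have N1 := weak_eval nu' (Re_line_proj_continuous (i:=i) (j:=j)) e'0.
  have N2 := weak_eval nu' (Im_line_proj_continuous (i:=i) (j:=j)) e'0.
  apply: (@filterS2 _ _ FF _ _ _ _ N1 N2) => mu h1 h2.
  by rewrite ReB ImB -bal !mxE /=; split; exact: ltW.
have [_ [[g _ <-] hg]] := clo _ nearA.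
have ug := SL_unit g.
have [W [WW hE]] := adapted_frame E (val g).
have mf := mass_frame nu ug WW hE; rewrite /= -/d in mf hE.
set B := pid_mx d *m W : 'M[C]_n.+1 in mf.
set A := avg nu setT (fun p => val g *m rep p) in mf.
have le1 : mass nu (linsub E) <= rRe (\tr (B^t* *m B *m A)).
  by rewrite -mf lerDl; apply: Rintegral_ge0 => p _; exact: stretch_ge0.
apply: le_trans le1 _.
have -> : A = (n.+1%:R^-1)%:M + (A - (n.+1%:R^-1)%:M) by rewrite addrC subrK.
rewrite mulmxDr mxtraceD ReD mul_mx_scalar mxtraceZ tr_frame//.
have -> : rRe (n.+1%:R^-1 * d%:R : C) = d%:R / n.+1%:R.
  by rewrite -!(rmorph_nat (real_complex R)) -fmorphV -rmorphM /= mulrC.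
rewrite lerD2l; apply: le_trans (_ : mnorm (B^t* *m B) * (e / (K + 1)) <= _).
  apply: tr_mnorm => i j; have := hg i j; rewrite avg_push -/A.
  have NE (x : C) : `|rRe (- x)| = `|rRe x| /\ `|rIm (- x)| = `|rIm x|.
    by case: x => x y /=; rewrite !normrN.
  set c : 'M[C]_n.+1 := (n.+1%:R^-1)%:M.
  have -> : (A - c) i j = - (c i j - A i j).
    by rewrite opprB [LHS]mxE [(- c) i j]mxE.
  by rewrite (NE _).1 (NE _).2.
rewrite mulrA ler_pdivrMr// mulrC ler_pM2l//.
by apply: le_trans (mnorm_frame d WW) _; rewrite lerDl.
Qed.
End Frame.

(** * Mass of subspaces for stable measures *)

Section Necessity.
Local Open Scope quotient_scope.
Variables (R : realType) (n : nat).
Local Notation C := R[i].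
Local Notation PS := (projspace R n).
Local Notation V := 'cV[C]_n.+1.
Implicit Types (nu : probability PS R).

Definition rdiag (x : 'I_n.+1 -> R) : 'M[C]_n.+1 := diag_mx (\row_i (x i)%:C).

Lemma rdiag_coef x (w : V) i : (rdiag x *m w) i 0 = (x i)%:C * w i 0.
Proof. by rewrite mul_diag_mx !mxE. Qed.

Lemma rdiagM x y : rdiag x *m rdiag y = rdiag (fun i => x i * y i).
Proof.
rewrite /rdiag mulmx_diag; congr diag_mx; apply/rowP => i.
by rewrite !mxE -rmorphM.
Qed.

Lemma conj_rdiag_coef (G : 'M[C]_n.+1) x i j :
  (invmx G *m rdiag x *m G) i j = \sum_l (invmx G i l * (x l)%:C) * G l j.
Proof. by rewrite mxE; apply: eq_bigr => l _; rewrite mul_mx_diag !mxE. Qed.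

Lemma mul_conj k (A A' X Y : 'M[C]_k) : A' *m A = 1%:M ->
  A *m X *m A' *m (A *m Y *m A') = A *m (X *m Y) *m A'.
Proof. by move=> AA; rewrite -!mulmxA (mulmxA A') AA mul1mx. Qed.

Lemma tr_conj k (A A' X : 'M[C]_k) : A' *m A = 1%:M -> \tr (A *m X *m A') = \tr X.
Proof. by move=> AA; rewrite mxtrace_mulC mulmxA AA mul1mx. Qed.

Lemma det_conj k (A A' X : 'M[C]_k) : A' *m A = 1%:M -> \det (A *m X *m A') = \det X.
Proof.
by move=> AA; rewrite det_mulmx mulrC -det_mulmx mulmxA AA mul1mx.
Qed.

Lemma conj_expr k (A A' X : 'M[C]_k.+1) l : A' *m A = 1%:M -> A *m A' = 1%:M ->
  (A *m X *m A') ^+ l = A *m X ^+ l *m A'.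
Proof.
move=> AA' A'A; elim: l => [|l IH]; first by rewrite !expr0 mulmx1.
by rewrite exprS IH [LHS]mul_conj// [X ^+ l.+1]exprS.
Qed.

Lemma rdiagX x k : rdiag x ^+ k = rdiag (fun i => x i ^+ k).
Proof.
elim: k => [|k IH]; first by apply/matrixP => i j; rewrite !mxE; case: eqVneq.
by rewrite exprS IH [LHS]rdiagM; under eq_fun do rewrite -exprS.
Qed.

Lemma conj_rdiagX (G : 'M[C]_n.+1) x k : G \in unitmx ->
  (invmx G *m rdiag x *m G) ^+ k = invmx G *m rdiag (fun i => x i ^+ k) *m G.
Proof. by move=> uG; rewrite conj_expr ?rdiagX ?mulmxV ?mulVmx. Qed.

Lemma expm_conj_rdiag (G : 'M[C]_n.+1) x (t : R) : G \in unitmx ->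
  expm (t%:C *: (invmx G *m rdiag x *m G)) =
  invmx G *m rdiag (fun i => expR (t * x i)) *m G.
Proof.
move=> uG; apply: limn_mx => i j.
have termE k : ((k`!%:R)^-1 *: (t%:C *: (invmx G *m rdiag x *m G)) ^+ k) i j =
    \sum_l (invmx G i l * (exp_coeff (t * x l) k)%:C) * G l j.
  rewrite expm_term conj_rdiagX// conj_rdiag_coef mulr_sumr; apply: eq_bigr => l _.
  rewrite /exp_coeff /= exprMn !rmorphM /=; ring.
have serE k : series (fun k => (k`!%:R)^-1 *: (t%:C *: (invmx G *m rdiag x *m G)) ^+ k) k i j =
    \sum_l (invmx G i l * (series (exp_coeff (t * x l)) k)%:C) * G l j.
  rewrite series_mxE /series /= (eq_bigr _ (fun k _ => termE k)) exchange_big/=.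
  apply: eq_bigr => l _.
  by rewrite (rmorph_sum (real_complex R)) mulr_sumr mulr_suml.
rewrite (funext serE) conj_rdiag_coef.
apply: ccvg_sum => l _; apply: ccvgM; last exact: ccvg_cst.
apply: ccvgM; first exact: ccvg_cst.
split; rewrite /=; last exact: cvg_cst.
exact: is_cvg_series_exp_coeff.
Qed.

Lemma null_eq nu (A B N : set PS) : measurable A -> measurable B -> measurable N ->
  nu N = 0%E -> (forall p, ~ N p -> A p <-> B p) -> nu A = nu B.
Proof.
move=> mA mB mN N0 AB; have mN0 : mass nu N = 0 by rewrite /mass N0.
have le (S S' : set PS) : measurable S -> measurable S' ->
    (forall p, ~ N p -> S p -> S' p) -> mass nu S <= mass nu S'.
  move=> mS mS' h; have := mass_le nu mS (measurableU _ _ mS' mN).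
  move=> /(_ _)/le_trans; apply.
    by move=> p Sp; have [Np|Np] := pselect (N p); [right|left; exact: h].
  by apply: le_trans (mass_setU_le nu mS' mN) _; rewrite mN0 addr0.
rewrite (mass_fin nu mA) (mass_fin nu mB); congr (_%:E); apply/eqP; rewrite eq_le.
by rewrite !le// => p Np; have [h1 h2] := AB p Np.
Qed.

(** A skew-Hermitian matrix cannot be conjugate to a nonzero real diagonal
    one: the traces of the squares have opposite signs. *)
Lemma su_conj_rdiag (G h : 'M[C]_n.+1) x : G \in unitmx -> h \in unitmx ->
  su (h *m (invmx G *m rdiag x *m G) *m invmx h) -> forall i, x i = 0.
Proof.
move=> uG uh [skew _].
set X := invmx G *m rdiag x *m G in skew; set Z := h *m X *m invmx h in skew.
have trZ : \tr (Z *m Z) = (\sum_i x i ^+ 2)%:C.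
  rewrite /Z mul_conj ?mulVmx// tr_conj ?mulVmx// /X mul_conj ?mulmxV//.
  rewrite tr_conj ?mulmxV// rdiagM mxtrace_diag.
  by rewrite (rmorph_sum (real_complex R)); apply: eq_bigr => i _; rewrite mxE expr2.
have : rRe (\tr (Z^t* *m Z)) = - \sum_i x i ^+ 2.
  have -> : \tr (Z^t* *m Z) = - \tr (Z *m Z) by rewrite skew mulNmx raddfN.
  by rewrite trZ.
have : 0 <= rRe (\tr (Z^t* *m Z)).
  rewrite /mxtrace Re_sum; apply: sumr_ge0 => i _; rewrite mxE Re_sum.
  by apply: sumr_ge0 => j _; rewrite !mxE mul_conj_sqn sqn_ge0.
move=> h1 h2; have s0 : \sum_i x i ^+ 2 = 0.
  have : 0 <= \sum_i x i ^+ 2 by apply: sumr_ge0 => i _; exact: sqr_ge0.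
  lra.
move=> i; apply/eqP; rewrite -sqrf_eq0; apply/eqP.
move/eqP: s0; rewrite psumr_eq0; last by move=> j _; exact: sqr_ge0.
by move=> /allP/(_ i (mem_index_enum i))/eqP.
Qed.

(** If E had its full share, [mass_frame] would put almost every line of the
    balanced translate in g E or its orthogonal complement. The matrix X acting by
    n + 1 - d and - d on their preimages under g would generate a one-parameter
    group that fixes nu, against [su_conj_rdiag]. *)
Theorem stable_mass nu (E : {vspace V}) : stable nu -> E != 0%VS -> E != fullv ->
  mass nu (linsub E) < (\dim E)%:R / n.+1%:R.
Proof.
move=> [[g /momentum_avg_eq0 bal] [h hh]] E0 Ef.
set d := \dim E; rewrite avg_push in bal.
have fullE : \dim {:V} = n.+1 by rewrite dimvf /dim/= muln1.
have d0 : (0 < d)%N by rewrite lt0n dimv_eq0.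
have dn : (d < n.+1)%N.
  rewrite ltn_neqAle -{2}fullE dimvS ?subvf// andbT.
  by apply: contraNneq Ef => dE; rewrite eqEdim subvf fullE -/d dE leqnn.
have ug := SL_unit g.
have [W [WW hE]] := adapted_frame E (val g).
have mf := mass_frame nu ug WW hE; rewrite /= -/d in mf hE.
set B := pid_mx d *m W : 'M[C]_n.+1 in mf.
have tB : rRe (\tr (B^t* *m B *m avg nu setT (fun p => val g *m rep p))) = d%:R / n.+1%:R.
  rewrite bal mul_mx_scalar mxtraceZ tr_frame//; last exact: ltnW.
  by rewrite -!(rmorph_nat (real_complex R)) -fmorphV -rmorphM /= mulrC.
rewrite tB in mf.
set I0 := \int[nu]_(p in _) _ in mf.
have I00 : 0 <= I0 by apply: Rintegral_ge0 => p _; exact: stretch_ge0.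
suff : I0 != 0 by move=> I1; rewrite -mf ltrDl lt_neqAle eq_sym I1.
apply/negP => /eqP I1.
have rl := random_line_unit (random_line_rep R n) ug.
have mE := measurable_linsub E.
have mC : measurable (~` linsub E) by exact: measurableC.
have mq : measurable_fun (~` linsub E) (fun p => stretch B (val g *m rep p)).
  by apply: measurable_funS (measurable_stretch rl B).
have iq : nu.-integrable (~` linsub E) (EFin \o (fun p => stretch B (val g *m rep p))).
  apply: (@bounded_integrable _ _ _ nu _ _ (mnorm (B^t* *m B))) => // p _.
  by rewrite ger0_norm ?stretch_ge0// stretch_bound.
have [N [mN N0 hN]] : ae_eq nu (~` linsub E) (EFin \o (fun p => stretch B (val g *m rep p))) (cst 0)%E.
  apply/(ae_eq_integral_abs _ mC); first exact/measurable_EFinP.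
  rewrite (@eq_integral _ _ _ _ _ (EFin \o (fun p => stretch B (val g *m rep p)))).
    move: I1; rewrite /I0 /Rintegral => I1; rewrite -[LHS]fineK ?I1//.
    by apply: integrable_fin_num.
  by move=> p _ /=; rewrite ger0_norm// stretch_ge0.
have split p : ~ N p -> p \in linsub E \/ B *m (val g *m rep p) = 0.
  move=> Np; have [Ep|Ep] := pselect (linsub E p); first by left; exact/mem_set.
  right; apply/eqP; rewrite -stretch_eq0 ?unit_nz ?rep_neq0//; apply/eqP.
  apply: contra_notP Np => qp; apply: hN => /= H; apply: qp.
  by have [] := H Ep.
(* The eigenvalues are weighted so that the trace is 0. *)
pose x (i : 'I_n.+1) : R := if (i < d)%N then n.+1%:R - d%:R else - d%:R.
pose G := W *m val g.
have uW : W \in unitmx by have [] := mulmx1_unit WW.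
have uG : G \in unitmx by rewrite unitmx_mul uW.
have Gp p : G *m rep p = W *m (val g *m rep p) by rewrite mulmxA.
clearbody G.
pose X := invmx G *m rdiag x *m G.
have sx : \sum_i x i = 0.
  have dn' := ltnW dn.
  rewrite (eq_bigr (fun i : 'I_n.+1 => (if (i < d)%N then n.+1%:R else 0) - d%:R)).
    rewrite sumrB -big_mkcond/= (big_ord_narrow dn') !sumr_const !card_ord.
    have e (a b : nat) : a%:R *+ b = b%:R *+ a :> R by rewrite -!mulrnA mulnC.
    by rewrite (e n.+1 d) subrr.
  by move=> i _; rewrite /x; case: ifP; rewrite ?sub0r.
have lX : lie_algebra (stabilizer nu) X.
  move=> t; pose y (i : 'I_n.+1) := expR (t * x i).
  have dk : \det (invmx G *m rdiag y *m G) == 1.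
    rewrite det_conj ?mulmxV// det_diag.
    under eq_bigr do rewrite mxE.
    by rewrite -rmorph_prod /= -expR_sum -mulr_sumr sx mulr0 expR0.
  exists (exist (fun g : 'M[C]_n.+1 => \det g == 1) _ dk); last by rewrite /= expm_conj_rdiag.
  set k : SL R n := exist _ _ _.
  have fix_k p : ~ N p -> SL_act k p = p.
    move=> Np.
    have [c c0 kp] : exists2 c : C, c != 0 & val k *m rep p = c *: rep p.
      suff [c c0 yc] : exists2 c : R, 0 < c & rdiag y *m (G *m rep p) = c%:C *: (G *m rep p).
        exists c%:C; first by rewrite fmorph_eq0 gt_eqF.
        by rewrite /= -!mulmxA yc -scalemxAr mulKmx.
      have [/set_mem Ep|Bp] := split p Np.
        exists (expR (t * (n.+1%:R - d%:R))); first exact: expR_gt0.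
        apply/colP => i; rewrite rdiag_coef [RHS]mxE.
        have : ((pid_mx d : 'M[C]_n.+1) *m (G *m rep p)) i 0 = (G *m rep p) i 0 by rewrite Gp hE.
        rewrite pid_mx_coef /y /x; case: ifP => // _ <-; by rewrite !mulr0.
      exists (expR (t * - d%:R)); first exact: expR_gt0.
      apply/colP => i; rewrite rdiag_coef [RHS]mxE.
      have : ((pid_mx d : 'M[C]_n.+1) *m (G *m rep p)) i 0 = 0.
        by rewrite Gp mulmxA Bp mxE.
      by rewrite pid_mx_coef /y /x; case: ifP => // _ ->; rewrite !mulr0.
    rewrite -[RHS]reprK; apply/(@eqmodP _ (@same_line_equiv R n))/asboolP.
    exists c^-1; first by rewrite invr_eq0.
    have kp' : val k *m \val (repr p) = c *: \val (repr p) := kp.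
    by rewrite /= kp' scalerA mulVf// scale1r.
  move=> A mA.
  have mkA : measurable (SL_act k @^-1` A).
    by rewrite -[_ @^-1` _]setTI; exact: SL_act_measurable.
  rewrite /push /distribution /pushforward /=.
  by apply: (null_eq mkA mA mN N0) => p /fix_k; rewrite /preimage /= => ->.
have := hh _ (ex_intro2 _ _ X lX (erefl _)).
move=> /(su_conj_rdiag uG (SL_unit h)) /(_ ord0).
rewrite /x d0; apply/eqP; rewrite subr_eq0 eqr_nat.
by rewrite gtn_eqF.
Qed.
End Necessity.

(** * Weak limits under one-parameter subgroups *)

Section Degeneration.
Local Open Scope quotient_scope.
Variables (R : realType) (n : nat).
Local Notation C := R[i].
Local Notation PS := (projspace R n).
Local Notation V := 'cV[C]_n.+1.
Local Notation pi := (\pi_PS).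
Implicit Types (nu : probability PS R).

(** The topology is the coarsest for which integrals of continuous functions are
    continuous, so that convergence is tested on these integrals. *)
Lemma weak_cvg (nu : nat -> probability PS R) (mu : probability PS R) :
  (forall f : PS -> R, continuous f ->
     (fun s => \int[nu s]_p f p) @ \oo --> \int[mu]_p f p) ->
  (nu : nat -> weak_prob R n) @ \oo --> (mu : weak_prob R n).
Proof.
move=> h.
have H : ((fun s => integral_ev (nu s)) : nat -> {ptws continuousType PS R -> R}) @ \oo -->
       (integral_ev mu : {ptws continuousType PS R -> R}).
  apply/cvg_sup => F; apply/cvg_image.
    by rewrite eqEsubset; split=> v // _; exists (cst v).
  move=> W /= hW.
  have hF := h F (@cts_fun _ _ F) _ hW.
  exists ((fun g => g F) @^-1` W) => //.
  by rewrite eqEsubset; split => [j [? + <-//]|j Wj]; exists (fun _ => j).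
move=> B; rewrite nbhsE => - [_ [[Q oQ <-] Qmu]] QB.
have : nbhs (integral_ev mu : {ptws continuousType PS R -> R}) Q by exact: open_nbhs_nbhs.
move=> /H hQ.
by apply: (@filterS _ (nbhs \oo) _ _ _ _ hQ) => s; exact: QB.
Qed.

Lemma pi_eq (x y : nzvec R n) (c : C) : c != 0 -> \val y = c *: \val x -> pi x = pi y.
Proof.
by move=> c0 xy; apply/(@eqmodP _ (@same_line_equiv R n))/asboolP; exists c.
Qed.

Lemma SL_scale (g : 'M[C]_n.+1) : g \in unitmx ->
  exists k : SL R n, exists2 c : C, c != 0 & val k = c *: g.
Proof.
move=> ug; pose c := n.+1.-root (\det g)^-1.
have dg : \det g != 0 by move: ug; rewrite unitmxE unitfE.
have cn : c ^+ n.+1 = (\det g)^-1 by rewrite rootCK.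
have c0 : c != 0.
  by apply: contraNneq (invr_neq0 dg) => c0; rewrite -cn c0 expr0n.
have d1 : \det (c *: g) == 1 by rewrite detZ cn mulVf.
by exists (exist (fun g : 'M[C]_n.+1 => \det g == 1) _ d1), c.
Qed.

Section Limit.
Variables (g : 'M[C]_n.+1) (al : 'I_n.+1 -> nat).
Hypothesis ug : g \in unitmx.

Let w p := g *m rep p : V.
Let w0 p : w p != 0. Proof. by rewrite unit_nz// rep_neq0. Qed.

Definition limit_vec (p : PS) : nzvec R n :=
  exist (fun z => z \in nzvec R n) _ (mem_set (initial_form_neq0 al (w0 p)) : _ \in nzvec R n).

Definition limit_map (p : PS) : PS := pi (limit_vec p).

Let pr (i : 'I_n.+1) : 'M[C]_n.+1 := rdiag (fun j => (al j == al i)%:R).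

Let prE i x : pr i *m x = \col_j (if al j == al i then x j 0 else 0).
Proof.
apply/colP => j; rewrite rdiag_coef [RHS]mxE.
by case: ifP; rewrite ?mul1r ?mul0r.
Qed.

Let wmax_at (i : 'I_n.+1) (x : V) : x i 0 != 0 ->
  (forall j : 'I_n.+1, (al i < al j)%N -> x j 0 = 0) -> wmax al x = al i.
Proof.
move=> xi h; apply/eqP; rewrite eqn_leq; apply/andP; split.
  by apply/bigmax_leqP => j xj; rewrite leqNgt; apply: contra xj => /h ->.
exact: (leq_bigmax_cond (F := al)).
Qed.

Let wmax_ex (x : V) : x != 0 -> exists i, x i 0 != 0 /\
  (forall j : 'I_n.+1, (al i < al j)%N -> x j 0 = 0).
Proof.
move=> /colv_neq0[j xj].
have c0 : (0 < #|[pred j | (x j 0 != 0)%R]|)%N by apply/card_gt0P; exists j.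
have [i xi imax] := eq_bigmax_cond al c0; exists i; split; first by [].
move=> l il; apply/eqP; apply: contraTT il => xl.
by rewrite -leqNgt -imax; apply: leq_bigmax_cond.
Qed.

(** On each of the finitely many Borel pieces where a given coordinate i is
    nonzero and of greatest weight, the initial form of g z is a linear image
    of z. *)
Lemma limit_map_measurable : measurable_fun setT limit_map.
Proof.
apply: (@measurability _ _ _ _ setT limit_map (@open PS)) => // _ [U oU <-].
rewrite setTI.
have [B oB BU] : exists2 B : set V, open B & forall z : nzvec R n, U (pi z) <-> B (\val z).
  have : open ((fun z : nzvec R n => pi z) @^-1` U) by exact: oU.
  move=> [B oB BE]; exists B => // z.
  by have := congr1 (fun S : set (nzvec R n) => S z) BE; rewrite /preimage /= => ->.
(* The set B, the preimage of U, is a cone. *)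
have BZ c (x : V) : c != 0 -> x != 0 -> B (c *: x) <-> B x.
  move=> c0 x0; have nx : x \in nzvec R n by exact/mem_set.
  have ncx : c *: x \in nzvec R n by apply/mem_set; rewrite /nzvec /= scaler_eq0 negb_or c0.
  pose x1 : nzvec R n := exist (fun z => z \in nzvec R n) _ nx.
  pose x2 : nzvec R n := exist (fun z => z \in nzvec R n) _ ncx.
  by rewrite -[B x]/(B (val x1)) -[B (c *: x)]/(B (val x2)) -!BU (@pi_eq x1 x2 c c0 erefl).
pose D i (p : PS) := (w p i 0 != 0) /\ (forall j : 'I_n.+1, (al i < al j)%N -> w p j 0 = 0).
pose G i (p : PS) := pr i *m w p != 0 /\ B (pr i *m w p).
have rl := random_line_rep R n.
have coordE j p : (w p j 0 = 0) <-> (delta_mx j j *m g : 'M[C]_n.+1) *m rep p = 0.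
  rewrite -mulmxA -/(w p); split => [h|/colP/(_ j) h].
    by apply/colP => i; rewrite delta_mx_coef h mulr0 mxE.
  by move: h; rewrite delta_mx_coef eqxx mul1r => ->; rewrite mxE.
have mcoord j : measurable [set p | w p j 0 = 0].
  rewrite (_ : [set p | _] = setT `&` [set p | (delta_mx j j *m g : 'M[C]_n.+1) *m rep p = 0]).
    exact: measurable_ker.
  by rewrite setTI; apply/seteqP; split => p /coordE.
have mD i : measurable [set p | D i p].
  rewrite (_ : [set p | _] = ~` [set p | w p i 0 = 0] `&`
     \bigcap_(j in [set j : 'I_n.+1 | (al i < al j)%N]) [set p | w p j 0 = 0]).
    apply: measurableI; first exact: measurableC.
    by apply: fin_bigcap_measurable => // j _.
  apply/seteqP; split => p [h1 h2]; split => //=.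
  - by move/eqP; exact/negP.
  - exact: (introN eqP h1).
have mG i : measurable [set p | G i p].
  apply: open_measurable_PS.
  have o1 : open [set x : V | pr i *m g *m x != 0].
    rewrite (_ : [set x : V | _] = ~` ((fun x : V => nsq (pr i *m g *m x)) @^-1` [set 0])).
      apply: closed_openC; apply: closed_comp; last exact: closed_eq.
      move=> x _; apply: continuous_comp; first exact: mulmx_continuous.
      exact: nsq_continuous.
    apply/seteqP; split => x /=; first by move=> h /eqP; rewrite nsq_eq0; exact/negP.
    by move=> h; apply/negP; rewrite -nsq_eq0; move/eqP.
  have oG : open [set x : V | pr i *m g *m x != 0 /\ B (pr i *m g *m x)].
    apply: openI; first exact: o1.
    by move/continuousP : (@mulmx_continuous R n (pr i *m g)); apply.
  exists [set x : V | pr i *m g *m x != 0 /\ B (pr i *m g *m x)] => //.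
  apply/seteqP; split => z /=; have [c c0 e] := rep_pi z;
    rewrite /G /w e -!scalemxAr mulmxA scaler_eq0 negb_or c0 => -[h1 h2];
    by split => //; move: h2; rewrite BZ.
have initE i p : D i p -> initial_form al (w p) = pr i *m w p.
  by move=> [h1 h2]; rewrite /initial_form (wmax_at h1 h2) prE.
rewrite (_ : _ @^-1` _ = \bigcup_(i in [set: 'I_n.+1]) ([set p | D i p] `&` [set p | G i p])).
  by apply: fin_bigcup_measurable => // i _; apply: measurableI.
apply/seteqP; split => p.
  rewrite /preimage /= /limit_map => /BU /= Bp.
  have [i Di] := wmax_ex (w0 p); exists i => //; split => //=.
  by rewrite /G -initE//; split => //; exact: initial_form_neq0.
move=> [i _ [/= Di [h1 h2]]]; rewrite /preimage /= /limit_map; apply/BU => /=.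
by rewrite (initE i).
Qed.

HB.instance Definition _ :=
  isMeasurableFun.Build _ _ _ _ limit_map limit_map_measurable.

Let ratio_cvg (a b : nat) : (a <= b)%N ->
  (fun s : nat => (s.+1%:R ^+ b)^-1 * s.+1%:R ^+ a : R) @ \oo --> ((a == b)%:R : R).
Proof.
rewrite leq_eqVlt => /orP[/eqP ->|ab].
  rewrite eqxx; under eq_fun do rewrite mulVf ?expf_neq0 ?pnatr_eq0//.
  exact: cvg_cst.
rewrite ltn_eqF//; apply: (@squeeze_cvgr _ _ _ _ (fun=> 0) (@harmonic R)); last 2 first.
- exact: cvg_cst.
- exact: cvg_harmonic.
near=> s; rewrite mulr_ge0 ?invr_ge0 ?exprn_ge0//= /harmonic.
have s0 : 0 < s.+1%:R :> R by rewrite ltr0n.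
rewrite -(subnKC (ltnW ab)) exprD invfM mulrAC mulVf ?mul1r; last by rewrite expf_neq0// gt_eqF.
rewrite lef_pV2 ?posrE ?exprn_gt0// ler_eXnr ?subn_gt0//.
by rewrite ler1n.
Unshelve. all: by end_near.
Qed.

Let lam s := rdiag (fun i => s.+1%:R ^+ al i : R).

Let lam_unit s : lam s \in unitmx.
Proof.
rewrite unitmxE unitfE det_diag; apply/prodf_neq0 => i _.
by rewrite mxE fmorph_eq0 expf_neq0// pnatr_eq0.
Qed.

(** After division by s^M, where M is the greatest weight on the line, the
    coordinate i is multiplied by s^(al i - M), which tends to 1 or to 0. The
    determinant is normalised by a scalar, which does not move lines. *)
Lemma limit_map_approx : exists k : nat -> SL R n, forall p,
  (fun s => SL_act (k s) p) @ \oo --> limit_map p.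
Proof.
have ul s : lam s *m g \in unitmx by rewrite unitmx_mul lam_unit.
pose k s := sval (cid (SL_scale (ul s))); exists k => p.
pose M := wmax al (w p).
pose x s : V := ((s.+1%:R ^+ M)^-1 : R)%:C *: (lam s *m w p).
have r0 s : ((s.+1%:R ^+ M)^-1 : R)%:C != 0 :> C.
  by rewrite fmorph_eq0 invr_eq0 expf_neq0// pnatr_eq0.
have x0 s : x s \in nzvec R n.
  by apply/mem_set; rewrite /nzvec /= scaler_eq0 negb_or r0 unit_nz.
pose X s : nzvec R n := exist (fun z => z \in nzvec R n) _ (x0 s).
have kX s : SL_act (k s) p = pi (X s).
  rewrite /SL_act /k; case: cid => h /= [c c0 hE].
  apply: (@pi_eq _ _ (((s.+1%:R ^+ M)^-1 : R)%:C * c^-1)); first by rewrite mulf_neq0 ?invr_eq0.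
  rewrite /= hE /x /w -/(rep p) -scalemxAl scalerA -mulrA mulVf// mulr1.
  by rewrite mulmxA.
rewrite (funext kX); apply: pi_cvg; apply/mx_cvgP => i j; rewrite !ord1 /=.
have xE s : x s i 0 = ((s.+1%:R ^+ M)^-1 * s.+1%:R ^+ al i)%:C * w p i 0.
  by rewrite mxE rdiag_coef mulrA -rmorphM.
have -> : initial_form al (w p) i 0 = if al i == M then w p i 0 else 0 by rewrite [LHS]mxE.
rewrite (funext xE).
have [wi|wi] := eqVneq (w p i 0) 0.
  rewrite wi if_same; under eq_fun do rewrite mulr0; exact: ccvg_cst.
have aM : (al i <= M)%N by exact: (leq_bigmax_cond (F := al)).
have -> : (if al i == M then w p i 0 else 0) = ((al i == M)%:R : R)%:C * w p i 0.
  by case: eqP; rewrite ?mul1r ?mul0r.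
apply: ccvgM; last exact: ccvg_cst.
by split; rewrite /=; [exact: ratio_cvg|exact: cvg_cst].
Qed.

(** Pointwise convergence of the maps and dominated convergence. *)
Lemma push_limit nu : exists k : nat -> SL R n,
  ((fun s => push (k s) nu) : nat -> weak_prob R n) @ \oo -->
  (distribution nu limit_map : weak_prob R n).
Proof.
have [k hk] := limit_map_approx; exists k; apply: weak_cvg => f cf.
have [M hM] := continuous_bounded cf.
have mf := continuous_measurable cf.
have kE s : \int[push (k s) nu]_p f p = \int[nu]_p f (SL_act (k s) p).
  exact: (Rint_distribution nu (SL_act (k s)) mf hM).
rewrite (funext kE) (Rint_distribution nu limit_map mf hM).
have mk s : measurable_fun setT (fun p => f (SL_act (k s) p)) by apply: measurableT_comp.
have mphi : measurable_fun setT (fun p => f (limit_map p)) by apply: measurableT_comp.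
have iphi : nu.-integrable setT (EFin \o (fun p => f (limit_map p))).
  by apply: (@bounded_integrable _ _ _ nu _ _ M) => // p _.
have ae_cvg : {ae nu, forall p, setT p ->
    (fun s => (f (SL_act (k s) p))%:E) @ \oo --> (f (limit_map p))%:E}.
  apply: aeW => p _; apply: cvg_EFin; first exact: nearW.
  by apply: (cvg_comp (fun s => SL_act (k s) p) f (hk p)); exact: cf.
have ae_le : {ae nu, forall p s, setT p -> (`|(f (SL_act (k s) p))%:E| <= M%:E)%E}.
  by apply: aeW => p s _; rewrite abse_EFin lee_fin; exact: hM.
have iM : nu.-integrable setT (fun=> M%:E).
  by apply: (@bounded_integrable _ _ _ nu setT (fun=> M) `|M|).
have [_ _ dc] := @dominated_convergence _ _ _ nu setT measurableT
  (fun s p => (f (SL_act (k s) p))%:E) (fun p => (f (limit_map p))%:E) (fun=> M%:E)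
  (fun s => (measurable_EFinP _ _).2 (mk s)) ((measurable_EFinP _ _).2 mphi) ae_cvg iM ae_le.
apply: fine_cvg; rewrite fineK//; exact: (integrable_fin_num measurableT iphi).
Qed.
End Limit.

Theorem spread_semistable nu : spread nu setT (@rep R n) -> semistable nu.
Proof.
move=> sn; have [g [al [ug rl bal]]] := spread_degenerates (random_line_rep R n) sn.
have [k hk] := push_limit al ug nu.
exists ((distribution nu (limit_map al ug) : probability PS R) : weak_prob R n); split.
  move=> B /hk [s _ hs]; exists (push (k s) nu); split; first by exists (k s).
  exact: (hs s (leqnn s)).
apply/momentum_avg_eq0; rewrite (avg_distribution nu (w := fun p => initial_form al (g *m rep p))).
  by rewrite bal /mass probability_setT mul1r fmorphV rmorph_nat.
by move=> p; rewrite /limit_map line_proj_rep_pi.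
Qed.
End Degeneration.

Theorem theorem7p6 (R : realType) (n : nat)
    (nu : probability (projspace R n) R) :
  (stable nu <->
     forall E : {vspace 'cV[R[i]]_n.+1}, E != 0%VS -> E != fullv ->
       (nu (linsub E) < ((linsub_dim E + 1)%:R / n.+1%:R)%:E)%E) /\
  (semistable nu <->
     forall E : {vspace 'cV[R[i]]_n.+1}, E != 0%VS -> E != fullv ->
       (nu (linsub E) <= ((linsub_dim E + 1)%:R / n.+1%:R)%:E)%E).
Proof.
split; split.
- move=> st E E0 Ef; rewrite linsub_dimE// (mass_fin nu (measurable_linsub E)) lte_fin.
  exact: stable_mass.
- by move=> /linsub_strictly_spread; exact: strictly_spread_stable.
- move=> ss E E0 _; rewrite linsub_dimE// (mass_fin nu (measurable_linsub E)) lee_fin.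
  exact: semistable_mass.
- by move=> /linsub_spread; exact: spread_semistable.
Qed.
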